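(* Let $f(z)=z+a_2z^2+a_3z^3+\cdots\in\mathcal{C}_{\arcsin}$ with logarithmic coefficients $\gamma_n$, and let $H_{2,1}(F_f/2)=\gamma_1\gamma_3-\gamma_2^2$. Then $$|H_{2,1}(F_f/2)|\le \frac{1}{36\pi^2}.$$ The inequality is sharp, i.e. there is a function in $\mathcal{C}_{\arcsin}$ for which equality holds.
   Context: Let $\Omega=\{z\in\mathbb{C}:|z|<1\}$. Let $\mathcal{A}$ be the family of analytic functions $f$ in $\Omega$ normalized by $f(z)=z+\sum_{n=2}^{\infty}a_nz^n$, and let $\mathcal{S}\subset\mathcal{A}$ be the subclass of univalent functions. A Schwarz function is an analytic $\omega:\Omega\to\mathbb{C}$ with $\omega(0)=0$ and $|\omega(z)|\le 1$ on $\Omega$. For analytic $g,h$ in $\Omega$, $g\prec h$ (subordination) means that there is a Schwarz function $\omega$ with $g(z)=h(\omega(z))$ for all $z\in\Omega$. With $\arcsin$ the principal branch ($\arcsin 0=0$), define $$\mathcal{C}_{\arcsin}=\left\{f\in\mathcal{S}:\ 1+\frac{zf''(z)}{f'(z)}\prec 1+\frac{2}{\pi}\arcsin z \text{ in } \Omega\right\}.$$ The logarithmic coefficients $\gamma_n$ of $f\in\mathcal{S}$ are defined by $F_f(z)=\log\left(\frac{f(z)}{z}\right)=2\sum_{n=1}^{\infty}\gamma_nz^n$ with $\log 1=0$. Thus $\gamma_1=\frac12a_2$, $\gamma_2=\frac12\left(a_3-\frac12a_2^2\right)$, $\gamma_3=\frac12\left(a_4-a_2a_3+\frac13a_2^3\right)$.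 *)

(* Defs.v *)
From Stdlib Require Import Reals.
From Coquelicot Require Import Coquelicot.

Open Scope R_scope.
Open Scope C_scope.

Definition Omega (z : C) : Prop := Cmod z < 1.

(* Analytic in the open disc means complex differentiable at each of its
   points.  Functions on the disc are total functions C -> C; their values
   outside Omega are never used. *)
Definition analytic (g : C -> C) : Prop :=
  forall z : C, Omega z -> @ex_derive C_AbsRing C_NormedModule g z.

Definition power_series (c : nat -> C) (z s : C) : Prop :=
  @is_pseries C_AbsRing C_NormedModule c z s.

Definition univalent (f : C -> C) : Prop :=
  forall z w : C, Omega z -> Omega w -> f z = f w -> z = w.

Definition class_A (f : C -> C) : Prop :=
  analytic f /\
  exists a : nat -> C,
    a 0%nat = 0 /\ a 1%nat = 1 /\
    forall z : C, Omega z -> power_series a z (f z).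

Definition class_S (f : C -> C) : Prop := class_A f /\ univalent f.

Definition Schwarz (w : C -> C) : Prop :=
  analytic w /\ w 0 = 0 /\ forall z : C, Omega z -> (Cmod (w z) <= 1)%R.

Definition subordinate (g h : C -> C) : Prop :=
  exists w : C -> C, Schwarz w /\ forall z : C, Omega z -> g z = h (w z).

Definition Cexp (z : C) : C :=
  ((exp (Re z) * cos (Im z))%R, (exp (Re z) * sin (Im z))%R).

(* Principal argument, in ]-PI, PI], of z <> 0. *)
Definition Carg (z : C) : R :=
  if Rle_dec 0 (Im z) then acos (Re z / Cmod z) else (- acos (Re z / Cmod z))%R.

Definition Clog (z : C) : C := (ln (Cmod z), Carg z).

(* Principal square root of z <> 0; the value at 0 is irrelevant, since
   Carcsin below is only evaluated at points of Omega, where 1 - z^2 <> 0. *)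
Definition Csqrt (z : C) : C := Cexp (Clog z / 2).

(* arcsin z = -i Log (i z + sqrt (1 - z^2)), all branches principal. *)
Definition Carcsin (z : C) : C := - Ci * Clog (Ci * z + Csqrt (1 - z ^ 2)).

Definition class_C_arcsin (f : C -> C) : Prop :=
  class_S f /\
  subordinate
    (fun z => 1 + z * C_derive (C_derive f) z / C_derive f z)
    (fun z => 1 + 2 / PI * Carcsin z).

(* F is the analytic branch of log (f(z)/z) in Omega with F(0) = log 1 = 0
   (f(z)/z extends by 1 to z = 0). *)
Definition is_log_quotient (f F : C -> C) : Prop :=
  analytic F /\ F 0 = 0 /\
  forall z : C, Omega z -> z <> 0 -> Cexp (F z) = f z / z.

(* F_f(z) = 2 * (sum over n >= 1 of gamma_n z^n); gamma 0 plays no role. *)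
Definition log_coefficients (f : C -> C) (gamma : nat -> C) : Prop :=
  exists F : C -> C,
    is_log_quotient f F /\
    forall z : C, Omega z ->
      power_series (fun n => match n with O => 0 | S _ => 2 * gamma n end)
        z (F z).

(* H_{2,1}(F_f/2) *)
Definition H21 (gamma : nat -> C) : C :=
  gamma 1%nat * gamma 3%nat - gamma 2%nat ^ 2.

(* Main.v *)
Require Import Defs.
From Stdlib Require Import Reals Ranalysis5 Wf_nat Lra Lia.
From Coquelicot Require Import Coquelicot.

(* Write [w z = c1 z + c2 z^2 + c3 z^3 + ...] for the Schwarz function of [f].
   Comparing coefficients gives [H21 = E / (36 PI^2)] with
     [E = 3/2 c1 c3 + b/4 c1^2 c2 + (1/4 - b^2/16) c1^4 - c2^2],  [b = 2 / PI].
   As [f] is a power series and [w = sin (PI/2 z f''/f')], the function [w] has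
   a continuous derivative, so that circle means of [w U V / z^3], with [U], [V]
   quadratic polynomials, give the coefficient of [z^3] in [w U V].  Hence the
   triangular Toeplitz matrix of [(c1, c2, c3)] is a contraction; with
   [q = 1 - |c1|^2] this yields [|q c3 + conj c1 c2^2| <= q^2 - |c2|^2], from
   which [|E| <= 1] is elementary.  Equality holds for [w z = z^2]: the solution
   of [z p' = b arcsin (z^2) p], [p 0 = 1], has Taylor coefficients [p_n >= 0] with
   [p_1 + p_2 + ... <= 1], so [Re p > 0] and its primitive [f] is univalent. *)

Local Open Scope C_scope.

(** * Complex differentiability *)

(** [analytic] is mere complex differentiability at each point, so no regularity of the Schwarz
    function [w] is available at the start. Solving the subordination for [w] transfers to it the
    smoothness of the power series of [f], but only where [f'] is nonzero and [w^2 <> 1]: elsewhere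
    division and [Carcsin] return junk values. Both facts therefore come first, from a differential
    inequality along rays. Circle means are then handled by differentiation under the integral sign,
    and coefficients by expansions up to [O(z^4)], which pass through products, quotients, [Cexp]
    and [Csin]. For sharpness, [f'], [arcsin (z^2)] and [log (f z / z)] are each given by a
    recursion for real coefficients. Bounded coefficients give convergence on the disc; functional
    identities hold because some expression has derivative 0. That [p_1 + p_2 + ... <= 1] rests on
    the coefficients of [arcsin (z^2)] having sum at most [PI / 2], which the factor [2 / PI] of the
    class turns into 1. *)

Definition cderiv (f : C -> C) (z d : C) : Prop :=
  @is_derive C_AbsRing C_NormedModule f z d.

Lemma C_ext (z w : C) : Re z = Re w -> Im z = Im w -> z = w.
Proof. destruct z, w; simpl; now intros -> ->. Qed.

(** Replaces the filters in the definition of the derivative by estimates in [Cmod], the form in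
    which concrete derivatives are verified and exploited. *)
Lemma cderiv_iff (f : C -> C) (z d : C) :
  cderiv f z d <->
  forall eps : R, (0 < eps)%R -> exists delta : R, (0 < delta)%R /\
    forall w : C, (Cmod (w - z) < delta)%R ->
      (Cmod (f w - f z - (w - z) * d) <= eps * Cmod (w - z))%R.
Proof.
split.
- intros [_ H] eps Heps.
  specialize (H z (fun P HP => HP)). specialize (H (mkposreal eps Heps)).
  apply locally_C in H.
  destruct H as [delta H]. exists delta; split; [apply cond_pos|].
  intros w Hw. apply H. apply C_NormedModule_mixin_compat1. exact Hw.
- intros H. split; [apply is_linear_scal_l|].
  intros x Hx eps.
  assert (E : z = x) by exact (is_filter_lim_locally_unique (V := AbsRing_NormedModule C_AbsRing) z x Hx).
  subst x.
  destruct (H eps (cond_pos eps)) as [delta [Hd H']].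
  exists (mkposreal delta Hd). intros w Hw. apply H'. exact Hw.
Qed.

Lemma cderiv_ext_loc (f g : C -> C) (z d : C) (rho : R) :
  (0 < rho)%R -> (forall w : C, (Cmod (w - z) < rho)%R -> f w = g w) ->
  cderiv f z d -> cderiv g z d.
Proof.
intros Hr E H. apply cderiv_iff. intros eps He.
destruct (proj1 (cderiv_iff f z d) H eps He) as [delta [Hd H']].
exists (Rmin delta rho). split; [now apply Rmin_pos|].
intros w Hw. rewrite <- !E.
- apply H'. eapply Rlt_le_trans; [exact Hw|apply Rmin_l].
- replace (z - z) with (RtoC 0) by ring. rewrite Cmod_0. exact Hr.
- eapply Rlt_le_trans; [exact Hw|apply Rmin_r].
Qed.

Lemma cderiv_ext (f g : C -> C) (z d : C) :
  (forall w, f w = g w) -> cderiv f z d -> cderiv g z d.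
Proof. intros E. apply (cderiv_ext_loc f g z d 1); [lra | intros w _; apply E]. Qed.

Lemma cderiv_eq (f : C -> C) (z d e : C) : d = e -> cderiv f z d -> cderiv f z e.
Proof. now intros ->. Qed.

Lemma cderiv_const (c z : C) : cderiv (fun _ => c) z 0.
Proof. exact (is_derive_const (K := C_AbsRing) (V := C_NormedModule) c z). Qed.

Lemma cderiv_id (z : C) : cderiv (fun w => w) z 1.
Proof. apply cderiv_iff; intros eps He; exists 1%R; split; [lra|]; intros w _.
replace (w - z - (w - z) * 1) with (RtoC 0) by ring. rewrite Cmod_0.
apply Rmult_le_pos; [lra|apply Cmod_ge_0]. Qed.

Lemma cderiv_plus (f g : C -> C) (z a b : C) :
  cderiv f z a -> cderiv g z b -> cderiv (fun w => f w + g w) z (a + b).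
Proof. exact (is_derive_plus (K := C_AbsRing) (V := C_NormedModule) f g z a b). Qed.

Lemma cderiv_cont (f : C -> C) (z d : C) : cderiv f z d ->
  forall eps : R, (0 < eps)%R -> exists delta : R, (0 < delta)%R /\
    forall w : C, (Cmod (w - z) < delta)%R -> (Cmod (f w - f z) < eps)%R.
Proof.
intros H eps He.
destruct (proj1 (cderiv_iff f z d) H 1%R Rlt_0_1) as [delta [Hd H']].
set (K := (2 + Cmod d)%R).
assert (HK : (0 < K)%R) by (unfold K; pose proof (Cmod_ge_0 d); lra).
exists (Rmin delta (eps / K)). split.
{ apply Rmin_pos; [exact Hd|]. apply Rdiv_lt_0_compat; lra. }
intros w Hw.
assert (H1 : (Cmod (w - z) < delta)%R) by (eapply Rlt_le_trans; [exact Hw|apply Rmin_l]).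
assert (H2 : (Cmod (w - z) < eps / K)%R) by (eapply Rlt_le_trans; [exact Hw|apply Rmin_r]).
specialize (H' w H1).
replace (f w - f z) with ((f w - f z - (w - z) * d) + (w - z) * d) by ring.
eapply Rle_lt_trans; [apply Cmod_triangle|].
rewrite Cmod_mult.
assert (H3 : (Cmod (w - z) * K < eps)%R).
{ apply (Rmult_lt_compat_r K) in H2; [|exact HK].
  replace (eps / K * K)%R with eps in H2 by (field; lra). exact H2. }
unfold K in H3. pose proof (Cmod_ge_0 (w - z)). nra.
Qed.

(* Coquelicot puts on C, as a module over itself, a uniform structure which is
   not the one of [C_NormedModule]. *)
Lemma cderiv_AbsRing (f : C -> C) (z d : C) :
  cderiv f z d <-> @is_derive C_AbsRing (AbsRing_NormedModule C_AbsRing) f z d.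
Proof. split; intros [_ H]; (split; [apply is_linear_scal_l|exact H]). Qed.

Lemma cderiv_mult (f g : C -> C) (z a b : C) :
  cderiv f z a -> cderiv g z b -> cderiv (fun w => f w * g w) z (a * g z + f z * b).
Proof.
intros Hf Hg. apply cderiv_AbsRing in Hf, Hg. apply cderiv_AbsRing.
exact (is_derive_mult (K := C_AbsRing) f g z a b Hf Hg Cmult_comm).
Qed.

Lemma cderiv_comp (f g : C -> C) (z a b : C) :
  cderiv f (g z) a -> cderiv g z b -> cderiv (fun w => f (g w)) z (b * a).
Proof.
intros Hf Hg. apply cderiv_AbsRing in Hg.
exact (is_derive_comp (K := C_AbsRing) (V := C_NormedModule) f g z a b Hf Hg). Qed.

Lemma cderiv_scal (c : C) (f : C -> C) (z a : C) :
  cderiv f z a -> cderiv (fun w => c * f w) z (c * a).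
Proof.
intros H. eapply cderiv_eq; [|apply (cderiv_mult (fun _ => c) f z 0 a (cderiv_const c z) H)].
ring.
Qed.

Lemma cderiv_opp (f : C -> C) (z a : C) : cderiv f z a -> cderiv (fun w => - f w) z (- a).
Proof.
intros H. apply (cderiv_ext (fun w => (-1) * f w)); [intros; ring|].
eapply cderiv_eq; [|apply cderiv_scal, H]. ring.
Qed.

Lemma cderiv_minus (f g : C -> C) (z a b : C) :
  cderiv f z a -> cderiv g z b -> cderiv (fun w => f w - g w) z (a - b).
Proof. intros Hf Hg. apply (cderiv_plus f (fun w => - g w)); [exact Hf|now apply cderiv_opp]. Qed.

Lemma cderiv_pow (n : nat) (z : C) : cderiv (fun w => w ^ S n) z (INR (S n) * z ^ n).
Proof.
induction n as [|n IH].
- apply (cderiv_ext (fun w => w)); [intros; simpl; ring|].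
  eapply cderiv_eq; [|apply cderiv_id]. simpl; ring.
- apply (cderiv_ext (fun w => w * w ^ S n)); [intros; simpl; ring|].
  eapply cderiv_eq; [|apply (cderiv_mult _ _ _ _ _ (cderiv_id z) IH)].
  rewrite (S_INR (S n)), RtoC_plus. simpl (_ ^ _). ring.
Qed.

Lemma cderiv_Cinv (z : C) : z <> 0 -> cderiv Cinv z (- / (z * z)).
Proof.
intros Hz. apply cderiv_iff. intros eps He.
set (m := Cmod z).
assert (Hm : (0 < m)%R) by (now apply Cmod_gt_0).
(* The first bound keeps [Cmod w >= m / 2]. The remainder is [(w - z)^2 / (w z^2)], of modulus at
   most [2 |w - z|^2 / m^3], and the second bound turns this into [eps |w - z|]. *)
exists (Rmin (m / 2) (eps * m ^ 3 / 2)). split.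
{ apply Rmin_pos; [lra|]. apply Rdiv_lt_0_compat; [|lra]. apply Rmult_lt_0_compat; [lra|]. now apply pow_lt. }
intros w Hw.
assert (H1 : (Cmod (w - z) < m / 2)%R) by (eapply Rlt_le_trans; [exact Hw|apply Rmin_l]).
assert (H2 : (Cmod (w - z) < eps * m ^ 3 / 2)%R) by (eapply Rlt_le_trans; [exact Hw|apply Rmin_r]).
assert (H3 : (m / 2 <= Cmod w)%R).
{ pose proof (Cmod_triangle w (z - w)). replace (w + (z - w)) with z in H by ring.
  replace (Cmod (z - w)) with (Cmod (w - z)) in H.
  2:{ rewrite <- (Cmod_opp (w - z)). f_equal. ring. }
  fold m in H. lra. }
assert (Hw0 : w <> 0) by (apply Cmod_gt_0; lra).
replace (/ w - / z - (w - z) * - / (z * z)) with ((w - z) * ((w - z) / (w * z ^ 2))) by (field; now split).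
rewrite Cmod_mult, Rmult_comm. apply Rmult_le_compat_r; [apply Cmod_ge_0|].
rewrite Cmod_div; [|apply Cmult_neq_0; [exact Hw0|now apply Cpow_nz]].
rewrite Cmod_mult, Cmod_pow. fold m.
assert (Hm2 : (0 < m ^ 2)%R) by now apply pow_lt.
apply Rle_div_l; [apply Rmult_gt_0_compat; lra|].
apply Rle_trans with (eps * (m / 2 * m ^ 2))%R; [simpl in *; lra|].
apply Rmult_le_compat_l; [lra|]. apply Rmult_le_compat_r; lra.
Qed.

Lemma cderiv_inv (f : C -> C) (z a : C) :
  cderiv f z a -> f z <> 0 -> cderiv (fun w => / f w) z (- a / (f z * f z)).
Proof.
intros Hf H0. eapply cderiv_eq; [|apply (cderiv_comp Cinv f z _ a (cderiv_Cinv _ H0) Hf)].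
field. exact H0.
Qed.

Lemma Cmod_le_Re_Im (z : C) : (Cmod z <= Rabs (Re z) + Rabs (Im z))%R.
Proof.
unfold Cmod.
rewrite <- (sqrt_Rsqr (Rabs (Re z) + Rabs (Im z))).
- apply sqrt_le_1_alt. unfold Rsqr. pose proof (Rabs_pos (Re z)); pose proof (Rabs_pos (Im z)).
  rewrite <- (pow2_abs (fst z)), <- (pow2_abs (snd z)). fold (Re z) (Im z). nra.
- pose proof (Rabs_pos (Re z)); pose proof (Rabs_pos (Im z)); lra.
Qed.

Lemma im_le_Cmod (z : C) : (Rabs (Im z) <= Cmod z)%R.
Proof. rewrite <- Rmax_Cmod. apply Rmax_r. Qed.

Lemma Cmod_sqr (z : C) : (Cmod z * Cmod z = Re z * Re z + Im z * Im z)%R.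
Proof. pose proof (Cmod2_alt z). simpl in H. lra. Qed.

(** A complex derivative is a total differential of the real and imaginary parts, so the chain rule
    in two real variables applies. The curves needed are lines, circles and radii. *)
Lemma cderiv_curve (f : C -> C) (g h : R -> R) (t dg dh : R) (d : C) :
  cderiv f (g t, h t) d -> is_derive g t dg -> is_derive h t dh ->
  is_derive (fun s => Re (f (g s, h s))) t (Re (d * (dg, dh))) /\
  is_derive (fun s => Im (f (g s, h s))) t (Im (d * (dg, dh))).
Proof.
intros Hf Hg Hh.
pose proof (proj1 (cderiv_iff _ _ _) Hf) as Hf'.
(* [p] stands for [Re] or [Im]; [lx] and [ly] are the partial derivatives of [p] composed with
   [f]. *)
assert (HB : forall (p : C -> R) (lx ly : R),
  (forall x y : C, p (x - y)%C = p x - p y)%R -> (forall x : C, Rabs (p x) <= Cmod x)%R ->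
  (forall u v : R, p ((u, v) * d)%C = lx * u + ly * v)%R ->
  is_derive (fun s => p (f (g s, h s))) t (dg * lx + dh * ly)%R).
{ intros p lx ly Hp1 Hp2 Hp3.
  apply is_derive_Reals.
  replace (dg * lx + dh * ly)%R with (lx * dg + ly * dh)%R by ring.
  apply (derivable_pt_lim_comp_2d (fun u v => p (f (u, v))) g h t lx ly dg dh);
   [|now apply is_derive_Reals|now apply is_derive_Reals].
  intros eps.
  (* Halved because the modulus is at most twice the larger of the two increments. *)
  destruct (Hf' (eps / 2)%R ltac:(destruct eps; simpl; lra)) as [delta [Hd H]].
  exists (mkposreal (delta / 2) ltac:(lra)). simpl. intros u v Hu Hv.
  specialize (H (u, v)).
  assert (E : ((u, v) - (g t, h t))%C = ((u - g t)%R, (v - h t)%R)) by (apply C_ext; simpl; ring).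
  rewrite E in H.
  assert (HM : (Cmod ((u - g t)%R, (v - h t)%R) <= 2 * Rmax (Rabs (u - g t)) (Rabs (v - h t)))%R).
  { eapply Rle_trans; [apply Cmod_le_Re_Im|]. simpl.
    pose proof (Rmax_l (Rabs (u - g t)) (Rabs (v - h t))).
    pose proof (Rmax_r (Rabs (u - g t)) (Rabs (v - h t))). lra. }
  assert (HM2 : (Cmod ((u - g t)%R, (v - h t)%R) < delta)%R).
  { eapply Rle_lt_trans; [apply Cmod_le_Re_Im|]. simpl. lra. }
  specialize (H HM2).
  rewrite <- Hp1. rewrite <- Hp3, <- Hp1.
  eapply Rle_trans; [apply Hp2|]. eapply Rle_trans; [exact H|].
  destruct eps as [eps He]; simpl in *. nra. }
split.
- replace (Re (d * (dg, dh))) with (dg * Re d + dh * (- Im d))%R by (destruct d; simpl; ring).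
  apply HB.
  + intros; unfold Re, Im; simpl; ring.
  + apply re_le_Cmod.
  + intros; destruct d; simpl; ring.
- replace (Im (d * (dg, dh))) with (dg * Im d + dh * Re d)%R by (destruct d; simpl; ring).
  apply HB.
  + intros; unfold Re, Im; simpl; ring.
  + apply im_le_Cmod.
  + intros; destruct d; simpl; ring.
Qed.

(** * Power series on the unit disc *)

(** Split into components so that the theory of real series (domination, products, uniqueness)
    applies; [csum_iff] identifies it with convergence in [C]. *)
Definition csum (s : nat -> C) (l : C) : Prop :=
  is_series (fun n => Re (s n)) (Re l) /\ is_series (fun n => Im (s n)) (Im l).

Lemma Re_sum_n (s : nat -> C) (n : nat) :
  Re (sum_n (G := C_NormedModule) s n) = sum_n (fun k => Re (s k)) n.
Proof.
induction n as [|n IH].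
- now rewrite !sum_O.
- rewrite !sum_Sn. rewrite <- IH. reflexivity.
Qed.

Lemma Im_sum_n (s : nat -> C) (n : nat) :
  Im (sum_n (G := C_NormedModule) s n) = sum_n (fun k => Im (s k)) n.
Proof.
induction n as [|n IH].
- now rewrite !sum_O.
- rewrite !sum_Sn. rewrite <- IH. reflexivity.
Qed.

Lemma csum_iff (s : nat -> C) (l : C) :
  csum s l <-> is_series (K := C_AbsRing) (V := C_NormedModule) s l.
Proof.
unfold csum, is_series. split.
- intros [H1 H2]. apply filterlim_locally. intros eps.
  generalize (proj1 (filterlim_locally _ _) H1 eps) (proj1 (filterlim_locally _ _) H2 eps).
  intros A B. generalize (filter_and _ _ A B). apply filter_imp.
  intros n [P Q]. rewrite <- Re_sum_n in P. rewrite <- Im_sum_n in Q. now split.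
- intros H. split; apply filterlim_locally; intros eps;
  generalize (proj1 (filterlim_locally _ _) H eps); apply filter_imp; intros n [P Q].
  + rewrite <- Re_sum_n. exact P.
  + rewrite <- Im_sum_n. exact Q.
Qed.

Lemma csum_unique (s : nat -> C) (l m : C) : csum s l -> csum s m -> l = m.
Proof.
intros [H1 H2] [H3 H4]. apply C_ext.
- rewrite <- (is_series_unique _ _ H1). now apply is_series_unique.
- rewrite <- (is_series_unique _ _ H2). now apply is_series_unique.
Qed.

Lemma csum_ext (s t : nat -> C) (l : C) : (forall n, s n = t n) -> csum s l -> csum t l.
Proof.
intros E [H1 H2]; split; (eapply is_series_ext; [|eassumption]); intros n; simpl; now rewrite E.
Qed.

Lemma csum_plus (s t : nat -> C) (l m : C) :
  csum s l -> csum t m -> csum (fun n => s n + t n) (l + m).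
Proof.
intros [H1 H2] [H3 H4]. split.
- exact (is_series_plus _ _ _ _ H1 H3).
- exact (is_series_plus _ _ _ _ H2 H4).
Qed.

Lemma csum_scal (c : C) (s : nat -> C) (l : C) : csum s l -> csum (fun n => c * s n) (c * l).
Proof.
intros [H1 H2]. split.
- rewrite re_mult.
  pose proof (is_series_minus _ _ _ _ (is_series_scal (K := R_AbsRing) (Re c) _ _ H1)
    (is_series_scal (K := R_AbsRing) (Im c) _ _ H2)) as H.
  eapply is_series_ext; [|exact H]. intros n. rewrite re_mult. reflexivity.
- rewrite im_mult.
  pose proof (is_series_plus _ _ _ _ (is_series_scal (K := R_AbsRing) (Re c) _ _ H2)
    (is_series_scal (K := R_AbsRing) (Im c) _ _ H1)) as H.
  eapply is_series_ext; [|exact H]. intros n. rewrite im_mult. reflexivity.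
Qed.

Lemma csum_incr_1 (s : nat -> C) (l : C) :
  csum (fun n => s (S n)) l -> csum s (s O + l).
Proof.
intros [H1 H2]. split.
- rewrite re_plus. apply is_series_decr_1. eapply is_series_ext with (fun n => Re (s (S n))).
  + reflexivity.
  + match goal with |- is_series _ ?x => replace x with (Re l) end; [exact H1|].
    unfold plus, opp; simpl. unfold Re; ring.
- rewrite im_plus. apply is_series_decr_1. eapply is_series_ext with (fun n => Im (s (S n))).
  + reflexivity.
  + match goal with |- is_series _ ?x => replace x with (Im l) end; [exact H2|].
    unfold plus, opp; simpl. unfold Im; ring.
Qed.

Lemma ex_series_dominated (a b : nat -> R) :
  (forall n, Rabs (a n) <= b n) -> ex_series b -> ex_series a.
Proof. exact (ex_series_le (K := R_AbsRing) (V := R_CompleteNormedModule) a b). Qed.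

Lemma ex_series_ext_R (a b : nat -> R) :
  (forall n, a n = b n) -> ex_series a -> ex_series b.
Proof. exact (ex_series_ext a b). Qed.

Lemma is_series_ext_R (a b : nat -> R) (l : R) :
  (forall n, a n = b n) -> is_series a l -> is_series b l.
Proof. exact (is_series_ext a b l). Qed.

Lemma ex_series_scal_R (c : R) (a : nat -> R) :
  ex_series a -> ex_series (fun n => (c * a n)%R).
Proof. exact (ex_series_scal (K := R_AbsRing) (V := R_NormedModule) c a). Qed.

Lemma csum_of_abs (s : nat -> C) : ex_series (fun n => Cmod (s n)) ->
  csum s (Series (fun n => Re (s n)), Series (fun n => Im (s n))).
Proof.
intros H. split; apply Series_correct; apply (ex_series_dominated _ (fun n => Cmod (s n)));
 try exact H; intros n; [apply re_le_Cmod|apply im_le_Cmod].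
Qed.

Lemma Cmod_csum_le (s : nat -> C) (l : C) (b : nat -> R) (m : R) :
  csum s l -> is_series b m -> (forall n, Cmod (s n) <= b n) -> (Cmod l <= m)%R.
Proof.
intros Hs Hb Hle.
apply csum_iff in Hs.
apply Rnot_lt_le. intros Hlt.
(* A quarter of the gap for each of three approximations: real part, imaginary part and majorant.
   Their total stays below the gap. *)
assert (Hpos : (0 < (Cmod l - m) / 4)%R) by lra.
pose proof (proj1 (filterlim_locally _ _) Hs (mkposreal _ Hpos)) as A.
pose proof (proj1 (filterlim_locally _ _) Hb (mkposreal _ Hpos)) as B.
destruct (filter_ex _ (filter_and _ _ A B)) as [n [P Q]].
destruct P as [P1 P2]. simpl in P1, P2.
change (Rabs (sum_n b n - m) < (Cmod l - m) / 4) in Q.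
change (Rabs (Re (sum_n (G := C_NormedModule) s n) - Re l) < (Cmod l - m) / 4) in P1.
change (Rabs (Im (sum_n (G := C_NormedModule) s n) - Im l) < (Cmod l - m) / 4) in P2.
assert (HS : (Cmod (sum_n (G := C_NormedModule) s n) <= sum_n b n)%R).
{ clear -Hle. induction n as [|n IH].
  - rewrite !sum_O. apply Hle.
  - rewrite !sum_Sn. eapply Rle_trans; [apply (Cmod_triangle (sum_n (G := C_NormedModule) s n))|].
    apply Rplus_le_compat; [exact IH|apply Hle]. }
assert (HD : (Cmod (l - sum_n (G := C_NormedModule) s n) <= (Cmod l - m) / 4 + (Cmod l - m) / 4)%R).
{ eapply Rle_trans; [apply Cmod_le_Re_Im|].
  unfold Cminus. rewrite re_plus, re_opp, im_plus, im_opp.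
  rewrite <- (Rabs_Ropp (Re l + _)), <- (Rabs_Ropp (Im l + _)).
  apply Rplus_le_compat; apply Rlt_le.
  - eapply Rle_lt_trans; [|exact P1]. right. f_equal. ring.
  - eapply Rle_lt_trans; [|exact P2]. right. f_equal. ring. }
pose proof (Cmod_triangle (l - sum_n (G := C_NormedModule) s n) (sum_n (G := C_NormedModule) s n)) as T.
replace (l - sum_n (G := C_NormedModule) s n + sum_n (G := C_NormedModule) s n) with l in T by ring.
apply Rabs_def2 in Q. lra.
Qed.

(** [Series] is total, so this is always defined; it is the sum of the power series when that
    converges, in practice under [CVdisk a] and [Omega z]. *)
Definition psum (a : nat -> C) (z : C) : C :=
  (Series (fun n => Re (a n * z ^ n)), Series (fun n => Im (a n * z ^ n))).

(** Radius of convergence at least 1, put as absolute convergence at each smaller radius: this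
    supplies majorants that are uniform on smaller discs. *)
Definition CVdisk (a : nat -> C) : Prop :=
  forall r : R, (0 <= r < 1)%R -> ex_series (fun n => (Cmod (a n) * r ^ n)%R).

Lemma psum_csum (a : nat -> C) (z : C) : CVdisk a -> Omega z ->
  csum (fun n => a n * z ^ n) (psum a z).
Proof.
intros Ha Hz. apply csum_of_abs.
eapply ex_series_ext_R; [|apply (Ha (Cmod z)); split; [apply Cmod_ge_0|exact Hz]].
intros n. simpl. now rewrite Cmod_mult, Cmod_pow.
Qed.

Lemma power_series_iff (a : nat -> C) (z l : C) :
  power_series a z l <-> csum (fun n => a n * z ^ n) l.
Proof.
assert (E : forall n, scal (K := C_AbsRing) (V := C_NormedModule) (pow_n (K := C_AbsRing) z n) (a n) = a n * z ^ n).
{ intros n. change (pow_n (K := C_AbsRing) z n * a n = a n * z ^ n).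
  rewrite Cmult_comm. apply (f_equal (Cmult (a n))). induction n as [|n IH]; [reflexivity|]. simpl. now rewrite IH. }
unfold power_series, is_pseries. rewrite csum_iff. split; intros H; (eapply is_series_ext; [|exact H]); intros n.
- apply E.
- symmetry. apply E.
Qed.

Lemma psum_power_series (a : nat -> C) (z : C) : CVdisk a -> Omega z ->
  power_series a z (psum a z).
Proof. intros Ha Hz. apply power_series_iff. now apply psum_csum. Qed.

Lemma psum_unique (a : nat -> C) (z l : C) : CVdisk a -> Omega z ->
  csum (fun n => a n * z ^ n) l -> psum a z = l.
Proof. intros Ha Hz H. eapply csum_unique; [now apply psum_csum|exact H]. Qed.

Lemma CVdisk_bounded (a : nat -> C) (M : R) :
  (forall n, Cmod (a n) <= M) -> CVdisk a.
Proof.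
intros H r Hr. apply (ex_series_dominated _ (fun n => (M * r ^ n)%R)).
- intros n. simpl.
  rewrite Rabs_pos_eq.
  + apply Rmult_le_compat_r; [apply pow_le; lra|apply H].
  + apply Rmult_le_pos; [apply Cmod_ge_0|apply pow_le; lra].
- apply (ex_series_scal_R M (fun n => (r ^ n)%R)).
  apply ex_series_geom. rewrite Rabs_pos_eq; lra.
Qed.

(** With [s] halfway between [r] and 1, a bound at radius [s] is a geometric majorant of ratio
    [r / s] at radius [r]. *)
Lemma CVdisk_bounded_each (a : nat -> C) :
  (forall r : R, (0 < r < 1)%R -> exists M : R, forall n, Cmod (a n) * r ^ n <= M) -> CVdisk a.
Proof.
intros H r Hr. set (s := ((1 + r) / 2)%R).
destruct (H s ltac:(unfold s; lra)) as [M HM].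
assert (Hs : (0 < s < 1)%R) by (unfold s; lra).
apply (ex_series_dominated _ (fun n => (M * (r / s) ^ n)%R)).
- intros n.
  rewrite Rabs_pos_eq.
  + replace (r ^ n)%R with (s ^ n * (r / s) ^ n)%R.
    * rewrite <- Rmult_assoc. apply Rmult_le_compat_r; [|apply HM].
      apply pow_le. apply Rle_div_r; lra.
    * rewrite <- Rpow_mult_distr. f_equal. field. lra.
  + apply Rmult_le_pos; [apply Cmod_ge_0|apply pow_le; lra].
- apply (ex_series_scal_R M (fun n => ((r / s) ^ n)%R)).
  apply ex_series_geom. rewrite Rabs_pos_eq; [|apply Rle_div_r; lra].
  apply Rlt_div_l; [lra|]. unfold s; lra.
Qed.

(** Abel's lemma: the terms of a convergent series are bounded, and at a real point [r] this bounds
    [|a_n| r^n]. *)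
Lemma CVdisk_of_power_series (a : nat -> C) (f : C -> C) :
  (forall z, Omega z -> power_series a z (f z)) -> CVdisk a.
Proof.
intros H. apply CVdisk_bounded_each. intros r Hr.
assert (Hz : Omega (RtoC r)) by (unfold Omega; rewrite Cmod_R, Rabs_pos_eq; lra).
pose proof (proj1 (power_series_iff _ _ _) (H _ Hz)) as [H1 H2].
assert (B : forall u : nat -> R, ex_series u -> exists M, forall n, Rabs (u n) <= M).
{ intros u Hu. apply ex_series_lim_0 in Hu.
  apply is_lim_seq_Reals in Hu.
  destruct (maj_by_pos u (exist _ 0%R Hu)) as [M [_ HM]]. now exists M. }
destruct (B _ (ex_intro _ _ H1)) as [M1 HM1].
destruct (B _ (ex_intro _ _ H2)) as [M2 HM2].
exists (M1 + M2)%R. intros n.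
replace (Cmod (a n) * r ^ n)%R with (Cmod (a n * RtoC r ^ n)).
- eapply Rle_trans; [apply Cmod_le_Re_Im|]. apply Rplus_le_compat; [apply HM1|apply HM2].
- rewrite Cmod_mult, Cmod_pow, Cmod_R, (Rabs_pos_eq r); lra.
Qed.

Lemma psum_of_power_series (a : nat -> C) (f : C -> C) (z : C) :
  (forall z, Omega z -> power_series a z (f z)) -> Omega z -> f z = psum a z.
Proof.
intros H Hz. symmetry. apply psum_unique; [exact (CVdisk_of_power_series a f H)|exact Hz|].
apply power_series_iff. now apply H.
Qed.

Lemma CVdisk_plus (a b : nat -> C) : CVdisk a -> CVdisk b -> CVdisk (fun n => a n + b n).
Proof.
intros Ha Hb r Hr.
apply (ex_series_dominated _ (fun n => (Cmod (a n) * r ^ n + Cmod (b n) * r ^ n)%R)).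
- intros n.  rewrite Rabs_pos_eq.
  + rewrite <- Rmult_plus_distr_r. apply Rmult_le_compat_r; [apply pow_le; lra|apply Cmod_triangle].
  + apply Rmult_le_pos; [apply Cmod_ge_0|apply pow_le; lra].
- apply (ex_series_plus _ _ (Ha r Hr) (Hb r Hr)).
Qed.

Lemma CVdisk_scal (c : C) (a : nat -> C) : CVdisk a -> CVdisk (fun n => c * a n).
Proof.
intros Ha r Hr. apply (ex_series_ext_R (fun n => (Cmod c * (Cmod (a n) * r ^ n))%R)).
- intros n. rewrite Cmod_mult. ring.
- apply ex_series_scal_R. now apply Ha.
Qed.

Lemma psum_plus (a b : nat -> C) (z : C) : CVdisk a -> CVdisk b -> Omega z ->
  psum (fun n => a n + b n) z = psum a z + psum b z.
Proof.
intros Ha Hb Hz. apply psum_unique; [now apply CVdisk_plus|exact Hz|].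
eapply csum_ext; [|apply csum_plus; apply psum_csum; eassumption].
intros n; simpl; ring.
Qed.

Lemma psum_scal (c : C) (a : nat -> C) (z : C) : CVdisk a -> Omega z ->
  psum (fun n => c * a n) z = c * psum a z.
Proof.
intros Ha Hz. apply psum_unique; [now apply CVdisk_scal|exact Hz|].
eapply csum_ext; [|apply csum_scal; apply psum_csum; eassumption].
intros n; simpl; ring.
Qed.

Lemma psum_ext (a b : nat -> C) (z : C) : (forall n, a n = b n) -> psum a z = psum b z.
Proof. intros E. unfold psum. f_equal; apply Series_ext; intros n; now rewrite E. Qed.

Lemma CVdisk_ext (a b : nat -> C) : (forall n, a n = b n) -> CVdisk a -> CVdisk b.
Proof. intros E H r Hr. eapply ex_series_ext_R; [|apply (H r Hr)]. intros n. simpl. now rewrite E. Qed.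

Definition pshift (a : nat -> C) (n : nat) : C := match n with O => 0 | S k => a k end.

Lemma CVdisk_shift (a : nat -> C) : CVdisk a -> CVdisk (pshift a).
Proof.
intros Ha r Hr. apply ex_series_incr_1. simpl.
apply (ex_series_ext_R (fun n => (r * (Cmod (a n) * r ^ n))%R)); [intros; ring|].
apply ex_series_scal_R. now apply Ha.
Qed.

Lemma psum_shift (a : nat -> C) (z : C) : CVdisk a -> Omega z ->
  psum (pshift a) z = z * psum a z.
Proof.
intros Ha Hz. apply psum_unique; [now apply CVdisk_shift|exact Hz|].
replace (z * psum a z) with (pshift a O * z ^ 0 + z * psum a z) by (simpl; ring).
apply csum_incr_1. eapply csum_ext; [|apply csum_scal, psum_csum; eassumption].
intros n; simpl; ring.
Qed.

Lemma CVdisk_tail (a : nat -> C) : CVdisk a -> CVdisk (fun n => a (S n)).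
Proof.
intros Ha. apply CVdisk_bounded_each. intros r Hr.
specialize (Ha r ltac:(lra)). apply ex_series_incr_1 in Ha. apply ex_series_lim_0 in Ha.
apply is_lim_seq_Reals in Ha.
destruct (maj_by_pos _ (exist _ 0%R Ha)) as [M [_ HM]]. exists (M / r)%R. intros n.
apply (Rle_div_r _ _ r (proj1 Hr)). eapply Rle_trans; [|apply (HM n)].
eapply Rle_trans; [|apply Rle_abs].
rewrite Rmult_assoc, (Rmult_comm (r ^ n)). apply Rle_refl.
Qed.

Lemma psum_tail (a : nat -> C) (z : C) : CVdisk a -> Omega z ->
  psum a z = a O + z * psum (fun n => a (S n)) z.
Proof.
intros Ha Hz. apply psum_unique; [exact Ha|exact Hz|].
replace (a O) with (a O * z ^ 0) by (simpl; ring).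
apply (csum_incr_1 (fun n => a n * z ^ n)).
eapply csum_ext; [|apply csum_scal, psum_csum; [apply CVdisk_tail|]; eassumption].
intros n; simpl; ring.
Qed.

Lemma psum_0 (a : nat -> C) : CVdisk a -> psum a 0 = a O.
Proof.
intros Ha. rewrite psum_tail; [ring|exact Ha|]. unfold Omega. rewrite Cmod_0. lra.
Qed.

Lemma Cmod_psum_le (a : nat -> C) (z : C) (r : R) : CVdisk a -> (Cmod z <= r < 1)%R ->
  (Cmod (psum a z) <= Series (fun n => Cmod (a n) * r ^ n))%R.
Proof.
intros Ha Hr. pose proof (Cmod_ge_0 z).
eapply Cmod_csum_le.
- apply psum_csum; [exact Ha|unfold Omega; lra].
- apply Series_correct. apply Ha. lra.
- intros n. simpl. rewrite Cmod_mult, Cmod_pow. apply Rmult_le_compat_l; [apply Cmod_ge_0|].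
  apply pow_incr. lra.
Qed.

(** Bernoulli's inequality for [s / r = 1 + x]. It absorbs a factor [n] into a slightly larger
    radius, so that termwise differentiation preserves [CVdisk]. *)
Lemma INR_pow_bound (r s : R) (n : nat) : (0 < r < s)%R ->
  (INR n * r ^ n <= / (s / r - 1) * s ^ n)%R.
Proof.
intros Hr. set (x := (s / r - 1)%R).
assert (Hx : (0 < x)%R) by (unfold x; apply Rlt_0_minus; apply Rlt_div_r; lra).
assert (H : (1 + INR n * x <= (1 + x) ^ n)%R).
{ induction n as [|n IH]; [simpl; lra|]. rewrite S_INR. simpl.
  pose proof (pos_INR n). assert (0 <= INR n * x)%R by (apply Rmult_le_pos; lra).
  apply Rle_trans with ((1 + x) * (1 + INR n * x))%R; [nra|]. apply Rmult_le_compat_l; lra. }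
replace (s ^ n)%R with ((1 + x) ^ n * r ^ n)%R.
2:{ rewrite <- Rpow_mult_distr. f_equal. unfold x. field. lra. }
rewrite <- Rmult_assoc. apply Rmult_le_compat_r; [apply pow_le; lra|].
apply (Rmult_le_reg_l x); [exact Hx|]. rewrite <- Rmult_assoc, Rinv_r; lra.
Qed.

Lemma CVdisk_INR (a : nat -> C) : CVdisk a -> CVdisk (fun n => INR n * a n).
Proof.
intros Ha. apply CVdisk_bounded_each. intros r Hr.
set (s := ((1 + r) / 2)%R).
specialize (Ha s ltac:(unfold s; lra)). apply ex_series_lim_0 in Ha.
apply is_lim_seq_Reals in Ha.
destruct (maj_by_pos _ (exist _ 0%R Ha)) as [M [_ HM]].
assert (Hrs : (0 < r < s)%R) by (unfold s; lra).
assert (Hx : (0 < s / r - 1)%R) by (apply Rlt_0_minus; apply Rlt_div_r; lra).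
exists (/ (s / r - 1) * M)%R. intros n.
rewrite Cmod_mult, Cmod_R, Rabs_pos_eq; [|apply pos_INR].
apply Rle_trans with (/ (s / r - 1) * (Cmod (a n) * s ^ n))%R.
- pose proof (INR_pow_bound r s n Hrs). pose proof (Cmod_ge_0 (a n)). nra.
- apply Rmult_le_compat_l; [apply Rlt_le, Rinv_0_lt_compat, Hx|].
  eapply Rle_trans; [apply Rle_abs|apply HM].
Qed.

Definition pderiv (a : nat -> C) (n : nat) : C := INR (S n) * a (S n).

Lemma CVdisk_deriv (a : nat -> C) : CVdisk a -> CVdisk (pderiv a).
Proof. intros Ha. exact (CVdisk_tail _ (CVdisk_INR a Ha)). Qed.

(** The factor [rho ^ 2] on the left avoids the exponent [n - 1] on the right. If [e] is the
    remainder for one exponent, the next one is [w e + (n + 1) z^n (w - z)^2], and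
    [N^2 + N <= (N + 1)^2] closes the induction. *)
Lemma pow_second_order (rho : R) (z w : C) (n : nat) :
  (0 <= rho)%R -> (Cmod z <= rho)%R -> (Cmod w <= rho)%R ->
  (rho ^ 2 * Cmod (w ^ n * w - z ^ n * z - INR (S n) * z ^ n * (w - z)) <=
     (INR (S n) * INR (S n)) * rho ^ S n * Cmod (w - z) ^ 2)%R.
Proof.
intros Hr Hz Hw. induction n as [|n IH].
- replace (w ^ 0 * w - z ^ 0 * z - INR 1 * z ^ 0 * (w - z)) with (RtoC 0) by (simpl; ring).
  rewrite Cmod_0. simpl. pose proof (Cmod_ge_0 (w - z)). nra.
- set (e := w ^ n * w - z ^ n * z - INR (S n) * z ^ n * (w - z)) in *.
  replace (w ^ S n * w - z ^ S n * z - INR (S (S n)) * z ^ S n * (w - z))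
    with (w * e + INR (S n) * z ^ n * (w - z) ^ 2).
  2:{ unfold e. rewrite (S_INR (S n)), RtoC_plus. simpl (_ ^ _). ring. }
  assert (Hz' : (Cmod z ^ n <= rho ^ n)%R) by (apply pow_incr; split; [apply Cmod_ge_0|exact Hz]).
  assert (H0 : (0 <= rho ^ n)%R) by (now apply pow_le).
  assert (H1 : (0 <= INR (S n))%R) by apply pos_INR.
  assert (H2 : (0 <= Cmod (w - z) ^ 2)%R) by (apply pow2_ge_0).
  assert (H3 : (rho ^ 2 * Cmod (w * e) <= rho * (INR (S n) * INR (S n) * rho ^ S n * Cmod (w - z) ^ 2))%R).
  { rewrite Cmod_mult. apply Rle_trans with (rho * (rho ^ 2 * Cmod e))%R.
    - replace (rho * (rho ^ 2 * Cmod e))%R with (rho ^ 2 * (rho * Cmod e))%R by ring.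
      apply Rmult_le_compat_l; [apply pow2_ge_0|]. apply Rmult_le_compat_r; [apply Cmod_ge_0|exact Hw].
    - now apply Rmult_le_compat_l. }
  assert (H4 : (rho ^ 2 * Cmod (INR (S n) * z ^ n * (w - z) ^ 2) <= INR (S n) * rho ^ S (S n) * Cmod (w - z) ^ 2)%R).
  { rewrite !Cmod_mult, !Cmod_pow, Cmod_R, Rabs_pos_eq; [|exact H1].
    replace (INR (S n) * rho ^ S (S n) * Cmod (w - z) ^ 2)%R with
      (rho ^ 2 * (INR (S n) * rho ^ n * Cmod (w - z) ^ 2))%R by (simpl; ring).
    apply Rmult_le_compat_l; [apply pow2_ge_0|]. apply Rmult_le_compat_r; [exact H2|].
    now apply Rmult_le_compat_l. }
  eapply Rle_trans; [apply Rmult_le_compat_l; [apply pow2_ge_0|apply Cmod_triangle]|].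
  rewrite Rmult_plus_distr_l.
  eapply Rle_trans; [apply Rplus_le_compat; [exact H3|exact H4]|].
  rewrite (S_INR (S n)).
  set (N := INR (S n)) in *. set (h := (Cmod (w - z) ^ 2)%R) in *.
  assert (H5 : (0 <= rho ^ S (S n) * h)%R) by (apply Rmult_le_pos; [now apply pow_le|exact H2]).
  replace (rho * (N * N * rho ^ S n * h) + N * rho ^ S (S n) * h)%R with
    ((N * N + N) * (rho ^ S (S n) * h))%R by (simpl; ring).
  replace ((N + 1) * (N + 1) * rho ^ S (S n) * h)%R with ((N + 1) * (N + 1) * (rho ^ S (S n) * h))%R by ring.
  apply Rmult_le_compat_r; [exact H5|]. nra.
Qed.

(** The second-order remainders of the powers, summed against [|a_n|], leave an error of at most
    [K |w - z|^2 / rho^2], where [K] is the sum of [n^2 |a_n| rho^n] for some [rho] between [|z|]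
    and 1. *)
Lemma cderiv_psum (a : nat -> C) (z : C) : CVdisk a -> Omega z ->
  cderiv (psum a) z (psum (pderiv a) z).
Proof.
intros Ha Hz. unfold Omega in Hz. pose proof (Cmod_ge_0 z) as Hz0.
set (rho := ((1 + Cmod z) / 2)%R).
assert (Hrho : (0 < rho < 1 /\ Cmod z < rho)%R) by (unfold rho; lra).
set (K := Series (fun n => (Cmod (INR n * (INR n * a n)) * rho ^ n)%R)).
assert (HS : ex_series (fun n => (Cmod (INR n * (INR n * a n)) * rho ^ n)%R)).
{ apply (CVdisk_INR _ (CVdisk_INR _ Ha)). lra. }
assert (HK0 : (0 <= K)%R).
{ eapply Rle_trans; [apply Cmod_ge_0|].
  apply (Cmod_psum_le (fun n => INR n * (INR n * a n)) z rho); [|lra].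
  now apply CVdisk_INR, CVdisk_INR. }
assert (main : forall w, (Cmod w <= rho)%R ->
  (Cmod (psum a w - psum a z - (w - z) * psum (pderiv a) z) <= K / rho ^ 2 * Cmod (w - z) ^ 2)%R).
{ intros w Hw.
  (* The derivative series is shifted by one index, so that the [n]-th term is
     [a_n (w^n - z^n - n z^(n-1) (w - z))]. *)
  assert (Hs : csum (fun n => a n * w ^ n + (-1) * (a n * z ^ n)
                 + (- (w - z)) * pshift (fun k => pderiv a k * z ^ k) n)
              (psum a w + (-1) * psum a z + (- (w - z)) * (0 + psum (pderiv a) z))).
  { repeat apply csum_plus.
    - apply psum_csum; [exact Ha|unfold Omega; lra].
    - apply csum_scal, psum_csum; [exact Ha|unfold Omega; lra].
    - apply csum_scal. apply (csum_incr_1 (pshift _)). simpl.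
      apply (psum_csum (pderiv a)); [now apply CVdisk_deriv|unfold Omega; lra]. }
  replace (psum a w - psum a z - (w - z) * psum (pderiv a) z) with
    (psum a w + (-1) * psum a z + (- (w - z)) * (0 + psum (pderiv a) z)) by ring.
  eapply Cmod_csum_le; [exact Hs| |].
  - replace (K / rho ^ 2 * Cmod (w - z) ^ 2)%R with (Cmod (w - z) ^ 2 / rho ^ 2 * K)%R by (field; lra).
    exact (is_series_scal (K := R_AbsRing) (Cmod (w - z) ^ 2 / rho ^ 2)%R _ _ (Series_correct _ HS)).
  - intros n. match goal with |- _ <= ?x => change x with
        (Cmod (w - z) ^ 2 / rho ^ 2 * (Cmod (INR n * (INR n * a n)) * rho ^ n))%R end.
    destruct n as [|n].
    + simpl. match goal with |- Cmod ?x <= _ => replace x with (RtoC 0) by ring end.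
      rewrite Cmod_0. rewrite !Rmult_1_r. apply Rmult_le_pos; [|apply Cmod_ge_0].
      apply Rdiv_le_0_compat; [|nra]. pose proof (Cmod_ge_0 (w - z)); nra.
    + simpl pshift. unfold pderiv.
      match goal with |- Cmod ?x <= _ => replace x with
        (a (S n) * (w ^ n * w - z ^ n * z - INR (S n) * z ^ n * (w - z))) by (simpl (_ ^ S _); ring) end.
      rewrite !Cmod_mult, !Cmod_R, (Rabs_pos_eq (INR (S n))) by apply pos_INR.
      pose proof (pow_second_order rho z w n ltac:(lra) ltac:(lra) Hw) as B.
      pose proof (Cmod_ge_0 (a (S n))) as HA.
      assert (H2 : (0 < rho ^ 2)%R) by (apply pow_lt; lra).
      apply (Rmult_le_reg_l (rho ^ 2)%R); [exact H2|].
      apply Rle_trans with (Cmod (a (S n)) * (INR (S n) * INR (S n) * rho ^ S n * Cmod (w - z) ^ 2))%R.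
      * rewrite <- Rmult_assoc, (Rmult_comm (rho ^ 2)), Rmult_assoc. apply Rmult_le_compat_l; [exact HA|exact B].
      * right. field. lra. }
apply cderiv_iff. intros eps He.
exists (Rmin (rho - Cmod z) (eps / (K / rho ^ 2 + 1))).
assert (HK1 : (0 <= K / rho ^ 2)%R) by (apply Rdiv_le_0_compat; [exact HK0|apply pow_lt; lra]).
split.
{ apply Rmin_pos; [lra|]. apply Rdiv_lt_0_compat; lra. }
intros w Hw.
assert (H1 : (Cmod (w - z) < rho - Cmod z)%R) by (eapply Rlt_le_trans; [exact Hw|apply Rmin_l]).
assert (H2 : (Cmod (w - z) < eps / (K / rho ^ 2 + 1))%R) by (eapply Rlt_le_trans; [exact Hw|apply Rmin_r]).
eapply Rle_trans; [apply main|].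
- pose proof (Cmod_triangle (w - z) z). replace (w - z + z) with w in H by ring. lra.
- pose proof (Cmod_ge_0 (w - z)). apply Rlt_div_r in H2; [|lra].
  set (h := Cmod (w - z)) in *. set (k := (K / rho ^ 2)%R) in *. nra.
Qed.

Lemma sum_n_sub (x y : nat -> R) (n : nat) :
  sum_n (fun k => (x k - y k)%R) n = (sum_n x n - sum_n y n)%R.
Proof.
induction n as [|n IH].
- now rewrite !sum_O.
- rewrite !sum_Sn, IH. unfold plus; simpl. ring.
Qed.

(** The Cauchy product of absolutely convergent real series, applied to the four products of real
    and imaginary parts. *)
Lemma csum_conv (a b : nat -> C) (l m : C) :
  csum a l -> csum b m ->
  ex_series (fun n => Cmod (a n)) -> ex_series (fun n => Cmod (b n)) ->
  csum (fun n => sum_n (G := C_NormedModule) (fun k => a k * b (n - k)%nat) n) (l * m).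
Proof.
intros [A1 A2] [B1 B2] HA HB.
assert (D : forall (p : C -> R) (s : nat -> C), (forall x, Rabs (p x) <= Cmod x) ->
  ex_series (fun n => Cmod (s n)) -> ex_series (fun n => Rabs (p (s n)))).
{ intros p s Hp Hs. apply (ex_series_dominated _ _) with (2 := Hs). intros n.
   rewrite Rabs_Rabsolu. apply Hp. }
pose proof (D Re a re_le_Cmod HA) as DA1. pose proof (D Im a im_le_Cmod HA) as DA2.
pose proof (D Re b re_le_Cmod HB) as DB1. pose proof (D Im b im_le_Cmod HB) as DB2.
split.
- rewrite re_mult.
  pose proof (is_series_minus _ _ _ _ (is_series_mult _ _ _ _ A1 B1 DA1 DB1)
    (is_series_mult _ _ _ _ A2 B2 DA2 DB2)) as H.
  eapply is_series_ext_R; [|exact H].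
  intros n. rewrite Re_sum_n, <- !sum_n_Reals.
  rewrite (sum_n_ext _ _ n (fun k => re_mult (a k) (b (n - k)%nat))).
  symmetry. apply sum_n_sub.
- rewrite im_mult.
  pose proof (is_series_plus _ _ _ _ (is_series_mult _ _ _ _ A1 B2 DA1 DB2)
    (is_series_mult _ _ _ _ A2 B1 DA2 DB1)) as H.
  eapply is_series_ext_R; [|exact H].
  intros n. rewrite Im_sum_n, <- !sum_n_Reals.
  rewrite (sum_n_ext (fun k => Im (a k * b (n - k)%nat)) (fun k => plus (Re (a k) * Im (b (n - k)%nat))%R (Im (a k) * Re (b (n - k)%nat))%R)).
  2:{ intros k. rewrite im_mult. reflexivity. }
  now rewrite sum_n_plus.
Qed.

Definition pconv (a b : nat -> C) (n : nat) : C :=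
  sum_n (G := C_NormedModule) (fun k => a k * b (n - k)%nat) n.

(** In the applications the convolution is already known to be the coefficient sequence of a
    derivative, which provides [CVdisk (pconv a b)]. *)
Lemma psum_conv (a b : nat -> C) (z : C) : CVdisk a -> CVdisk b -> CVdisk (pconv a b) -> Omega z ->
  psum (pconv a b) z = psum a z * psum b z.
Proof.
intros Ha Hb Hc Hz. apply psum_unique; [exact Hc|exact Hz|].
assert (E : forall c, CVdisk c -> ex_series (fun n => Cmod (c n * z ^ n))).
{ intros c H. eapply ex_series_ext_R; [|apply (H (Cmod z)); split; [apply Cmod_ge_0|exact Hz]].
  intros n. simpl. now rewrite Cmod_mult, Cmod_pow. }
eapply csum_ext; [|apply csum_conv;
  [apply (psum_csum a z Ha Hz)|apply (psum_csum b z Hb Hz)|now apply E|now apply E]].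
intros n. unfold pconv.
transitivity (sum_n (G := C_NormedModule) (fun k => scal (K := C_Ring) (V := C_ModuleSpace) (z ^ n) (a k * b (n - k)%nat)) n).
- apply sum_n_ext_loc. intros k Hk.
  change (a k * z ^ k * (b (n - k)%nat * z ^ (n - k)) = z ^ n * (a k * b (n - k)%nat)).
  replace (z ^ n) with (z ^ k * z ^ (n - k)); [ring|].
  rewrite <- Cpow_add_r. f_equal. lia.
- rewrite (sum_n_scal_l (K := C_Ring) (V := C_ModuleSpace)). apply Cmult_comm.
Qed.

(** * Exponential, sine and principal arcsine *)

Lemma Cexp_plus (z w : C) : Cexp (z + w) = Cexp z * Cexp w.
Proof.
apply C_ext; unfold Cexp; simpl; rewrite exp_plus; [rewrite cos_plus|rewrite sin_plus]; unfold Re, Im; ring.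
Qed.

Lemma Cexp_0 : Cexp 0 = 1.
Proof. apply C_ext; unfold Cexp; simpl; rewrite exp_0, ?cos_0, ?sin_0; ring. Qed.

Lemma Cexp_opp (z : C) : Cexp z * Cexp (- z) = 1.
Proof. rewrite <- Cexp_plus. replace (z + - z) with (RtoC 0) by ring. apply Cexp_0. Qed.

Lemma Cexp_neq_0 (z : C) : Cexp z <> 0.
Proof.
intros H. pose proof (Cexp_opp z) as E. rewrite H in E.
assert (H1 : RtoC 1 = RtoC 0) by (rewrite <- E; ring). apply RtoC_inj in H1. lra.
Qed.

Lemma Cmod_Cexp (z : C) : Cmod (Cexp z) = exp (Re z).
Proof.
pose proof (Cmod_sqr (Cexp z)) as H. unfold Cexp in H at 3 4 5 6. simpl in H.
pose proof (sin2_cos2 (Im z)) as T. unfold Rsqr in T.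
pose proof (exp_pos (Re z)). pose proof (Cmod_ge_0 (Cexp z)).
assert (E : (Cmod (Cexp z) * Cmod (Cexp z) = exp (Re z) * exp (Re z))%R).
{ rewrite H. transitivity (exp (Re z) * exp (Re z) * (sin (Im z) * sin (Im z) + cos (Im z) * cos (Im z)))%R; [ring|]. rewrite T. ring. }
nra.
Qed.

Lemma Rabs_sin_le (t : R) : (Rabs (sin t) <= Rabs t)%R.
Proof.
assert (P : forall x : R, (0 <= x)%R -> (Rabs (sin x) <= x)%R).
{ intros x Hx. destruct (Req_dec x 0) as [->|Hx0]; [rewrite sin_0, Rabs_R0; lra|].
  apply Rabs_le. split.
  - destruct (Rle_lt_dec x 1).
    + assert (0 <= sin x)%R; [|lra]. apply sin_ge_0; [lra|]. pose proof PI2_1. lra.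
    + pose proof (SIN_bound x). lra.
  - apply Rlt_le, sin_lt_x. lra. }
destruct (Rle_lt_dec 0 t).
- rewrite (Rabs_pos_eq t) by lra. now apply P.
- rewrite <- (Rabs_Ropp t), <- (Rabs_Ropp (sin t)), <- sin_neg, (Rabs_pos_eq (- t)) by lra. apply P; lra.
Qed.

(** [1 - x <= exp (- x)] gives [exp x (1 - x) <= 1], while [(1 + x + 2 x^2) (1 - x) = 1 + x^2 (1 - 2
    x) >= 1] in this range. *)
Lemma exp_second_order (x : R) : (Rabs x <= 1 / 2)%R -> (Rabs (exp x - 1 - x) <= 2 * (x * x))%R.
Proof.
intros Hx. apply Rabs_le_between in Hx.
pose proof (exp_ineq1_le x). pose proof (exp_ineq1_le (- x)).
assert (E : (exp x * exp (- x) = 1)%R) by (rewrite <- exp_plus, Rplus_opp_r; apply exp_0).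
pose proof (exp_pos x).
rewrite Rabs_pos_eq by lra.
assert (H2 : (exp x * (1 - x) <= 1)%R) by nra.
assert (H3 : ((1 + x + 2 * (x * x)) * (1 - x) >= 1)%R) by nra.
nra.
Qed.

Lemma cos_second_order (y : R) : (Rabs (cos y - 1) <= y * y)%R.
Proof.
assert (E : (cos y - 1 = - (2 * (sin (y / 2) * sin (y / 2))))%R).
{ replace y with (2 * (y / 2))%R at 1 by field. rewrite cos_2a_sin. ring. }
rewrite E, Rabs_Ropp, Rabs_mult, Rabs_mult, (Rabs_pos_eq 2) by lra.
pose proof (Rabs_sin_le (y / 2)) as H. pose proof (Rabs_pos (sin (y / 2))).
assert (H1 : (Rabs (sin (y / 2)) * Rabs (sin (y / 2)) <= Rabs (y / 2) * Rabs (y / 2))%R) by (apply Rmult_le_compat; lra).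
rewrite <- (Rabs_mult (y / 2)), (Rabs_pos_eq (y / 2 * (y / 2))) in H1 by nra. nra.
Qed.

Lemma cderiv_Cexp (z : C) : cderiv Cexp z (Cexp z).
Proof.
assert (H0 : cderiv Cexp 0 1).
{ apply cderiv_iff. intros eps He.
  destruct (derivable_pt_lim_sin_0 (eps / 2)%R ltac:(lra)) as [ds Hs].
  (* With [m = |w|], the real part errs by at most [4 m^2] and the imaginary part by
     [2 m^2 + eps / 2 * m]; for [m < eps / 20] the sum [6 m^2] fits into the other half of
     [eps * m]. *)
  exists (Rmin (Rmin (1 / 2) ds) (eps / 20)). split.
  { repeat apply Rmin_pos; try lra. apply cond_pos. }
  intros w Hw. replace (w - 0) with w in * by ring. rewrite Cexp_0.
  replace (Cexp w - 1 - w * 1) with (Cexp w - 1 - w) by ring.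
  set (m := Cmod w) in *. pose proof (Cmod_ge_0 w) as Hm0. fold m in Hm0.
  assert (Hm1 : (m < 1 / 2)%R) by (eapply Rlt_le_trans; [exact Hw|eapply Rle_trans; [apply Rmin_l|apply Rmin_l]]).
  assert (Hm2 : (m < ds)%R) by (eapply Rlt_le_trans; [exact Hw|eapply Rle_trans; [apply Rmin_l|apply Rmin_r]]).
  assert (Hm3 : (m < eps / 20)%R) by (eapply Rlt_le_trans; [exact Hw|apply Rmin_r]).
  clear Hw.
  pose proof (re_le_Cmod w) as Hx. pose proof (im_le_Cmod w) as Hy. fold m in Hx, Hy.
  destruct w as [x y]. simpl in Hx, Hy.
  eapply Rle_trans; [apply Cmod_le_Re_Im|]. unfold Cexp; simpl. unfold Re, Im; simpl.
  pose proof (exp_second_order x ltac:(lra)) as B1.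
  pose proof (cos_second_order y) as B2.
  assert (B3 : (Rabs (sin y - y) <= eps / 2 * Rabs y)%R).
  { destruct (Req_dec y 0) as [->|Hy0].
    - rewrite sin_0, Rminus_0_r, Rabs_R0. lra.
    - specialize (Hs y Hy0 ltac:(lra)). rewrite Rplus_0_l, sin_0, Rminus_0_r in Hs.
      replace (sin y - y)%R with ((sin y / y - 1) * y)%R by (field; exact Hy0).
      rewrite Rabs_mult. apply Rmult_le_compat_r; [apply Rabs_pos|]. lra. }
  assert (X2 : (x * x <= m * m)%R) by (apply Rabs_le_between in Hx; nra).
  assert (Y2 : (y * y <= m * m)%R) by (apply Rabs_le_between in Hy; nra).
  assert (Ex : (Rabs (exp x - 1) <= 2 * m)%R).
  { replace (exp x - 1)%R with ((exp x - 1 - x) + x)%R by ring.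
    eapply Rle_trans; [apply Rabs_triang|]. nra. }
  assert (Ex2 : (exp x <= 2)%R) by (apply Rabs_le_between in Ex; lra).
  pose proof (exp_pos x) as Ex0.
  assert (T1 : (Rabs (exp x * cos y + - (1) + - x) <= 4 * (m * m))%R).
  { replace (exp x * cos y + - (1) + - x)%R with (exp x * (cos y - 1) + (exp x - 1 - x))%R by ring.
    eapply Rle_trans; [apply Rabs_triang|]. rewrite Rabs_mult, (Rabs_pos_eq (exp x)) by lra.
    pose proof (Rabs_pos (cos y - 1)). nra. }
  assert (T2 : (Rabs (exp x * sin y + - 0 + - y) <= 2 * (m * m) + eps / 2 * m)%R).
  { replace (exp x * sin y + - 0 + - y)%R with ((exp x - 1) * sin y + (sin y - y))%R by ring.
    eapply Rle_trans; [apply Rabs_triang|]. rewrite Rabs_mult.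
    pose proof (Rabs_sin_le y). pose proof (Rabs_pos (sin y)). pose proof (Rabs_pos (exp x - 1)).
    apply Rplus_le_compat.
    - replace (2 * (m * m))%R with ((2 * m) * m)%R by ring. apply Rmult_le_compat; lra.
    - nra. }
  eapply Rle_trans; [apply Rplus_le_compat; [exact T1|exact T2]|]. nra. }
(* The addition formula carries the derivative at 0 over to every [z]. *)
apply (cderiv_ext (fun w => Cexp z * Cexp (w - z))).
{ intros w. rewrite <- Cexp_plus. f_equal. ring. }
eapply cderiv_eq; [|apply cderiv_scal, (cderiv_comp Cexp (fun w => w - z) z 1 1)].
- ring.
- replace (z - z) with (RtoC 0) by ring. exact H0.
- eapply cderiv_eq; [|apply cderiv_minus; [apply cderiv_id|apply cderiv_const]]. ring.
Qed.

(** * Mean value estimates along segments *)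

Lemma cderiv_line (f : C -> C) (a d D : C) (t : R) : cderiv f (a + t * d) D ->
  is_derive (fun s : R => Re (f (a + s * d))) t (Re (D * d)) /\
  is_derive (fun s : R => Im (f (a + s * d))) t (Im (D * d)).
Proof.
intros H.
assert (E : forall s : R, a + s * d = ((Re a + s * Re d)%R, (Im a + s * Im d)%R)).
{ intros s. apply C_ext; simpl; unfold Re, Im; ring. }
assert (L : forall u v : R, is_derive (fun s : R => (u + s * v)%R) t v).
{ intros u v. auto_derive; [exact I|ring]. }
rewrite E in H.
destruct (cderiv_curve f (fun s => Re a + s * Re d)%R (fun s => Im a + s * Im d)%R t _ _ D H (L _ _) (L _ _)) as [H1 H2].
replace (D * d) with (D * (Re d, Im d)) by (destruct d; reflexivity).
split; [eapply is_derive_ext; [|exact H1]|eapply is_derive_ext; [|exact H2]]; intros s; simpl; now rewrite E.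
Qed.

Lemma MVT_unit (f df : R -> R) :
  (forall t : R, (0 <= t <= 1)%R -> is_derive f t (df t)) ->
  exists c : R, (0 <= c <= 1)%R /\ (f 1 - f 0 = df c)%R.
Proof.
intros H. destruct (MVT_gen f 0 1 df) as [c [Hc E]].
- intros x Hx. rewrite Rmin_left, Rmax_right in Hx by lra. apply H; lra.
- intros x Hx. rewrite Rmin_left, Rmax_right in Hx by lra.
  apply continuity_pt_filterlim. apply (ex_derive_continuous f). exists (df x). apply H; lra.
- rewrite Rmin_left, Rmax_right in Hc by lra. exists c. split; [exact Hc|]. rewrite E. ring.
Qed.

(** The mean value theorem is applied to real and imaginary parts separately, with two different
    intermediate points; this costs the factor 2. *)
Lemma segment_bound (f f' : C -> C) (z : C) (K : R) :
  (forall t : R, (0 <= t <= 1)%R -> cderiv f (t * z) (f' (t * z)) /\ Cmod (f' (t * z) * z)%C <= K) ->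
  Cmod (f z - f 0)%C <= 2 * K.
Proof.
intros H.
assert (Hl : forall t : R, (0 <= t <= 1)%R -> cderiv f (0 + t * z) (f' (t * z))).
{ intros t Ht. rewrite Cplus_0_l. now apply H. }
destruct (MVT_unit (fun s => Re (f (0 + s * z))) (fun t => Re (f' (t * z) * z))) as [c [Hc E1]].
{ intros t Ht. apply (cderiv_line f 0 z _ t). now apply Hl. }
destruct (MVT_unit (fun s => Im (f (0 + s * z))) (fun t => Im (f' (t * z) * z))) as [d [Hd E2]].
{ intros t Ht. apply (cderiv_line f 0 z _ t). now apply Hl. }
replace (0 + 1 * z) with z in * by ring. replace (0 + 0 * z) with (RtoC 0) in * by ring.
eapply Rle_trans; [apply Cmod_le_Re_Im|].
unfold Cminus. rewrite re_plus, re_opp, im_plus, im_opp.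
change (Re (f z) + - Re (f 0))%R with (Re (f z) - Re (f 0))%R.
change (Im (f z) + - Im (f 0))%R with (Im (f z) - Im (f 0))%R.
rewrite E1, E2.
pose proof (re_le_Cmod (f' (c * z) * z)). pose proof (im_le_Cmod (f' (d * z) * z)).
pose proof (proj2 (H c Hc)). pose proof (proj2 (H d Hd)). lra.
Qed.

Lemma Omega_ray (z : C) (t : R) : (0 <= t <= 1)%R -> Omega z -> Omega (t * z).
Proof.
unfold Omega. intros Ht Hz. rewrite Cmod_mult, Cmod_R, Rabs_pos_eq by lra.
pose proof (Cmod_ge_0 z). nra.
Qed.

Lemma Omega_0 : Omega 0.
Proof. unfold Omega. rewrite Cmod_0. lra. Qed.

(** The tool for the functional identities of the extremal construction: an expression is shown to
    have derivative 0 and is evaluated at 0. *)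
Lemma cderiv_zero_const (f : C -> C) (z : C) :
  (forall w, Omega w -> cderiv f w 0) -> Omega z -> f z = f 0.
Proof.
intros H Hz.
pose proof (segment_bound f (fun _ => 0) z 0) as B.
assert (Hb : (Cmod (f z - f 0) <= 2 * 0)%R).
{ apply B. intros t Ht. split; [apply H; now apply Omega_ray|]. rewrite Cmult_0_l, Cmod_0. lra. }
assert (E : f z - f 0 = 0) by (apply Cmod_eq_0; pose proof (Cmod_ge_0 (f z - f 0)); lra).
replace (f z) with ((f z - f 0) + f 0) by ring. rewrite E. ring.
Qed.

(** One integration from 0 gains a power of [Cmod w] at the cost of a factor 2; iteration yields
    Taylor remainders. *)
Lemma integrate_bound (f f' : C -> C) (n : nat) (K : R) :
  f 0 = 0 -> (forall w, cderiv f w (f' w)) ->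
  (forall w, (Cmod w <= 1)%R -> (Cmod (f' w) <= K * Cmod w ^ n)%R) ->
  forall w, (Cmod w <= 1)%R -> (Cmod (f w) <= 2 * K * Cmod w ^ S n)%R.
Proof.
intros H0 Hd Hb w Hw.
replace (f w) with (f w - f 0) by (rewrite H0; ring).
rewrite Rmult_assoc. apply (segment_bound f f').
intros t Ht. split; [apply Hd|]. rewrite Cmod_mult.
assert (HK : (0 <= K)%R).
{ specialize (Hb 1). rewrite Cmod_1, pow1 in Hb. pose proof (Cmod_ge_0 (f' 1)). lra. }
assert (Ht1 : (Cmod (t * w) <= Cmod w)%R).
{ rewrite Cmod_mult, Cmod_R, Rabs_pos_eq by lra. pose proof (Cmod_ge_0 w). nra. }
simpl. replace (K * (Cmod w * Cmod w ^ n))%R with ((K * Cmod w ^ n) * Cmod w)%R by ring.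
apply Rmult_le_compat_r; [apply Cmod_ge_0|].
eapply Rle_trans; [apply Hb; lra|]. apply Rmult_le_compat_l; [exact HK|].
apply pow_incr. split; [apply Cmod_ge_0|exact Ht1].
Qed.

(** Four integrations, starting from [|Cexp v| <= exp 1] on the closed unit disc; each one subtracts
    a further Taylor term. *)
Lemma Cexp_taylor : exists K : R, forall v : C, (Cmod v <= 1)%R ->
  (Cmod (Cexp v - (1 + v + v ^ 2 / 2 + v ^ 3 / 6)) <= K * Cmod v ^ 4)%R.
Proof.
set (K := exp 1).
assert (B0 : forall v, (Cmod v <= 1)%R -> (Cmod (Cexp v) <= K * Cmod v ^ 0)%R).
{ intros v Hv. rewrite Cmod_Cexp. simpl. rewrite Rmult_1_r. unfold K.
  pose proof (re_le_Cmod v). pose proof (Rle_abs (Re v)).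
  destruct (Req_dec (Re v) 1) as [->|]; [lra|]. apply Rlt_le, exp_increasing. lra. }
pose proof (integrate_bound (fun v => Cexp v - 1) Cexp 0 K) as B1.
specialize (B1 ltac:(cbv beta; rewrite Cexp_0; ring)).
specialize (B1 ltac:(intros w; eapply cderiv_eq;
  [|apply cderiv_minus; [apply cderiv_Cexp|apply cderiv_const]]; ring) B0).
pose proof (integrate_bound (fun v => Cexp v - (1 + v)) (fun v => Cexp v - 1) 1 (2 * K)) as B2.
specialize (B2 ltac:(cbv beta; rewrite Cexp_0; ring)).
specialize (B2 ltac:(intros w; eapply cderiv_eq;
  [|apply cderiv_minus; [apply cderiv_Cexp|apply cderiv_plus; [apply cderiv_const|apply cderiv_id]]]; ring) B1).
pose proof (integrate_bound (fun v => Cexp v - (1 + v + / 2 * v ^ 2)) (fun v => Cexp v - (1 + v)) 2 (2 * (2 * K))) as B3.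
specialize (B3 ltac:(cbv beta; rewrite Cexp_0; ring)).
specialize (B3 ltac:(intros w; eapply cderiv_eq;
  [|apply cderiv_minus; [apply cderiv_Cexp|apply cderiv_plus; [apply cderiv_plus; [apply cderiv_const|apply cderiv_id]|apply cderiv_scal, cderiv_pow]]];
  rewrite ?S_INR, ?RtoC_plus; simpl; field) B2).
pose proof (integrate_bound (fun v => Cexp v - (1 + v + / 2 * v ^ 2 + / 6 * v ^ 3)) (fun v => Cexp v - (1 + v + / 2 * v ^ 2)) 3 (2 * (2 * (2 * K)))) as B4.
specialize (B4 ltac:(cbv beta; rewrite Cexp_0; ring)).
specialize (B4 ltac:(intros w; eapply cderiv_eq;
  [|apply cderiv_minus; [apply cderiv_Cexp|apply cderiv_plus; [apply cderiv_plus; [apply cderiv_plus; [apply cderiv_const|apply cderiv_id]|apply cderiv_scal, cderiv_pow]|apply cderiv_scal, cderiv_pow]]];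
  rewrite ?S_INR, ?RtoC_plus; simpl; field) B3).
eexists. intros v Hv.
replace (1 + v + v ^ 2 / 2 + v ^ 3 / 6) with (1 + v + / 2 * v ^ 2 + / 6 * v ^ 3) by field.
apply (B4 v Hv).
Qed.

(** * Complex sine, principal logarithm and principal arcsine *)

Definition Csin (v : C) : C := (Cexp (Ci * v) - Cexp (- (Ci * v))) / (2 * Ci).

Lemma Ci_neq_0 : Ci <> 0.
Proof. intros H. apply (f_equal Im) in H. simpl in H. lra. Qed.

Lemma Ci_sqr : Ci * Ci = -1.
Proof. apply C_ext; simpl; ring. Qed.

(** In the difference of the expansions of [Cexp] at [i v] and [- i v] the even terms cancel, and
    [i^3 = - i] gives the sign of the cubic term. *)
Lemma Csin_taylor : exists K : R, forall v : C, (Cmod v <= 1)%R ->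
  (Cmod (Csin v - (v - v ^ 3 / 6)) <= K * Cmod v ^ 4)%R.
Proof.
destruct Cexp_taylor as [K HK]. exists K. intros v Hv.
assert (HC : Cmod Ci = 1%R).
{ unfold Cmod. simpl. replace (0 * (0 * 1) + 1 * (1 * 1))%R with 1%R by ring. apply sqrt_1. }
assert (E1 : Cmod (Ci * v) = Cmod v) by (rewrite Cmod_mult, HC; ring).
assert (E2 : Cmod (- (Ci * v)) = Cmod v) by now rewrite Cmod_opp.
pose proof (HK (Ci * v) ltac:(lra)) as B1. pose proof (HK (- (Ci * v)) ltac:(lra)) as B2.
rewrite E1 in B1. rewrite E2 in B2.
set (X := Cexp (Ci * v) - _) in B1. set (Y := Cexp (- (Ci * v)) - _) in B2.
replace (Csin v - (v - v ^ 3 / 6)) with ((X - Y) / (2 * Ci)).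
2:{ unfold X, Y, Csin.
  assert (Q : Ci ^ 3 = - Ci) by (simpl; rewrite Cmult_1_r, Ci_sqr; ring).
  replace (v - v ^ 3 / 6) with ((2 * Ci * v + 2 * Ci ^ 3 * v ^ 3 / 6) / (2 * Ci)).
  - field. apply Ci_neq_0.
  - rewrite Q. field. apply Ci_neq_0. }
rewrite Cmod_div, Cmod_mult, HC, Cmod_R, (Rabs_pos_eq 2); try lra.
2:{ apply Cmult_neq_0; [|apply Ci_neq_0]. intros H. apply RtoC_inj in H. lra. }
apply Rle_div_l; [lra|]. unfold Cminus.
eapply Rle_trans; [apply Cmod_triangle|]. rewrite Cmod_opp. lra.
Qed.

Lemma Cexp_Clog (z : C) : z <> 0 -> Cexp (Clog z) = z.
Proof.
intros Hz. assert (Hm : (0 < Cmod z)%R) by now apply Cmod_gt_0.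
pose proof (Cmod_sqr z) as HS. set (m := Cmod z) in *.
assert (Hb : (-1 <= Re z / m <= 1)%R).
{ pose proof (re_le_Cmod z) as H. fold m in H. apply Rabs_le_between in H.
  split; [apply Rle_div_r|apply Rle_div_l]; lra. }
assert (Hc : cos (Carg z) = (Re z / m)%R).
{ unfold Carg. destruct (Rle_dec 0 (Im z)); rewrite ?cos_neg; now apply cos_acos. }
assert (Hs : (sin (Carg z) = Im z / m)%R).
{ assert (Q : sqrt (1 - (Re z / m)²) = (Rabs (Im z) / m)%R).
  { replace (1 - (Re z / m)²)%R with ((Rabs (Im z) / m)²)%R.
    - apply sqrt_Rsqr. apply Rdiv_le_0_compat; [apply Rabs_pos|exact Hm].
    - unfold Rsqr. replace (Rabs (Im z) / m * (Rabs (Im z) / m))%R with (Rabs (Im z) ^ 2 / (m * m))%R by (field; lra).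
      rewrite pow2_abs. apply (Rmult_eq_reg_r (m * m)%R); [|nra]. field_simplify; [|lra|lra]. simpl. lra. }
  unfold Carg. fold m. destruct (Rle_dec 0 (Im z)).
  - rewrite sin_acos, Q, Rabs_pos_eq by lra. reflexivity.
  - rewrite sin_neg, sin_acos, Q, Rabs_left by lra. field. lra. }
unfold Cexp, Clog; simpl. fold m. rewrite exp_ln, Hc, Hs by exact Hm.
apply C_ext; simpl; field; lra.
Qed.

Lemma Carg_bound (z : C) : (- PI <= Carg z <= PI)%R.
Proof.
unfold Carg. pose proof (acos_bound (Re z / Cmod z)). destruct (Rle_dec 0 (Im z)); lra.
Qed.

Lemma Clog_Cexp (v : C) : (- PI < Im v <= PI)%R -> Clog (Cexp v) = v.
Proof.
intros Hv. unfold Clog. rewrite Cmod_Cexp, ln_exp. apply C_ext; [reflexivity|].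
simpl. unfold Carg. rewrite Cmod_Cexp. pose proof (exp_pos (Re v)) as He.
replace (Re (Cexp v) / exp (Re v))%R with (cos (Im v)) by (simpl; field; lra).
simpl. destruct (Rle_dec 0 (exp (Re v) * sin (Im v))) as [H|H].
- destruct (Rle_lt_dec 0 (Im v)); [apply acos_cos; lra|].
  exfalso. pose proof (sin_lt_0_var (Im v) ltac:(lra) ltac:(lra)). nra.
- assert (Hn : (Im v < 0)%R).
  { apply Rnot_le_lt. intros H0. apply H. apply Rmult_le_pos; [lra|]. apply sin_ge_0; lra. }
  rewrite <- cos_neg, acos_cos; lra.
Qed.

Lemma Cmult_integral (x y : C) : x * y = 0 -> x = 0 \/ y = 0.
Proof.
intros H. destruct (Ceq_dec x 0) as [|Hx]; [now left|right].
destruct (Ceq_dec y 0) as [|Hy]; [easy|]. now destruct (Cmult_neq_0 x y Hx Hy).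
Qed.

Lemma Re_Csqrt (z : C) : (0 <= Re (Csqrt z))%R.
Proof.
unfold Csqrt, Cexp; simpl. apply Rmult_le_pos; [apply Rlt_le, exp_pos|].
pose proof (Carg_bound z). replace (Im (Clog z / 2)) with (Carg z / 2)%R.
- apply cos_ge_0; lra.
- unfold Clog, Cdiv, Cinv; simpl. field.
Qed.

Lemma Csqrt_sqr (z : C) : z <> 0 -> Csqrt z * Csqrt z = z.
Proof.
intros Hz. unfold Csqrt. rewrite <- Cexp_plus.
replace (Clog z / 2 + Clog z / 2) with (Clog z) by field. now apply Cexp_Clog.
Qed.

(** A junk value of argument [PI / 4]: the quotient in [Carg 0] has numerator 0, and
    [acos 0 = PI / 2]. It decides what [Carcsin] does at [w = 1] and [w = -1]. *)
Lemma Re_Csqrt_0 : (0 < Re (Csqrt 0))%R.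
Proof.
unfold Csqrt, Cexp; simpl. apply Rmult_lt_0_compat; [apply exp_pos|].
replace (Im (Clog 0 / 2)) with (Carg 0 / 2)%R.
2:{ unfold Clog, Cdiv, Cinv; simpl. field. }
unfold Carg. destruct (Rle_dec 0 (Im 0)) as [H|H]; [|simpl in H; lra].
replace (Re 0 / Cmod 0)%R with 0%R by (simpl; unfold Rdiv; ring).
rewrite acos_0. pose proof PI_RGT_0. apply cos_gt_0; lra.
Qed.

Lemma Csin_Clog (E : C) : E <> 0 -> Csin (- Ci * Clog E) = (E - / E) / (2 * Ci).
Proof.
intros HE. unfold Csin.
replace (Ci * (- Ci * Clog E)) with (- (Ci * Ci) * Clog E) by ring. rewrite Ci_sqr.
replace (- (-1) * Clog E) with (Clog E) by ring.
pose proof (Cexp_opp (Clog E)) as H. rewrite (Cexp_Clog E HE) in *.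
replace (Cexp (- Clog E)) with (/ E * (E * Cexp (- Clog E))) by (field; exact HE).
rewrite H, Cmult_1_r. reflexivity.
Qed.

(** If [w^2 <> 1], the number has the inverse [Csqrt (1 - w^2) - i w]. If [w^2 = 1], its vanishing
    would mean [w = i Csqrt 0], which is not real. *)
Lemma Cexp_arcsin_arg (w : C) : Ci * w + Csqrt (1 - w ^ 2) <> 0.
Proof.
intros H. destruct (Ceq_dec (1 - w ^ 2) 0) as [E|E].
- rewrite E in H. pose proof Re_Csqrt_0 as P.
  assert (Q : w = Ci * Csqrt 0).
  { replace w with (- (Ci * Ci) * w) by (rewrite Ci_sqr; ring).
    replace (- (Ci * Ci) * w) with (Ci * Csqrt 0 - Ci * (Ci * w + Csqrt 0)) by ring. rewrite H. ring. }
  assert (W : (w - 1) * (w + 1) = 0) by (replace ((w - 1) * (w + 1)) with (- (1 - w ^ 2)) by ring; rewrite E; ring).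
  assert (HI : (Im w <> 0)%R).
  { rewrite Q, im_mult. simpl. unfold Re, Im in *; simpl in *. lra. }
  apply Cmult_integral in W. apply HI.
  destruct W as [W|W]; apply (f_equal Im) in W; simpl in W; unfold Im; lra.
- pose proof (Csqrt_sqr _ E) as S.
  assert (P : (Ci * w + Csqrt (1 - w ^ 2)) * (Csqrt (1 - w ^ 2) - Ci * w) = 1).
  { transitivity (Csqrt (1 - w ^ 2) * Csqrt (1 - w ^ 2) - Ci * Ci * (w * w)); [ring|].
    rewrite S, Ci_sqr. ring. }
  rewrite H, Cmult_0_l in P. apply RtoC_inj in P. lra.
Qed.

(* At w = 1 and w = -1 the value [Csqrt 0] is a nonzero number, so that
   [Carcsin w] is not an inverse sine of w. *)
Lemma Csin_Carcsin (w : C) : Csin (Carcsin w) = w <-> w ^ 2 <> 1.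
Proof.
unfold Carcsin. set (s := Csqrt (1 - w ^ 2)). pose proof (Cexp_arcsin_arg w) as HE. fold s in HE.
rewrite Csin_Clog by exact HE. pose proof Ci_neq_0 as HC.
assert (H2 : RtoC 2 <> 0) by (intros H; apply RtoC_inj in H; lra).
assert (D : ((Ci * w + s) - / (Ci * w + s)) / (2 * Ci) - w = (s * s - (1 - w ^ 2)) / (2 * Ci * (Ci * w + s))).
{ replace (1 - w ^ 2) with (1 + (Ci * Ci) * w ^ 2) by (rewrite Ci_sqr; ring). field. repeat split; assumption. }
split.
- intros H Hw. rewrite H in D. replace (w - w) with (RtoC 0) in D by ring.
  replace (1 - w ^ 2) with (RtoC 0) in D by (rewrite Hw; ring).
  assert (Hs : s <> 0) by (apply Cexp_neq_0).
  assert (Z : s * s = (s * s - 0) / (2 * Ci * (Ci * w + s)) * (2 * Ci * (Ci * w + s))) by (field; repeat split; assumption).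
  rewrite <- D, Cmult_0_l in Z. now destruct (Cmult_integral _ _ Z).
- intros Hw.
  assert (Hz : 1 - w ^ 2 <> 0) by (intros H; apply Hw; replace (w ^ 2) with (1 - (1 - w ^ 2)) by ring; rewrite H; ring).
  unfold s in D at 3 4. rewrite (Csqrt_sqr _ Hz) in D.
  match type of D with ?x - w = _ => replace x with ((x - w) + w) by ring end.
  rewrite D. unfold Cdiv. ring.
Qed.

(** [i w + s] and its inverse [s - i w] have modulus at most 3, so the logarithm of the modulus is
    at most 4 in absolute value, and so is the argument. The 8 becomes the constant of the
    differential inequality [|z p'| <= 8 |p|]. *)
Lemma Carcsin_bounded (w : C) : (Cmod w <= 1)%R -> w ^ 2 <> 1 -> (Cmod (Carcsin w) <= 8)%R.
Proof.
intros Hw Hw2. unfold Carcsin. rewrite Cmod_mult, Cmod_opp.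
assert (HC : Cmod Ci = 1%R).
{ unfold Cmod. simpl. replace (0 * (0 * 1) + 1 * (1 * 1))%R with 1%R by ring. apply sqrt_1. }
rewrite HC, Rmult_1_l.
assert (Hz : 1 - w ^ 2 <> 0) by (intros H; apply Hw2; replace (w ^ 2) with (1 - (1 - w ^ 2)) by ring; rewrite H; ring).
pose proof (Csqrt_sqr _ Hz) as S. set (s := Csqrt (1 - w ^ 2)) in *.
assert (Hs : (Cmod s <= 2)%R).
{ apply (f_equal Cmod) in S. rewrite Cmod_mult in S.
  pose proof (Cmod_triangle 1 (- w ^ 2)) as T. rewrite Cmod_opp, Cmod_pow, Cmod_1 in T.
  change (1 + - w ^ 2) with (1 - w ^ 2) in T. rewrite <- S in T.
  pose proof (Cmod_ge_0 s). pose proof (Cmod_ge_0 w). nra. }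
assert (P : (Ci * w + s) * (s - Ci * w) = 1).
{ transitivity (s * s - Ci * Ci * (w * w)); [ring|]. rewrite S, Ci_sqr. ring. }
set (E := Ci * w + s) in *.
assert (HE : (Cmod E <= 3)%R).
{ unfold E. eapply Rle_trans; [apply Cmod_triangle|]. rewrite Cmod_mult, HC. lra. }
assert (HE' : (Cmod (s - Ci * w) <= 3)%R).
{ eapply Rle_trans; [apply Cmod_triangle|]. rewrite Cmod_opp, Cmod_mult, HC. lra. }
apply (f_equal Cmod) in P. rewrite Cmod_mult, Cmod_1 in P.
pose proof (Cmod_ge_0 E).
assert (HE3 : (/ 3 <= Cmod E)%R) by nra.
assert (HL : (Rabs (ln (Cmod E)) <= 4)%R).
{ assert (E3 : (ln 3 <= 2)%R).
  { rewrite <- (ln_exp 2). apply Rlt_le. apply ln_increasing; [lra|]. pose proof (exp_ineq1 2 ltac:(lra)). lra. }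
  assert (A : forall x y : R, (0 < x)%R -> (x <= y)%R -> (ln x <= ln y)%R).
  { intros x y Hx Hxy. destruct (Req_dec x y) as [->|]; [lra|]. apply Rlt_le, ln_increasing; lra. }
  pose proof (A (Cmod E) 3%R ltac:(lra) HE). pose proof (A (/ 3)%R (Cmod E) ltac:(lra) HE3) as HL.
  rewrite ln_Rinv in HL by lra. apply Rabs_le. lra. }
eapply Rle_trans; [apply Cmod_le_Re_Im|]. simpl. unfold Re, Im; simpl.
pose proof (Carg_bound E). pose proof PI_4. assert (Rabs (Carg E) <= 4)%R by (apply Rabs_le; lra). lra.
Qed.

(** How a candidate is recognised as the principal value: of the two square roots of [1 - w^2] only
    [s] has positive real part, and in the strip for [Re v] the principal logarithm inverts the
    exponential. *)
Lemma Carcsin_unique (w s v : C) :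
  s * s = 1 - w ^ 2 -> (0 < Re s)%R -> Cexp (Ci * v) = s + Ci * w -> (- PI < Re v <= PI)%R ->
  Carcsin w = v.
Proof.
intros Hs Hr He Hv.
assert (Hz : 1 - w ^ 2 <> 0).
{ rewrite <- Hs. intros H. apply Cmult_integral in H. assert (H0 : s = 0) by tauto. rewrite H0 in Hr. simpl in Hr. lra. }
assert (E : Csqrt (1 - w ^ 2) = s).
{ pose proof (Csqrt_sqr _ Hz) as Q. set (r := Csqrt (1 - w ^ 2)) in *.
  assert (W : (r - s) * (r + s) = 0).
  { replace ((r - s) * (r + s)) with (r * r - s * s) by ring. rewrite Q, Hs. ring. }
  apply Cmult_integral in W. destruct W as [W|W].
  - replace r with ((r - s) + s) by ring. rewrite W. ring.
  - pose proof (Re_Csqrt (1 - w ^ 2)) as P. fold r in P.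
    apply (f_equal Re) in W. rewrite re_plus, re_RtoC in W. lra. }
unfold Carcsin. rewrite E, Cplus_comm, <- He.
rewrite Clog_Cexp.
- replace (- Ci * (Ci * v)) with (- (Ci * Ci) * v) by ring. rewrite Ci_sqr. ring.
- rewrite im_mult. simpl. lra.
Qed.

(** * Taylor expansions of order 3 at 0 *)

Definition bigO (n : nat) (f : C -> C) : Prop :=
  exists K delta : R, 0 < delta /\ 0 <= K /\
    forall z : C, Cmod z < delta -> Cmod (f z) <= K * Cmod z ^ n.

Lemma bigO_ext (n : nat) (f g : C -> C) : (forall z, f z = g z) -> bigO n f -> bigO n g.
Proof.
intros E (K & d & Hd & HK & H). exists K, d. repeat split; try assumption.
intros z Hz. rewrite <- E. now apply H.
Qed.

Lemma bigO_const (c : C) : bigO 0 (fun _ => c).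
Proof.
exists (Cmod c), 1%R. repeat split; [lra|apply Cmod_ge_0|]. intros z _. simpl. lra.
Qed.

Lemma bigO_id : bigO 1 (fun z => z).
Proof. exists 1%R, 1%R. repeat split; try lra. intros z _. simpl. lra. Qed.

Lemma bigO_plus (n : nat) (f g : C -> C) : bigO n f -> bigO n g -> bigO n (fun z => f z + g z).
Proof.
intros (K & d & Hd & HK & H) (K' & d' & Hd' & HK' & H').
exists (K + K')%R, (Rmin d d'). repeat split; [now apply Rmin_pos|lra|].
intros z Hz. eapply Rle_trans; [apply Cmod_triangle|]. rewrite Rmult_plus_distr_r.
apply Rplus_le_compat; [apply H|apply H'].
- eapply Rlt_le_trans; [exact Hz|apply Rmin_l].
- eapply Rlt_le_trans; [exact Hz|apply Rmin_r].
Qed.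

Lemma bigO_mult (n m : nat) (f g : C -> C) : bigO n f -> bigO m g -> bigO (n + m) (fun z => f z * g z).
Proof.
intros (K & d & Hd & HK & H) (K' & d' & Hd' & HK' & H').
exists (K * K')%R, (Rmin d d'). repeat split; [now apply Rmin_pos|now apply Rmult_le_pos|].
intros z Hz. rewrite Cmod_mult, pow_add.
replace (K * K' * (Cmod z ^ n * Cmod z ^ m))%R with ((K * Cmod z ^ n) * (K' * Cmod z ^ m))%R by ring.
apply Rmult_le_compat; try apply Cmod_ge_0; [apply H|apply H'].
- eapply Rlt_le_trans; [exact Hz|apply Rmin_l].
- eapply Rlt_le_trans; [exact Hz|apply Rmin_r].
Qed.

Lemma bigO_scal (n : nat) (c : C) (f : C -> C) : bigO n f -> bigO n (fun z => c * f z).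
Proof. intros H. exact (bigO_mult 0 n (fun _ => c) f (bigO_const c) H). Qed.

Lemma bigO_minus (n : nat) (f g : C -> C) : bigO n f -> bigO n g -> bigO n (fun z => f z - g z).
Proof.
intros Hf Hg. apply (bigO_ext n (fun z => f z + (-1) * g z)); [intros; ring|].
apply bigO_plus; [exact Hf|now apply bigO_scal].
Qed.

Lemma bigO_weaken (n m : nat) (f : C -> C) : (n <= m)%nat -> bigO m f -> bigO n f.
Proof.
intros Hnm (K & d & Hd & HK & H).
exists K, (Rmin d 1). repeat split; [apply Rmin_pos; lra|exact HK|].
intros z Hz.
assert (H1 : (Cmod z < d)%R) by (eapply Rlt_le_trans; [exact Hz|apply Rmin_l]).
assert (H2 : (Cmod z < 1)%R) by (eapply Rlt_le_trans; [exact Hz|apply Rmin_r]).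
eapply Rle_trans; [now apply H|]. apply Rmult_le_compat_l; [exact HK|].
replace m with (n + (m - n))%nat by lia. rewrite pow_add. pose proof (Cmod_ge_0 z).
rewrite <- (Rmult_1_r (Cmod z ^ n)) at 2. apply Rmult_le_compat_l; [now apply pow_le|].
rewrite <- (pow1 (m - n)). apply pow_incr. lra.
Qed.

Lemma bigO_pow (n : nat) : bigO n (fun z => z ^ n).
Proof.
induction n as [|n IH]; [exact (bigO_const 1)|]. exact (bigO_mult 1 n _ _ bigO_id IH).
Qed.

Lemma bigO_pow_mult (n : nat) (f : C -> C) : bigO 0 f -> bigO n (fun z => z ^ n * f z).
Proof. intros H. rewrite <- (Nat.add_0_r n) at 1. exact (bigO_mult n 0 _ _ (bigO_pow n) H). Qed.

Lemma bigO_cderiv (f : C -> C) (d : C) : cderiv f 0 d -> bigO 0 f.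
Proof.
intros H. destruct (cderiv_cont f 0 d H 1%R Rlt_0_1) as [delta [Hd Hc]].
exists (Cmod (f 0) + 1)%R, delta. pose proof (Cmod_ge_0 (f 0)). repeat split; [exact Hd|lra|].
intros z Hz. specialize (Hc z). replace (z - 0) with z in Hc by ring.
pose proof (Cmod_triangle (f z - f 0) (f 0)) as T. replace (f z - f 0 + f 0) with (f z) in T by ring.
specialize (Hc Hz). simpl. lra.
Qed.

(* [f z = a0 + a1 z + a2 z^2 + a3 z^3 + O(z^4)] at [0] *)
Definition taylor3 (f : C -> C) (a0 a1 a2 a3 : C) : Prop :=
  bigO 4 (fun z => f z - (a0 + a1 * z + a2 * z ^ 2 + a3 * z ^ 3)).

Lemma bigO_id_0 : bigO 0 (fun z => z).
Proof. apply (bigO_weaken 0 1); [lia|exact bigO_id]. Qed.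

Lemma bigO_pow_0 (n : nat) : bigO 0 (fun z => z ^ n).
Proof. apply (bigO_weaken 0 n); [lia|apply bigO_pow]. Qed.

Ltac bigO_poly :=
  repeat first [ exact bigO_id_0 | exact (bigO_pow_0 _) | apply bigO_const
               | apply bigO_scal | apply bigO_plus ].

Lemma taylor3_ext_loc (f g : C -> C) (a0 a1 a2 a3 : C) (rho : R) :
  (0 < rho)%R -> (forall z, Cmod z < rho -> f z = g z) -> taylor3 f a0 a1 a2 a3 -> taylor3 g a0 a1 a2 a3.
Proof.
intros Hr E (K & d & Hd & HK & H). exists K, (Rmin d rho). repeat split; [now apply Rmin_pos|exact HK|].
intros z Hz. rewrite <- E.
- apply H. eapply Rlt_le_trans; [exact Hz|apply Rmin_l].
- eapply Rlt_le_trans; [exact Hz|apply Rmin_r].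
Qed.

Lemma taylor3_eq (f : C -> C) (a0 a1 a2 a3 b0 b1 b2 b3 : C) :
  a0 = b0 -> a1 = b1 -> a2 = b2 -> a3 = b3 -> taylor3 f a0 a1 a2 a3 -> taylor3 f b0 b1 b2 b3.
Proof. now intros -> -> -> ->. Qed.

Lemma taylor3_const (c : C) : taylor3 (fun _ => c) c 0 0 0.
Proof.
apply (bigO_ext 4 (fun z => z ^ 4 * 0)); [intros; simpl; ring|]. apply bigO_pow_mult, bigO_const.
Qed.

Lemma taylor3_id : taylor3 (fun z => z) 0 1 0 0.
Proof.
apply (bigO_ext 4 (fun z => z ^ 4 * 0)); [intros; simpl; ring|]. apply bigO_pow_mult, bigO_const.
Qed.

Lemma taylor3_plus (f g : C -> C) (a0 a1 a2 a3 b0 b1 b2 b3 : C) :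
  taylor3 f a0 a1 a2 a3 -> taylor3 g b0 b1 b2 b3 ->
  taylor3 (fun z => f z + g z) (a0 + b0) (a1 + b1) (a2 + b2) (a3 + b3).
Proof.
intros Hf Hg. eapply bigO_ext; [|apply (bigO_plus _ _ _ Hf Hg)]. intros z. simpl. ring.
Qed.

Lemma taylor3_mult (f g : C -> C) (a0 a1 a2 a3 b0 b1 b2 b3 : C) :
  taylor3 f a0 a1 a2 a3 -> taylor3 g b0 b1 b2 b3 ->
  taylor3 (fun z => f z * g z) (a0 * b0) (a0 * b1 + a1 * b0) (a0 * b2 + a1 * b1 + a2 * b0)
    (a0 * b3 + a1 * b2 + a2 * b1 + a3 * b0).
Proof.
intros Hf Hg. unfold taylor3 in *.
set (p := fun z : C => a0 + a1 * z + a2 * z ^ 2 + a3 * z ^ 3).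
set (q := fun z : C => b0 + b1 * z + b2 * z ^ 2 + b3 * z ^ 3).
assert (Hp : bigO 0 p) by (unfold p; bigO_poly).
assert (Hq : bigO 0 q) by (unfold q; bigO_poly).
(* The terms of degree 4 to 6 in the product of the two polynomials, divided by [z^4]. *)
set (s := fun z : C => (a1 * b3 + a2 * b2 + a3 * b1) + (a2 * b3 + a3 * b2) * z + a3 * b3 * z ^ 2).
assert (Hs : bigO 0 s) by (unfold s; bigO_poly).
apply (bigO_ext 4 (fun z => (((f z - p z) * (g z - q z) + (f z - p z) * q z) + p z * (g z - q z)) + z ^ 4 * s z)).
{ intros z. unfold p, q, s. simpl. ring. }
apply bigO_plus; [|now apply bigO_pow_mult].
apply bigO_plus; [apply bigO_plus|].
- apply (bigO_weaken 4 8); [lia|]. exact (bigO_mult 4 4 _ _ Hf Hg).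
- exact (bigO_mult 4 0 _ _ Hf Hq).
- exact (bigO_mult 0 4 _ _ Hp Hg).
Qed.

Lemma taylor3_scal (c : C) (f : C -> C) (a0 a1 a2 a3 : C) :
  taylor3 f a0 a1 a2 a3 -> taylor3 (fun z => c * f z) (c * a0) (c * a1) (c * a2) (c * a3).
Proof.
intros H. eapply taylor3_eq; [..|exact (taylor3_mult _ _ _ _ _ _ _ _ _ _ (taylor3_const c) H)]; ring.
Qed.

Lemma taylor3_psum (a : nat -> C) : CVdisk a ->
  taylor3 (psum a) (a 0%nat) (a 1%nat) (a 2%nat) (a 3%nat).
Proof.
intros Ha.
set (b := fun n => a (S (S (S (S n))))).
assert (H1 : CVdisk (fun n => a (S n))) by now apply CVdisk_tail.
assert (H2 : CVdisk (fun n => a (S (S n)))) by exact (CVdisk_tail _ H1).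
assert (H3 : CVdisk (fun n => a (S (S (S n))))) by exact (CVdisk_tail _ H2).
assert (Hb : CVdisk b) by exact (CVdisk_tail _ H3).
destruct (bigO_pow_mult 4 (psum b) (bigO_cderiv _ _ (cderiv_psum b 0 Hb Omega_0))) as (K & d & Hd & HK & H).
exists K, (Rmin d 1). repeat split; [apply Rmin_pos; lra|exact HK|]. intros z Hz.
assert (Hz1 : (Cmod z < d)%R) by (eapply Rlt_le_trans; [exact Hz|apply Rmin_l]).
assert (Hz2 : Omega z) by (eapply Rlt_le_trans; [exact Hz|apply Rmin_r]).
rewrite (psum_tail a z Ha Hz2), (psum_tail _ z H1 Hz2), (psum_tail _ z H2 Hz2), (psum_tail _ z H3 Hz2).
fold b.
match goal with |- Cmod ?x <= _ => replace x with (z ^ 4 * psum b z) by (simpl; ring) end.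
now apply H.
Qed.

Lemma bigO_small_const (n : nat) (c : C) (f : C -> C) :
  (forall z, f z = c * z ^ n) -> bigO (S n) f -> c = 0.
Proof.
intros E (K & d & Hd & HK & H).
destruct (Ceq_dec c 0) as [|Hc]; [assumption|exfalso].
apply Cmod_gt_0 in Hc.
set (r := Rmin (d / 2) (Cmod c / (2 * (K + 1)))).
assert (Hr : (0 < r)%R) by (apply Rmin_pos; [lra|apply Rdiv_lt_0_compat; lra]).
assert (Hr1 : (r <= d / 2)%R) by apply Rmin_l.
assert (Hr2 : (r <= Cmod c / (2 * (K + 1)))%R) by apply Rmin_r.
apply (Rle_div_r r (Cmod c) (2 * (K + 1))) in Hr2; [|lra].
specialize (H (RtoC r)). rewrite E, Cmod_mult, Cmod_pow, Cmod_R, Rabs_pos_eq in H by lra.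
specialize (H ltac:(lra)). simpl in H.
assert (Hp : (0 < r ^ n)%R) by now apply pow_lt.
assert (H' : (Cmod c <= K * r)%R) by (apply (Rmult_le_reg_r (r ^ n)%R); [exact Hp|lra]).
nra.
Qed.

Lemma taylor3_unique (f : C -> C) (a0 a1 a2 a3 b0 b1 b2 b3 : C) :
  taylor3 f a0 a1 a2 a3 -> taylor3 f b0 b1 b2 b3 -> a0 = b0 /\ a1 = b1 /\ a2 = b2 /\ a3 = b3.
Proof.
intros Ha Hb.
pose proof (bigO_minus _ _ _ Hb Ha) as H. clear Ha Hb.
assert (D : forall x y : C, x - y = 0 -> x = y) by (intros x y E; replace x with ((x - y) + y) by ring; rewrite E; ring).
(* Once the lower coefficients agree, subtracting the higher terms [g] leaves one monomial [c z^n]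
   that is [O(z^(n+1))], hence [c = 0]. *)
assert (Q : forall n c g, (S n <= 4)%nat -> bigO (S n) g -> (forall z, (c * z ^ n + g z) =
   (f z - (b0 + b1 * z + b2 * z ^ 2 + b3 * z ^ 3) - (f z - (a0 + a1 * z + a2 * z ^ 2 + a3 * z ^ 3)))) -> c = 0).
{ intros n c g Hn Hg E. apply (bigO_small_const n c (fun z => c * z ^ n)); [reflexivity|].
  pose proof (bigO_minus _ _ _ (bigO_weaken (S n) 4 _ Hn H) Hg) as G. eapply bigO_ext; [|exact G].
  intros z. cbv beta. rewrite <- E. ring. }
assert (P1 : forall c, bigO 1 (fun z => c * z)) by (intros; apply bigO_scal, bigO_id).
assert (P : forall n c, bigO n (fun z => c * z ^ n)) by (intros; apply bigO_scal, bigO_pow).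
assert (E0 : a0 = b0).
{ apply D. apply (Q 0%nat _ (fun z => (a1 - b1) * z + (a2 - b2) * z ^ 2 + (a3 - b3) * z ^ 3)); [lia| |intros; simpl; ring].
  repeat apply bigO_plus; [apply P1|apply (bigO_weaken 1 2); [lia|apply P]|apply (bigO_weaken 1 3); [lia|apply P]]. }
subst b0.
assert (E1 : a1 = b1).
{ apply D. apply (Q 1%nat _ (fun z => (a2 - b2) * z ^ 2 + (a3 - b3) * z ^ 3)); [lia| |intros; simpl; ring].
  repeat apply bigO_plus; [apply (bigO_weaken 2 2); [lia|apply P]|apply (bigO_weaken 2 3); [lia|apply P]]. }
subst b1.
assert (E2 : a2 = b2).
{ apply D. apply (Q 2%nat _ (fun z => (a3 - b3) * z ^ 3)); [lia| |intros; simpl; ring]. apply P. }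
subst b2. repeat split; try reflexivity.
apply D. apply (Q 3%nat _ (fun z => 0 * z ^ 4)); [lia| |intros; simpl; ring]. apply P.
Qed.

(** The equations say that [n] and [(v1 z + v2 z^2 + v3 z^3) f] agree to order 3. Dividing their
    [O(z^4)] difference by [f] preserves the order, as [1 / f] is bounded near 0. *)
Lemma taylor3_quotient (n f : C -> C) (a1 a2 a3 b1 b2 b3 v1 v2 v3 d : C) :
  taylor3 n 0 a1 a2 a3 -> taylor3 f 1 b1 b2 b3 -> cderiv f 0 d ->
  a1 = v1 -> a2 = v2 + v1 * b1 -> a3 = v3 + v2 * b1 + v1 * b2 -> f 0 = 1 ->
  taylor3 (fun z => n z / f z) 0 v1 v2 v3.
Proof.
intros Hn Hf Hd -> -> -> H1.
assert (Hp : taylor3 (fun z => v1 * z + v2 * z ^ 2 + v3 * z ^ 3) 0 v1 v2 v3).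
{ apply (bigO_ext 4 (fun z => z ^ 4 * 0)); [intros; simpl; ring|]. apply bigO_pow_mult, bigO_const. }
pose proof (taylor3_mult _ _ _ _ _ _ _ _ _ _ Hp Hf) as Hm.
pose proof (bigO_minus _ _ _ Hn Hm) as Hdiff. cbv beta in Hdiff.
destruct (cderiv_cont f 0 d Hd (1 / 2)%R ltac:(lra)) as [delta [Hdelta Hc]].
assert (Hfz : forall z, (Cmod z < delta)%R -> (1 / 2 <= Cmod (f z))%R /\ f z <> 0).
{ intros z Hz. specialize (Hc z). replace (z - 0) with z in Hc by ring. specialize (Hc Hz).
  rewrite H1 in Hc. pose proof (Cmod_triangle (1 - f z) (f z)) as T.
  replace (1 - f z + f z) with (RtoC 1) in T by ring. rewrite Cmod_1 in T.
  replace (1 - f z) with (- (f z - 1)) in T by ring. rewrite Cmod_opp in T.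
  split; [lra|]. apply Cmod_gt_0. lra. }
assert (Hinv : bigO 0 (fun z => / f z)).
{ exists 2%R, delta. repeat split; [exact Hdelta|lra|]. intros z Hz. destruct (Hfz z Hz) as [A B].
  rewrite Cmod_inv by exact B. simpl. rewrite Rmult_1_r. replace 2%R with (/ (1 / 2))%R by field.
  apply Rinv_le_contravar; lra. }
destruct (bigO_mult 4 0 _ _ Hdiff Hinv) as (K & d' & Hd' & HK & H).
exists K, (Rmin d' delta). repeat split; [now apply Rmin_pos|exact HK|]. intros z Hz.
assert (Hz1 : (Cmod z < d')%R) by (eapply Rlt_le_trans; [exact Hz|apply Rmin_l]).
assert (Hz2 : (Cmod z < delta)%R) by (eapply Rlt_le_trans; [exact Hz|apply Rmin_r]).
specialize (H z Hz1). cbv beta in H.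
match type of H with Cmod ?x <= _ => replace x with (n z / f z - (0 + v1 * z + v2 * z ^ 2 + v3 * z ^ 3)) in H end.
- exact H.
- field. apply (Hfz z Hz2).
Qed.

Lemma bigO_taylor_comp (F P : C -> C) (K : R) (v : C -> C) :
  (forall w : C, Cmod w <= 1 -> Cmod (F w - P w)%C <= K * Cmod w ^ 4) ->
  bigO 1 v -> bigO 4 (fun z => F (v z) - P (v z)).
Proof.
intros HK (L & d & Hd & HL & H).
(* The second radius forces [Cmod (v z) <= 1]; [Rmax K 0] is there because [K] may be negative while
   [bigO] asks for a nonnegative constant. *)
exists (Rmax K 0 * L ^ 4)%R, (Rmin d (/ (L + 1))).
assert (HL1 : (0 < / (L + 1))%R) by (apply Rinv_0_lt_compat; lra).
repeat split; [now apply Rmin_pos|apply Rmult_le_pos; [apply Rmax_r|now apply pow_le]|].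
intros z Hz.
assert (Hz1 : (Cmod z < d)%R) by (eapply Rlt_le_trans; [exact Hz|apply Rmin_l]).
assert (Hz2 : (Cmod z < / (L + 1))%R) by (eapply Rlt_le_trans; [exact Hz|apply Rmin_r]).
specialize (H z Hz1). rewrite pow_1 in H. pose proof (Cmod_ge_0 z) as Hz0.
apply (Rmult_lt_compat_l (L + 1)) in Hz2; [|lra]. rewrite Rinv_r in Hz2 by lra.
eapply Rle_trans; [apply HK; nra|].
rewrite Rmult_assoc, <- Rpow_mult_distr.
apply Rle_trans with (Rmax K 0 * Cmod (v z) ^ 4)%R.
- apply Rmult_le_compat_r; [apply pow_le, Cmod_ge_0|apply Rmax_l].
- apply Rmult_le_compat_l; [apply Rmax_r|]. apply pow_incr. split; [apply Cmod_ge_0|exact H].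
Qed.

Lemma taylor3_bigO_1 (v : C -> C) (v1 v2 v3 : C) : taylor3 v 0 v1 v2 v3 -> bigO 1 v.
Proof.
intros Hv.
apply (bigO_ext 1 (fun z => (v z - (0 + v1 * z + v2 * z ^ 2 + v3 * z ^ 3)) + z ^ 1 * (v1 + v2 * z + v3 * z ^ 2)));
 [intros; simpl; ring|].
apply bigO_plus; [apply (bigO_weaken 1 4); [lia|exact Hv]|]. apply bigO_pow_mult. bigO_poly.
Qed.

Lemma taylor3_Csin (v : C -> C) (v1 v2 v3 : C) :
  taylor3 v 0 v1 v2 v3 -> taylor3 (fun z => Csin (v z)) 0 v1 v2 (v3 - v1 ^ 3 / 6).
Proof.
intros Hv.
pose proof (taylor3_bigO_1 v v1 v2 v3 Hv) as Hv1.
destruct Csin_taylor as [K HK].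
pose proof (bigO_taylor_comp Csin (fun w => w - w ^ 3 / 6) K v HK Hv1) as HR. cbv beta in HR.
pose proof (taylor3_mult _ _ _ _ _ _ _ _ _ _ Hv (taylor3_mult _ _ _ _ _ _ _ _ _ _ Hv Hv)) as H3.
pose proof (taylor3_plus _ _ _ _ _ _ _ _ _ _ Hv (taylor3_scal (- / 6) _ _ _ _ _ H3)) as HS. cbv beta in HS.
pose proof (bigO_plus _ _ _ HR HS) as H. eapply bigO_ext; [|exact H].
intros z. simpl. field.
Qed.

(** * Means over circles *)

Definition circ (r t : R) : C := ((r * cos t)%R, (r * sin t)%R).

Lemma Cmod_circ (r t : R) : (0 <= r)%R -> Cmod (circ r t) = r.
Proof.
intros Hr. pose proof (Cmod_sqr (circ r t)) as H. unfold circ at 3 4 5 6 in H. simpl in H.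
pose proof (sin2_cos2 t) as T. unfold Rsqr in T. pose proof (Cmod_ge_0 (circ r t)).
assert (E : (Cmod (circ r t) * Cmod (circ r t) = r * r)%R).
{ rewrite H. transitivity (r * r * (sin t * sin t + cos t * cos t))%R; [ring|]. rewrite T. ring. }
nra.
Qed.

Lemma circ_neq_0 (r t : R) : (0 < r)%R -> circ r t <> 0.
Proof. intros Hr. apply Cmod_gt_0. rewrite Cmod_circ; lra. Qed.

Lemma circ_2PI (r : R) : circ r (2 * PI) = circ r 0.
Proof. unfold circ. now rewrite cos_2PI, sin_2PI, cos_0, sin_0. Qed.

Lemma is_derive_circ (g : C -> C) (r t : R) (d : C) : cderiv g (circ r t) d ->
  is_derive (fun s => Re (g (circ r s))) t (Re (d * (Ci * circ r t))).
Proof.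
intros H.
destruct (cderiv_curve g (fun s => r * cos s)%R (fun s => r * sin s)%R t (- r * sin t) (r * cos t) d H) as [H1 _].
- auto_derive; [exact I|ring].
- auto_derive; [exact I|ring].
- replace (Ci * circ r t) with (((- r * sin t)%R, (r * cos t)%R) : C); [exact H1|].
  apply C_ext; simpl; unfold Re, Im; simpl; ring.
Qed.

Lemma continuous_circ (g : C -> C) (r t : R) (d : C) : cderiv g (circ r t) d ->
  continuous (fun s => Re (g (circ r s))) t.
Proof.
intros H. apply (ex_derive_continuous (fun s => Re (g (circ r s)))).
exact (ex_intro _ _ (is_derive_circ g r t d H)).
Qed.

Lemma ex_RInt_circ (g g' : C -> C) (r : R) : (forall t, cderiv g (circ r t) (g' (circ r t))) ->
  ex_RInt (fun t => Re (g (circ r t))) 0 (2 * PI).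
Proof.
intros H. apply (ex_RInt_continuous (V := R_CompleteNormedModule)). intros t _.
exact (continuous_circ g r t _ (H t)).
Qed.

(** The integrand is the [t]-derivative of the primitive [G] along the circle, which is closed. *)
Lemma is_RInt_circ_derivative (G g g' : C -> C) (r : R) :
  (forall t, cderiv G (circ r t) (g (circ r t))) ->
  (forall t, cderiv g (circ r t) (g' (circ r t))) ->
  is_RInt (fun t => Re (g (circ r t) * (Ci * circ r t))) 0 (2 * PI) 0%R.
Proof.
intros HG Hg.
replace 0%R with (minus (Re (G (circ r (2 * PI)))) (Re (G (circ r 0)))) at 2.
2:{ rewrite circ_2PI. unfold minus, plus, opp; simpl. ring. }
apply (is_RInt_derive (fun t => Re (G (circ r t)))).
- intros t _. now apply is_derive_circ.
- intros t _. eapply (continuous_circ (fun z => g z * (Ci * z))).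
  apply cderiv_mult; [apply Hg|]. apply cderiv_scal, cderiv_id.
Qed.

(** [g''] is there to make [g'] continuous, as the fundamental theorem of calculus and
    differentiation under the integral sign require. *)
Definition smooth_on (D : C -> Prop) (g : C -> C) : Prop :=
  exists g' g'' : C -> C, forall z, D z -> cderiv g z (g' z) /\ cderiv g' z (g'' z).

Lemma continuity_2d_circ (h : C -> C) (r t : R) (d : C) : cderiv h (circ r t) d ->
  continuity_2d_pt (fun u v => Re (h (circ u v))) r t.
Proof.
intros H eps. destruct (cderiv_cont h _ d H eps (cond_pos eps)) as [delta [Hd Hc]].
assert (C1 : continuity_2d_pt (fun u v => (u * cos v)%R) r t).
{ apply continuity_2d_pt_mult; [apply continuity_2d_pt_id1|].
  apply continuity_1d_2d_pt_comp; [apply continuity_cos|apply continuity_2d_pt_id2]. }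
assert (C2 : continuity_2d_pt (fun u v => (u * sin v)%R) r t).
{ apply continuity_2d_pt_mult; [apply continuity_2d_pt_id1|].
  apply continuity_1d_2d_pt_comp; [apply continuity_sin|apply continuity_2d_pt_id2]. }
assert (Hd2 : (0 < delta / 2)%R) by lra.
destruct (C1 (mkposreal _ Hd2)) as [d1 H1]. destruct (C2 (mkposreal _ Hd2)) as [d2 H2].
exists (mkposreal (Rmin d1 d2) (Rmin_pos _ _ (cond_pos d1) (cond_pos d2))). simpl.
intros u v Hu Hv.
assert (A1 := H1 u v (Rlt_le_trans _ _ _ Hu (Rmin_l _ _)) (Rlt_le_trans _ _ _ Hv (Rmin_l _ _))).
assert (A2 := H2 u v (Rlt_le_trans _ _ _ Hu (Rmin_r _ _)) (Rlt_le_trans _ _ _ Hv (Rmin_r _ _))).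
simpl in A1, A2.
assert (Hm : (Cmod (circ u v - circ r t) < delta)%R).
{ eapply Rle_lt_trans; [apply Cmod_le_Re_Im|]. unfold circ; simpl. unfold Rminus in *. lra. }
specialize (Hc _ Hm).
eapply Rle_lt_trans; [|exact Hc].
replace (Re (h (circ u v)) - Re (h (circ r t)))%R with (Re (h (circ u v) - h (circ r t))%C) by (unfold Cminus; now rewrite re_plus, re_opp).
apply re_le_Cmod.
Qed.

Definition punctured (z : C) : Prop := 0 < Cmod z < 1.

Lemma punctured_circ (r t : R) : (0 < r < 1)%R -> punctured (circ r t).
Proof. intros Hr. unfold punctured. rewrite Cmod_circ; lra. Qed.

(** The radial derivative of [g] is, up to the factor [1 / (i r)], its angular derivative, whose
    integral over the full circle vanishes. *)
Lemma circle_mean_derive (g : C -> C) (r : R) : smooth_on punctured g -> (0 < r < 1)%R ->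
  is_derive (fun u => RInt (fun t => Re (g (circ u t))) 0 (2 * PI)) r 0%R.
Proof.
intros (g' & g'' & Hg) Hr.
assert (Hrad : forall u t : R, (0 < u < 1)%R ->
  is_derive (fun s => Re (g (circ s t))) u (Re (g' (circ u t) * circ u t) * / u)%R).
{ intros u t Hu.
  destruct (cderiv_curve g (fun s => s * cos t)%R (fun s => s * sin t)%R u (cos t) (sin t) _
    (proj1 (Hg _ (punctured_circ u t Hu)))) as [H1 _].
  - auto_derive; [exact I|ring].
  - auto_derive; [exact I|ring].
  - match type of H1 with is_derive _ _ ?x => replace (Re (g' (circ u t) * circ u t) * / u)%R with x end; [exact H1|].
    rewrite !re_mult. unfold circ. unfold Re at 2 4; unfold Im at 2 4; simpl. field. lra. }
assert (Hloc : forall (P : R -> Prop), (forall u, (0 < u < 1)%R -> P u) -> locally r P).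
{ intros P HP. assert (Hm : (0 < Rmin r (1 - r))%R) by (apply Rmin_pos; lra).
  exists (mkposreal _ Hm). intros u Hu. apply HP.
  change (Rabs (u - r) < Rmin r (1 - r))%R in Hu.
  pose proof (Rmin_l r (1 - r)). pose proof (Rmin_r r (1 - r)). apply Rabs_def2 in Hu. lra. }
assert (HD : forall u t : R, (0 < u < 1)%R -> Derive (fun s => Re (g (circ s t))) u = (Re (g' (circ u t) * circ u t) * / u)%R).
{ intros u t Hu. apply is_derive_unique. now apply Hrad. }
assert (V : RInt (fun t => Derive (fun u => Re (g (circ u t))) r) 0 (2 * PI) = 0%R).
{ apply is_RInt_unique.
  (* [Re (g' z * z)] is the angular derivative of [Re (- i g)]. *)
  apply (is_RInt_ext (fun t => scal (/ r)%R (Re ((- Ci * g' (circ r t)) * (Ci * circ r t))))).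
  { intros t _. rewrite HD by exact Hr.
    match goal with |- scal ?x ?y = _ => change (scal x y) with (x * y)%R end.
    replace (- Ci * g' (circ r t) * (Ci * circ r t)) with (- (Ci * Ci) * (g' (circ r t) * circ r t)) by ring.
    rewrite Ci_sqr. replace (- (-1) * (g' (circ r t) * circ r t)) with (g' (circ r t) * circ r t) by ring. apply Rmult_comm. }
  rewrite <- (Rmult_0_r (/ r)) at 2.
  apply (is_RInt_scal (V := R_NormedModule)).
  apply (is_RInt_circ_derivative (fun z => - Ci * g z) (fun z => - Ci * g' z) (fun z => - Ci * g'' z));
   intros t; apply cderiv_scal; apply (Hg _ (punctured_circ r t Hr)). }
pose proof (is_derive_RInt_param (fun u t => Re (g (circ u t))) 0 (2 * PI) r) as H.
cbv beta in H. rewrite V in H. apply H.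
- apply Hloc. intros u Hu t _. exact (ex_intro _ _ (Hrad u t Hu)).
- intros t _. apply continuity_2d_pt_ext_loc with (fun u v => (Re (g' (circ u v) * circ u v) * / u)%R).
  + assert (Hm : (0 < Rmin r (1 - r))%R) by (apply Rmin_pos; lra).
    exists (mkposreal _ Hm). simpl. intros u v Hu _. symmetry. apply HD.
    pose proof (Rmin_l r (1 - r)). pose proof (Rmin_r r (1 - r)). apply Rabs_def2 in Hu. lra.
  + apply continuity_2d_pt_mult.
    * eapply (continuity_2d_circ (fun z => g' z * z)).
      apply cderiv_mult; [apply (Hg _ (punctured_circ r t Hr))|apply cderiv_id].
    * apply continuity_2d_pt_inv; [apply continuity_2d_pt_id1|lra].
- apply Hloc. intros u Hu. apply (ex_RInt_circ g g'). intros t. apply (Hg _ (punctured_circ u t Hu)).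
Qed.

Lemma circle_mean_const (g : C -> C) (r s : R) : smooth_on punctured g -> (0 < r < 1)%R -> (0 < s < 1)%R ->
  RInt (fun t => Re (g (circ r t))) 0 (2 * PI) = RInt (fun t => Re (g (circ s t))) 0 (2 * PI).
Proof.
intros Hg Hr Hs.
destruct (MVT_gen (fun u => RInt (fun t => Re (g (circ u t))) 0 (2 * PI)) r s (fun _ => 0%R)) as [c [_ E]].
- intros x Hx. apply circle_mean_derive; [exact Hg|].
  split; [eapply Rlt_trans; [|apply Hx]; apply Rmin_glb_lt; lra|eapply Rlt_trans; [apply Hx|]; apply Rmax_lub_lt; lra].
- intros x Hx. apply continuity_pt_filterlim.
  apply (ex_derive_continuous (fun u => RInt (fun t => Re (g (circ u t))) 0 (2 * PI))). exists 0%R.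
  apply circle_mean_derive; [exact Hg|].
  split; [eapply Rlt_le_trans; [|apply Hx]; apply Rmin_glb_lt; lra|eapply Rle_lt_trans; [apply Hx|]; apply Rmax_lub_lt; lra].
- lra.
Qed.

(** The integral does not depend on the radius, and the bound [K |z|] makes it arbitrarily small on
    small circles. *)
Lemma circle_mean_zero (g : C -> C) (K delta r : R) : smooth_on punctured g -> (0 < delta)%R ->
  (forall z : C, z <> 0 -> Cmod z < delta -> Cmod (g z) <= K * Cmod z) -> (0 < r < 1)%R ->
  RInt (fun t => Re (g (circ r t))) 0 (2 * PI) = 0%R.
Proof.
intros Hg Hd HK Hr. destruct (Req_dec (RInt (fun t => Re (g (circ r t))) 0 (2 * PI)) 0) as [|Hn]; [assumption|exfalso].
set (I := RInt (fun t => Re (g (circ r t))) 0 (2 * PI)) in *.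
pose proof PI_RGT_0 as HPI.
assert (HI : (0 < Rabs I)%R) by now apply Rabs_pos_lt.
set (K' := (Rabs K + 1)%R). assert (HK' : (0 < K')%R) by (unfold K'; pose proof (Rabs_pos K); lra).
assert (Hq : (0 < Rabs I / (8 * PI * K'))%R) by (apply Rdiv_lt_0_compat; [exact HI|nra]).
(* At this radius the integral is at most [2 PI K' s <= |I| / 4]. *)
set (s := Rmin (1 / 2) (Rmin (delta / 2) (Rabs I / (8 * PI * K')))).
assert (Hs0 : (0 < s)%R) by (repeat apply Rmin_pos; lra).
assert (Hs1 : (s <= 1 / 2)%R) by apply Rmin_l.
assert (Hs2 : (s <= delta / 2)%R) by (eapply Rle_trans; [apply Rmin_r|apply Rmin_l]).
assert (Hs3 : (s <= Rabs I / (8 * PI * K'))%R) by (eapply Rle_trans; [apply Rmin_r|apply Rmin_r]).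
apply (Rle_div_r s _ (8 * PI * K')) in Hs3; [|nra].
assert (E : I = RInt (fun t => Re (g (circ s t))) 0 (2 * PI)) by (apply circle_mean_const; [exact Hg|lra|lra]).
assert (B : (Rabs I <= (2 * PI - 0) * (K' * s))%R).
{ rewrite E. apply (abs_RInt_le_const (fun t => Re (g (circ s t))) 0 (2 * PI) (K' * s)); [lra| |].
  - destruct Hg as (g' & g'' & Hg). apply (ex_RInt_circ g g'). intros t. apply Hg. apply punctured_circ. lra.
  - intros t _. eapply Rle_trans; [apply re_le_Cmod|]. eapply Rle_trans; [apply HK|].
    + apply circ_neq_0; lra.
    + rewrite Cmod_circ; lra.
    + rewrite Cmod_circ by lra. apply Rmult_le_compat_r; [lra|]. unfold K'. pose proof (Rle_abs K). lra. }
nra.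
Qed.

(** * Closure properties of twice differentiable functions *)

Lemma smooth_on_weaken (D E : C -> Prop) (g : C -> C) : (forall z, E z -> D z) -> smooth_on D g -> smooth_on E g.
Proof. intros H (g' & g'' & Hg). exists g', g''. intros z Hz. now apply Hg, H. Qed.

Lemma smooth_on_const (D : C -> Prop) (c : C) : smooth_on D (fun _ => c).
Proof. exists (fun _ => 0), (fun _ => 0). intros z _. split; apply cderiv_const. Qed.

Lemma smooth_on_id (D : C -> Prop) : smooth_on D (fun z => z).
Proof. exists (fun _ => 1), (fun _ => 0). intros z _. split; [apply cderiv_id|apply cderiv_const]. Qed.

Lemma smooth_on_plus (D : C -> Prop) (f g : C -> C) : smooth_on D f -> smooth_on D g -> smooth_on D (fun z => f z + g z).
Proof.
intros (f' & f'' & Hf) (g' & g'' & Hg). exists (fun z => f' z + g' z), (fun z => f'' z + g'' z).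
intros z Hz. split; apply cderiv_plus; first [now apply Hf|now apply Hg].
Qed.

Lemma smooth_on_mult (D : C -> Prop) (f g : C -> C) : smooth_on D f -> smooth_on D g -> smooth_on D (fun z => f z * g z).
Proof.
intros (f' & f'' & Hf) (g' & g'' & Hg). exists (fun z => f' z * g z + f z * g' z).
eexists (fun z => (f'' z * g z + f' z * g' z) + (f' z * g' z + f z * g'' z)).
intros z Hz. destruct (Hf z Hz), (Hg z Hz). split; [now apply cderiv_mult|].
apply cderiv_plus; now apply cderiv_mult.
Qed.

Lemma smooth_on_comp (D : C -> Prop) (F F' F'' g : C -> C) :
  (forall z, D z -> cderiv F (g z) (F' (g z)) /\ cderiv F' (g z) (F'' (g z))) ->
  smooth_on D g -> smooth_on D (fun z => F (g z)).
Proof.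
intros HF (g' & g'' & Hg). exists (fun z => g' z * F' (g z)).
exists (fun z => g'' z * F' (g z) + g' z * (g' z * F'' (g z))).
intros z Hz. destruct (Hg z Hz), (HF z Hz). split; [exact (cderiv_comp F g z _ _ H1 H)|].
exact (cderiv_mult _ _ _ _ _ H0 (cderiv_comp F' g z _ _ H2 H)).
Qed.

Lemma smooth_on_inv (D : C -> Prop) (g : C -> C) : (forall z, D z -> g z <> 0) -> smooth_on D g ->
  smooth_on D (fun z => / g z).
Proof.
intros H0 Hg. apply (smooth_on_comp D Cinv (fun z => - / (z * z)) (fun z => - (- (1 * z + z * 1) / ((z * z) * (z * z))))).
- intros z Hz. specialize (H0 z Hz). split; [now apply cderiv_Cinv|].
  apply cderiv_opp, (cderiv_inv (fun w => w * w)); [|now apply Cmult_neq_0].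
    exact (cderiv_mult (fun w => w) (fun w => w) (g z) 1 1 (cderiv_id _) (cderiv_id _)).
- exact Hg.
Qed.

Lemma smooth_on_pow (D : C -> Prop) (n : nat) : smooth_on D (fun z => z ^ n).
Proof.
induction n as [|n IH]; [exact (smooth_on_const D 1)|].
exact (smooth_on_mult D _ _ (smooth_on_id D) IH).
Qed.

(** * Means of powers, Parseval's identity and the coefficient bound *)

Lemma is_RInt_circ_pow (c : C) (n : nat) (r : R) : (0 < r)%R ->
  is_RInt (fun t => Re (c * circ r t ^ S n)) 0 (2 * PI) 0%R.
Proof.
intros Hr. set (k := - Ci * c).
eapply is_RInt_ext; [|apply (is_RInt_circ_derivative (fun z => (k * / INR (S n)) * z ^ S n) (fun z => k * z ^ n)
   (fun z => match n with O => 0 | S m => k * (INR (S m) * z ^ m) end) r)].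
- intros t _. apply (f_equal Re). unfold k. change (circ r t ^ S n) with (circ r t * circ r t ^ n).
  replace (- Ci * c * circ r t ^ n * (Ci * circ r t)) with (- (Ci * Ci) * (c * (circ r t * circ r t ^ n))) by ring.
  rewrite Ci_sqr. ring.
- intros t. eapply cderiv_eq; [|apply cderiv_scal, cderiv_pow].
  assert (INR (S n) <> 0 :> C) by (intros H; apply RtoC_inj in H; pose proof (lt_0_INR (S n) ltac:(lia)); lra).
  field. assumption.
- intros t. destruct n as [|m].
  + eapply cderiv_eq; [|exact (cderiv_scal k (fun z => z ^ 0) (circ r t) 0 (cderiv_const 1 _))]. ring.
  + apply cderiv_scal, cderiv_pow.
Qed.

(** On the circle [1 / z = conj z / r^2], and conjugation does not change the real part; this
    reduces to positive powers. *)
Lemma is_RInt_circ_inv_pow (c : C) (n : nat) (r : R) : (0 < r)%R ->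
  is_RInt (fun t => Re (c * (/ circ r t) ^ S n)) 0 (2 * PI) 0%R.
Proof.
intros Hr.
apply (is_RInt_ext (fun t => Re ((Cconj c * / r ^ (2 * S n)) * circ r t ^ S n))).
- intros t _.
  assert (Hz := circ_neq_0 r t Hr).
  assert (E : / circ r t = / r ^ 2 * Cconj (circ r t)).
  { pose proof (Cmod2_conj (circ r t)) as H. rewrite Cmod_circ in H by lra. rewrite RtoC_pow in H. rewrite H.
    field. split; [|exact Hz]. intros H0. apply Hz. rewrite <- (Cconj_conj (circ r t)), H0. apply C_ext; simpl; lra. }
  rewrite E.
  rewrite <- (re_conj (c * _)), Cmult_conj, Cpow_conj, Cmult_conj, Cconj_conj.
  assert (F : Cconj (/ r ^ 2) = / r ^ 2).
  { rewrite <- RtoC_pow, <- RtoC_inv by (apply pow_nonzero; lra). apply C_ext; simpl; lra. }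
  rewrite F, Cpow_mult_l. f_equal. rewrite Cpow_inv, <- Cpow_mult_r; [ring|].
  apply Cpow_nz. intros H; apply RtoC_inj in H; lra.
- now apply is_RInt_circ_pow.
Qed.

(** The cross term [u2 w^2 conj (u1 w)] collapses to [|w|^2 u2 conj u1 w]. For fixed [|w|] the
    squared modulus is thus a constant plus real parts of monomials with mean zero, which gives
    Parseval's identity. *)
Lemma Cmod2_quadratic (u0 u1 u2 w : C) :
  (Cmod (u0 + u1 * w + u2 * w ^ 2) ^ 2 =
   Re (2 * (u1 * Cconj u0 + RtoC (Cmod w ^ 2) * (u2 * Cconj u1)) * w ^ 1)%C
   + Re (2 * (u2 * Cconj u0) * w ^ 2)%C
   + (Cmod u0 ^ 2 + Cmod u1 ^ 2 * Cmod w ^ 2 + Cmod u2 ^ 2 * (Cmod w ^ 2) ^ 2))%R.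
Proof.
rewrite !Cmod2_alt.
destruct u0 as [a0 b0], u1 as [a1 b1], u2 as [a2 b2], w as [x y]. unfold Re, Im. simpl. ring.
Qed.

Lemma is_RInt_circ_norm2 (u0 u1 u2 : C) (r : R) : (0 < r)%R ->
  is_RInt (fun t => (Cmod (u0 + u1 * circ r t + u2 * circ r t ^ 2) ^ 2)%R) 0 (2 * PI)
    (2 * PI * (Cmod u0 ^ 2 + Cmod u1 ^ 2 * r ^ 2 + Cmod u2 ^ 2 * (r ^ 2) ^ 2))%R.
Proof.
intros Hr.
set (S := (Cmod u0 ^ 2 + Cmod u1 ^ 2 * r ^ 2 + Cmod u2 ^ 2 * (r ^ 2) ^ 2)%R).
set (c1 := 2 * (u1 * Cconj u0 + RtoC (r ^ 2) * (u2 * Cconj u1))). set (c2 := 2 * (u2 * Cconj u0)).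
apply (is_RInt_ext (fun t => plus (plus (Re (c1 * circ r t ^ 1)) (Re (c2 * circ r t ^ 2))) S)).
- intros t _. rewrite Cmod2_quadratic, Cmod_circ by lra. reflexivity.
- replace (2 * PI * S)%R with (plus (plus 0%R 0%R) (scal (2 * PI - 0)%R S)).
  2:{ unfold plus, scal; simpl; unfold mult; simpl. ring. }
  apply (is_RInt_plus (V := R_NormedModule)); [apply (is_RInt_plus (V := R_NormedModule))|].
  + now apply is_RInt_circ_pow.
  + now apply is_RInt_circ_pow.
  + apply (is_RInt_const (V := R_NormedModule)).
Qed.

Lemma exists_phase (z : C) : exists e : C, Cmod e = 1%R /\ e * z = Cmod z.
Proof.
destruct (Ceq_dec z 0) as [->|Hz].
- exists 1. split; [apply Cmod_1|]. rewrite Cmod_0. ring.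
- assert (Hm : (0 < Cmod z)%R) by now apply Cmod_gt_0.
  assert (Hm' : RtoC (Cmod z) <> 0) by (intros H; apply RtoC_inj in H; lra).
  exists (Cconj z / Cmod z). split.
  + rewrite Cmod_div by exact Hm'. rewrite Cmod_conj, Cmod_R, Rabs_pos_eq by lra. field. lra.
  + replace (Cconj z / Cmod z * z) with (z * Cconj z / Cmod z) by (field; exact Hm').
    rewrite <- Cmod2_conj, RtoC_pow. field. exact Hm'.
Qed.

Lemma smooth_on_quadratic (D : C -> Prop) (u0 u1 u2 : C) : smooth_on D (fun z => u0 + u1 * z + u2 * z ^ 2).
Proof.
exact (smooth_on_plus _ _ _
  (smooth_on_plus _ _ _ (smooth_on_const D u0) (smooth_on_mult _ _ _ (smooth_on_const D u1) (smooth_on_id D)))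
  (smooth_on_mult _ _ _ (smooth_on_const D u2) (smooth_on_pow D 2))).
Qed.

(** [h3] is the mean of [h / z^3]: beyond the terms in [h0], [h1], [h2], [h3] that quotient is
    [O(z)], so this rest has mean zero, as have the negative powers. *)
Lemma coeff3_bound (h : C -> C) (h0 h1 h2 h3 : C) (r : R) (b : R -> R) (m : R) :
  smooth_on Omega h -> taylor3 h h0 h1 h2 h3 -> (0 < r < 1)%R ->
  (forall t, Cmod (h (circ r t)) <= b t) -> is_RInt b 0 (2 * PI) (2 * PI * m)%R ->
  (Cmod h3 * r ^ 3 <= m)%R.
Proof.
intros Hs (K & delta & Hd & HK & Ht) Hr Hb HI.
(* Rotation by [e] turns [h3] into its modulus, so that means of real parts suffice. *)
destruct (exists_phase h3) as [e [He1 He]].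
set (p := fun z : C => h0 + h1 * z + h2 * z ^ 2 + h3 * z ^ 3) in *.
set (g := fun z => e * ((h z + (-1) * p z) * (/ z) ^ 3)).
assert (Hg : smooth_on punctured g).
{ apply smooth_on_mult; [apply smooth_on_const|]. apply smooth_on_mult.
  - apply smooth_on_plus.
    + apply (smooth_on_weaken Omega); [|exact Hs]. intros z Hz. apply Hz.
    + apply smooth_on_mult; [apply smooth_on_const|]. unfold p.
      exact (smooth_on_plus _ _ _ (smooth_on_quadratic punctured h0 h1 h2)
        (smooth_on_mult _ _ _ (smooth_on_const _ h3) (smooth_on_pow _ 3))).
  - apply (smooth_on_comp punctured (fun z => z ^ 3) (fun z => INR 3 * z ^ 2) (fun z => INR 3 * (INR 2 * z ^ 1))).
    + intros z _. split; [apply cderiv_pow|apply cderiv_scal, cderiv_pow].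
    + apply smooth_on_inv; [|apply smooth_on_id]. intros z Hz. apply Cmod_gt_0, Hz. }
assert (HgK : forall z : C, z <> 0 -> Cmod z < delta -> Cmod (g z) <= K * Cmod z).
{ intros z Hz Hzd. specialize (Ht z Hzd).
  unfold g. rewrite !Cmod_mult, He1, Cmod_pow, Cmod_inv by exact Hz.
  replace (h z + (-1) * p z) with (h z - p z) by ring.
  assert (Hm : (0 < Cmod z)%R) by now apply Cmod_gt_0.
  replace (K * Cmod z)%R with (1 * ((K * Cmod z ^ 4) * (/ Cmod z) ^ 3))%R by (field; lra).
  apply Rmult_le_compat_l; [lra|]. apply Rmult_le_compat_r; [|exact Ht].
  apply pow_le, Rlt_le, Rinv_0_lt_compat, Hm. }
assert (Ig : is_RInt (fun t => Re (g (circ r t))) 0 (2 * PI) 0%R).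
{ pose proof (circle_mean_zero g K delta r Hg Hd HgK Hr) as Z.
  destruct Hg as (g' & g'' & Hg).
  pose proof (RInt_correct (V := R_CompleteNormedModule) _ _ _
    (ex_RInt_circ g g' r (fun t => proj1 (Hg _ (punctured_circ r t Hr))))) as Y.
  rewrite Z in Y. exact Y. }
pose proof (is_RInt_circ_inv_pow (e * h0) 2 r ltac:(lra)) as I0.
pose proof (is_RInt_circ_inv_pow (e * h1) 1 r ltac:(lra)) as I1.
pose proof (is_RInt_circ_inv_pow (e * h2) 0 r ltac:(lra)) as I2.
pose proof (is_RInt_const (V := R_NormedModule) 0 (2 * PI) (Cmod h3)) as I3.
pose proof (is_RInt_plus (V := R_NormedModule) _ _ _ _ _ _ Ig
  (is_RInt_plus (V := R_NormedModule) _ _ _ _ _ _ I0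
  (is_RInt_plus (V := R_NormedModule) _ _ _ _ _ _ I1
  (is_RInt_plus (V := R_NormedModule) _ _ _ _ _ _ I2 I3)))) as IS.
pose proof (is_RInt_scal (V := R_NormedModule) _ _ _ (/ r ^ 3)%R _ HI) as Ib.
pose proof PI_RGT_0 as HPI.
assert (Hr3 : (0 < r ^ 3)%R) by (apply pow_lt; lra).
pose proof (is_RInt_le _ _ 0 (2 * PI) _ _ ltac:(lra) IS Ib) as L.
assert (L' : (2 * PI * Cmod h3 <= / r ^ 3 * (2 * PI * m))%R).
{ match type of L with ?A -> (?x <= ?y)%R => replace (2 * PI * Cmod h3)%R with x; [apply L|] end.
  - clear L. intros t _.
    assert (Hz : circ r t <> 0) by (apply circ_neq_0; lra).
    change ((Re (g (circ r t)) + (Re (e * h0 * (/ circ r t) ^ 3)%C + (Re (e * h1 * (/ circ r t) ^ 2)%C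
      + (Re (e * h2 * (/ circ r t) ^ 1)%C + Cmod h3))) <= / r ^ 3 * b t)%R).
    replace (Cmod h3) with (Re (e * h3)) by now rewrite He.
    rewrite <- !re_plus.
    match goal with |- (Re ?x <= _)%R => replace x with (e * (h (circ r t) * (/ circ r t) ^ 3)) end.
    2:{ unfold g, p. field. exact Hz. }
    eapply Rle_trans; [eapply Rle_trans; [apply Rle_abs|apply re_le_Cmod]|].
    rewrite !Cmod_mult, He1, Cmod_pow, Cmod_inv, Cmod_circ by (try exact Hz; lra).
    rewrite pow_inv, Rmult_1_l, Rmult_comm. apply Rmult_le_compat_l; [|apply Hb].
    now apply Rlt_le, Rinv_0_lt_compat.
  - unfold plus, scal; simpl; unfold mult; simpl. ring. }
apply (Rmult_le_reg_l (2 * PI * / r ^ 3)%R).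
{ apply Rmult_lt_0_compat; [lra|now apply Rinv_0_lt_compat]. }
replace (2 * PI * / r ^ 3 * (Cmod h3 * r ^ 3))%R with (2 * PI * Cmod h3)%R by (field; lra).
lra.
Qed.

Lemma taylor3_quadratic (u0 u1 u2 : C) : taylor3 (fun z => u0 + u1 * z + u2 * z ^ 2) u0 u1 u2 0.
Proof.
apply (bigO_ext 4 (fun z => z ^ 4 * 0)); [intros; simpl; ring|]. apply bigO_pow_mult, bigO_const.
Qed.

Lemma le_of_pow_scaled (S M : R) (n : nat) : (0 <= M)%R ->
  (forall r : R, 0 < r < 1 -> S * r ^ n <= M)%R -> (S <= M)%R.
Proof.
intros HM H. apply Rnot_lt_le. intros Hlt.
assert (HB : forall m (d : R), (0 < d < 1)%R -> (1 - INR m * d <= (1 - d) ^ m)%R).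
{ intros m d Hd. induction m as [|m IH]; [simpl; lra|]. rewrite S_INR. simpl.
  pose proof (pos_INR m).
  apply Rle_trans with ((1 - d) * (1 - INR m * d))%R; [nra|]. apply Rmult_le_compat_l; lra. }
pose proof (pos_INR n) as Hn.
(* For [r = 1 - d], Bernoulli gives [S r^n >= S - n d S], and [n d S] is less than [S - M]. *)
set (d := ((S - M) / (2 * (INR n + 1) * S))%R).
assert (Hden : (0 < 2 * (INR n + 1) * S)%R) by (apply Rmult_lt_0_compat; lra).
assert (E : (d * (2 * (INR n + 1) * S) = S - M)%R) by (unfold d; field; lra).
assert (Hd : (0 < d < 1)%R).
{ split; [unfold d; apply Rdiv_lt_0_compat; lra|]. apply (Rlt_div_l (S - M) 1 _ Hden). nra. }
specialize (H (1 - d)%R ltac:(lra)). specialize (HB n d Hd).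
apply (Rmult_le_compat_l S) in HB; [|lra].
assert (0 < d * S)%R by (apply Rmult_lt_0_compat; lra). nra.
Qed.

(** The form on the left is the [z^3] coefficient of [w U V]. On circles
    [|w U V| <= (|U|^2 + |V|^2) / 2], whose mean Parseval evaluates; then [r] tends to 1. *)
Lemma toeplitz_bilinear (w : C -> C) (c1 c2 c3 u0 u1 u2 v0 v1 v2 : C) :
  smooth_on Omega w -> (forall z, Omega z -> Cmod (w z) <= 1) -> taylor3 w 0 c1 c2 c3 ->
  (Cmod (c1 * (u0 * v2 + u1 * v1 + u2 * v0) + c2 * (u0 * v1 + u1 * v0) + c3 * (u0 * v0)) <=
   (Cmod u0 ^ 2 + Cmod u1 ^ 2 + Cmod u2 ^ 2 + (Cmod v0 ^ 2 + Cmod v1 ^ 2 + Cmod v2 ^ 2)) / 2)%R.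
Proof.
intros Hs Hw Ht.
set (U := fun z : C => u0 + u1 * z + u2 * z ^ 2). set (V := fun z : C => v0 + v1 * z + v2 * z ^ 2).
pose proof (taylor3_mult _ _ _ _ _ _ _ _ _ _ Ht (taylor3_mult _ _ _ _ _ _ _ _ _ _
   (taylor3_quadratic u0 u1 u2) (taylor3_quadratic v0 v1 v2))) as HT. cbv beta in HT.
fold U V in HT.
assert (HS : smooth_on Omega (fun z => w z * (U z * V z))).
{ apply smooth_on_mult; [exact Hs|]. apply smooth_on_mult; apply smooth_on_quadratic. }
set (X := c1 * (u0 * v2 + u1 * v1 + u2 * v0) + c2 * (u0 * v1 + u1 * v0) + c3 * (u0 * v0)).
set (M := ((Cmod u0 ^ 2 + Cmod u1 ^ 2 + Cmod u2 ^ 2 + (Cmod v0 ^ 2 + Cmod v1 ^ 2 + Cmod v2 ^ 2)) / 2)%R).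
assert (HM : (0 <= M)%R).
{ unfold M. pose proof (pow2_ge_0 (Cmod u0)); pose proof (pow2_ge_0 (Cmod u1)); pose proof (pow2_ge_0 (Cmod u2));
  pose proof (pow2_ge_0 (Cmod v0)); pose proof (pow2_ge_0 (Cmod v1)); pose proof (pow2_ge_0 (Cmod v2)); lra. }
assert (B : forall r : R, (0 < r < 1)%R -> (Cmod X * r ^ 3 <= M)%R).
{ intros r Hr.
  pose proof (is_RInt_scal (V := R_NormedModule) _ _ _ (/ 2)%R _ (is_RInt_plus (V := R_NormedModule) _ _ _ _ _ _
    (is_RInt_circ_norm2 u0 u1 u2 r ltac:(lra)) (is_RInt_circ_norm2 v0 v1 v2 r ltac:(lra)))) as HI.
  set (M' := ((Cmod u0 ^ 2 + Cmod u1 ^ 2 * r ^ 2 + Cmod u2 ^ 2 * (r ^ 2) ^ 2 +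
     (Cmod v0 ^ 2 + Cmod v1 ^ 2 * r ^ 2 + Cmod v2 ^ 2 * (r ^ 2) ^ 2)) / 2)%R).
  apply Rle_trans with M'.
  - replace X with (0 * (u0 * 0 + u1 * v2 + u2 * v1 + 0 * v0) + c1 * (u0 * v2 + u1 * v1 + u2 * v0) + c2 * (u0 * v1 + u1 * v0) + c3 * (u0 * v0)) by (unfold X; ring).
    eapply coeff3_bound; [exact HS|exact HT|exact Hr| |].
    2:{ match type of HI with is_RInt _ _ _ ?y => replace (2 * PI * M')%R with y end; [exact HI|].
        unfold M', plus, scal; simpl; unfold mult; simpl. field. }
    intros t. cbv beta. fold (U (circ r t)) (V (circ r t)).
    match goal with |- _ <= ?y => change y with (/ 2 * (Cmod (U (circ r t)) ^ 2 + Cmod (V (circ r t)) ^ 2))%R end.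
    rewrite !Cmod_mult.
    assert (H1 : (Cmod (w (circ r t)) <= 1)%R) by (apply Hw; unfold Omega; rewrite Cmod_circ; lra).
    pose proof (Cmod_ge_0 (w (circ r t))). pose proof (Cmod_ge_0 (U (circ r t))). pose proof (Cmod_ge_0 (V (circ r t))).
    set (x := Cmod (U (circ r t))) in *. set (y := Cmod (V (circ r t))) in *. set (k := Cmod (w (circ r t))) in *.
    assert (0 <= x * y)%R by now apply Rmult_le_pos.
    assert (0 <= (x - y) ^ 2)%R by apply pow2_ge_0. nra.
  - unfold M', M.
    assert (H2 : (0 <= r ^ 2 <= 1)%R) by (simpl; nra).
    assert (H4 : (0 <= (r ^ 2) ^ 2 <= 1)%R).
    { generalize dependent (r ^ 2)%R. intros s _ Hs'. simpl. nra. }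
    assert (Q : forall x s : R, (0 <= s <= 1)%R -> (x ^ 2 * s <= x ^ 2)%R).
    { intros x s Hs'. pose proof (pow2_ge_0 x) as Hx. rewrite <- (Rmult_1_r (x ^ 2)) at 2. apply Rmult_le_compat_l; lra. }
    pose proof (Q (Cmod u1) _ H2); pose proof (Q (Cmod u2) _ H4);
    pose proof (Q (Cmod v1) _ H2); pose proof (Q (Cmod v2) _ H4). lra. }
exact (le_of_pow_scaled (Cmod X) M 3 HM B).
Qed.

(** * Coefficients of Schwarz functions *)

Lemma Cmult_conj_r (z : C) : z * Cconj z = RtoC (Cmod z ^ 2).
Proof. rewrite <- Cmod2_conj. reflexivity. Qed.

(** With [T] the Toeplitz matrix, taking for [v] the conjugate of [T u] in reverse order turns the
    form into [|T u|^2]. Hence [|T u|^2 <= (|u|^2 + |T u|^2) / 2]. *)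
Lemma toeplitz_contraction (c1 c2 c3 : C) :
  (forall u0 u1 u2 v0 v1 v2 : C,
    Cmod (c1 * (u0 * v2 + u1 * v1 + u2 * v0) + c2 * (u0 * v1 + u1 * v0) + c3 * (u0 * v0))%C <=
    (Cmod u0 ^ 2 + Cmod u1 ^ 2 + Cmod u2 ^ 2 + (Cmod v0 ^ 2 + Cmod v1 ^ 2 + Cmod v2 ^ 2)) / 2) ->
  forall u0 u1 u2 : C,
    (Cmod (c1 * u0) ^ 2 + Cmod (c2 * u0 + c1 * u1) ^ 2 + Cmod (c3 * u0 + c2 * u1 + c1 * u2) ^ 2 <=
     Cmod u0 ^ 2 + Cmod u1 ^ 2 + Cmod u2 ^ 2)%R.
Proof.
intros H u0 u1 u2.
set (t0 := c1 * u0). set (t1 := c2 * u0 + c1 * u1). set (t2 := c3 * u0 + c2 * u1 + c1 * u2).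
specialize (H u0 u1 u2 (Cconj t2) (Cconj t1) (Cconj t0)).
match type of H with Cmod ?x <= _ => replace x with (t0 * Cconj t0 + t1 * Cconj t1 + t2 * Cconj t2) in H
  by (unfold t0, t1, t2; ring) end.
rewrite !Cmult_conj_r, <- !RtoC_plus, Cmod_R in H. rewrite !Cmod_conj in H.
match type of H with Rabs ?x <= _ => pose proof (Rle_abs x) end. lra.
Qed.

(** The identity behind the Schwarz-Pick lemma. Applied to the entries of [T u] and [u], it carries
    the contraction property over to the Moebius transform of [T]. *)
Lemma moebius_defect (c a b : C) :
  (Cmod (b - Cconj c * a) ^ 2 - Cmod (a - c * b) ^ 2 = (1 - Cmod c ^ 2) * (Cmod b ^ 2 - Cmod a ^ 2))%R.
Proof.
rewrite !Cmod2_alt. destruct a, b, c; unfold Re, Im; simpl. ring.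
Qed.

(* With [T] the Toeplitz matrix, [|(T - c1) u| <= |(1 - conj c1 T) u|]; the
   vector [u] is chosen so that the last entry on the right vanishes. *)
Lemma schwarz_coefficients (c1 c2 c3 : C) :
  (forall u0 u1 u2 : C,
    (Cmod (c1 * u0) ^ 2 + Cmod (c2 * u0 + c1 * u1) ^ 2 + Cmod (c3 * u0 + c2 * u1 + c1 * u2) ^ 2 <=
     Cmod u0 ^ 2 + Cmod u1 ^ 2 + Cmod u2 ^ 2)%R) ->
  let q := (1 - Cmod c1 ^ 2)%R in
  (q = 0%R /\ c2 = 0 /\ c3 = 0) \/
  (0 < q /\ Cmod (q * c3 + Cconj c1 * c2 ^ 2)%C <= q ^ 2 - Cmod c2 ^ 2).
Proof.
intros H q.
(* Yields [|c1|^2 + |c2|^2 + |c3|^2 <= 1], which settles the case [q = 0]. *)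
pose proof (H 1 0 0) as H1. rewrite !Cmult_1_r, !Cmult_0_r, !Cplus_0_r, Cmod_0, Cmod_1 in H1.
pose proof (Cmod_ge_0 c2) as P2. pose proof (Cmod_ge_0 c3) as P3.
assert (Hq0 : (0 <= q)%R) by (unfold q; simpl in *; nra).
destruct (Req_dec q 0) as [Hq|Hq].
- left. unfold q in Hq. split; [exact Hq|].
  split; apply Cmod_eq_0; simpl in *; nra.
- right. assert (Hqp : (0 < q)%R) by lra. split; [exact Hqp|].
  assert (Hqc : RtoC q <> 0) by (intros E; apply RtoC_inj in E; lra).
  set (D := q * c3 + Cconj c1 * c2 ^ 2).
  destruct (exists_phase D) as [e [He1 HeD]].
  assert (Hee : Cconj e * e = 1).
  { rewrite Cmult_comm, Cmult_conj_r, He1. f_equal. ring. }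
  (* With this [u], the entries of [(1 - conj c1 T) u] are [q^2], [q t], [0], and those of
     [(T - c1) u] are [0], [q c2], [conj e (|D| + |c2|^2)]; the phase [e] aligns the two summands of
     the last one. As [|t| = |c2|], the middle entries cancel and [|D| + |c2|^2 <= q^2] remains. *)
  set (t := Cconj e * Cconj c2).
  set (u0 := RtoC q). set (u1 := Cconj c1 * c2 + t).
  set (u2 := Cconj c1 * (c3 * u0 + c2 * u1) / q).
  specialize (H u0 u1 u2).
  set (t0 := c1 * u0) in H. set (t1 := c2 * u0 + c1 * u1) in H. set (t2 := c3 * u0 + c2 * u1 + c1 * u2) in H.
  pose proof (moebius_defect c1 t0 u0) as M0. pose proof (moebius_defect c1 t1 u1) as M1.
  pose proof (moebius_defect c1 t2 u2) as M2. fold q in M0, M1, M2.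
  assert (Q : Cconj c1 * c1 = 1 - RtoC q).
  { rewrite Cmult_comm, Cmult_conj_r. unfold q. rewrite RtoC_minus. ring. }
  assert (Q1 : c1 * Cconj c1 = 1 - RtoC q) by (rewrite <- Q; ring).
  assert (A0 : t0 - c1 * u0 = 0) by (unfold t0; ring).
  assert (A1 : t1 - c1 * u1 = q * c2) by (unfold t1, u0; ring).
  assert (A2 : t2 - c1 * u2 = Cconj e * (Cmod D + Cmod c2 ^ 2)).
  { rewrite <- RtoC_pow. transitivity (c3 * u0 + c2 * u1); [unfold t2; ring|].
    unfold u0, u1. transitivity (D + c2 * t); [unfold D; ring|].
    unfold t. rewrite <- HeD, <- Cmult_conj_r.
    transitivity ((Cconj e * e) * D + Cconj e * (c2 * Cconj c2)); [rewrite Hee|]; ring. }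
  assert (B0 : u0 - Cconj c1 * t0 = q * q).
  { unfold t0, u0. transitivity (q - (Cconj c1 * c1) * q); [ring|]. rewrite Q. ring. }
  assert (B1 : u1 - Cconj c1 * t1 = q * t).
  { unfold t1. transitivity (u1 - Cconj c1 * c2 * u0 - (Cconj c1 * c1) * u1); [ring|].
    rewrite Q. unfold u0, u1. ring. }
  assert (B2 : u2 - Cconj c1 * t2 = 0).
  { unfold t2. transitivity (u2 - Cconj c1 * (c3 * u0 + c2 * u1) - (Cconj c1 * c1) * u2); [ring|].
    rewrite Q. unfold u2. field. exact Hqc. }
  rewrite A0, B0, Cmod_0, Cmod_mult, Cmod_R, Rabs_pos_eq in M0 by lra.
  rewrite A1, B1, !Cmod_mult, Cmod_R, Rabs_pos_eq in M1 by lra.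
  assert (Ht : Cmod t = Cmod c2).
  { unfold t. rewrite Cmod_mult, !Cmod_conj, He1. ring. }
  rewrite Ht in M1.
  rewrite A2, B2, Cmod_0, Cmod_mult, Cmod_conj, He1 in M2.
  rewrite <- RtoC_pow, <- RtoC_plus, Cmod_R in M2.
  pose proof (Cmod_ge_0 D) as PD. pose proof (pow2_ge_0 (Cmod c2)) as Pc.
  rewrite Rabs_pos_eq in M2 by lra.
  fold t0 t1 t2 in H.
  set (x := (Cmod D + Cmod c2 ^ 2)%R) in *.
  assert (Hx : (x ^ 2 <= (q ^ 2) ^ 2)%R).
  { assert (S : (0 <= q * ((Cmod u0 ^ 2 - Cmod t0 ^ 2) + (Cmod u1 ^ 2 - Cmod t1 ^ 2) + (Cmod u2 ^ 2 - Cmod t2 ^ 2)))%R).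
    { apply Rmult_le_pos; lra. }
    rewrite !Rmult_plus_distr_l in S. rewrite <- M0, <- M1, <- M2 in S. simpl in S. simpl. lra. }
  assert (Hx2 : (x <= q ^ 2)%R).
  { apply Rnot_lt_le. intros Hl.
    assert (0 <= q ^ 2)%R by apply pow2_ge_0. nra. }
  unfold x in Hx2. lra.
Qed.

Lemma hankel_schwarz_bound (b : R) (c1 c2 c3 : C) : (0 <= b <= 1)%R ->
  let q := (1 - Cmod c1 ^ 2)%R in
  (q = 0%R /\ c2 = 0 /\ c3 = 0) \/
  (0 < q /\ Cmod (q * c3 + Cconj c1 * c2 ^ 2)%C <= q ^ 2 - Cmod c2 ^ 2) ->
  Cmod (3 / 2 * c1 * c3 + b / 4 * (c1 ^ 2 * c2) + (1 / 4 - b ^ 2 / 16) * c1 ^ 4 - c2 ^ 2)%C <= 1.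
Proof.
intros Hb q H.
set (K := (1 / 4 - b ^ 2 / 16)%R).
assert (HK : (0 <= K <= 1 / 4)%R) by (unfold K; simpl; nra).
assert (EK : 1 / 4 - b ^ 2 / 16 = RtoC K).
{ unfold K. rewrite RtoC_minus, !RtoC_div, RtoC_pow; try lra. reflexivity. }
assert (Eb : b / 4 = RtoC (b / 4)) by (rewrite RtoC_div; [reflexivity|lra]).
rewrite EK, Eb. clear EK Eb. clearbody K.
pose proof (Cmod_ge_0 c1) as P1. pose proof (Cmod_ge_0 c2) as P2.
destruct H as [(Hq & -> & ->)|[Hq HD]].
- match goal with |- Cmod ?x <= 1 => replace x with (RtoC K * c1 ^ 4) by ring end.
  rewrite Cmod_mult, Cmod_pow, Cmod_R, Rabs_pos_eq by lra.
  assert (E1 : (Cmod c1 ^ 2 = 1)%R) by (unfold q in Hq; lra).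
  replace (Cmod c1 ^ 4)%R with (Cmod c1 ^ 2 * Cmod c1 ^ 2)%R by ring. rewrite E1. lra.
- set (D := q * c3 + Cconj c1 * c2 ^ 2) in *.
  set (p := (Cmod c1 ^ 2)%R) in *. set (c := Cmod c1) in *. set (m := Cmod c2) in *.
  assert (Hp : (p = c * c)%R) by (unfold p; ring).
  assert (Hc : (c < 1)%R) by (unfold q in Hq; nra).
  match goal with |- Cmod ?x <= 1 => set (E := x) end.
  (* Multiplication by [q] allows [q c3 = D - conj c1 c2^2] to be inserted. *)
  assert (HE : RtoC q * E = RtoC (3 / 2) * (c1 * D) + - (RtoC (3 / 2 * p + q) * c2 ^ 2)
     + (RtoC (q * (b / 4)) * (c1 ^ 2 * c2) + RtoC (q * K) * c1 ^ 4)).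
  { unfold E, D. rewrite RtoC_plus, !RtoC_mult.
    replace (RtoC p) with (c1 * Cconj c1) by (rewrite Cmult_conj_r; reflexivity).
    rewrite !RtoC_div by lra. field. }
  assert (B : (q * Cmod E <= 3 / 2 * (c * Cmod D) + (3 / 2 * p + q) * m ^ 2 + (q * (b / 4) * (p * m) + q * K * (p * p)))%R).
  { replace (q * Cmod E)%R with (Cmod (q * E)) by (rewrite Cmod_mult, Cmod_R, Rabs_pos_eq; lra).
    rewrite HE.
    assert (N : forall (x : R) (y : C), (0 <= x)%R -> Cmod (RtoC x * y) = (x * Cmod y)%R).
    { intros x y Hx. rewrite Cmod_mult, Cmod_R, Rabs_pos_eq; lra. }
    assert (Hp0 : (0 <= p)%R) by (unfold p; apply pow2_ge_0).
    eapply Rle_trans; [apply Cmod_triangle|]. apply Rplus_le_compat.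
    - eapply Rle_trans; [apply Cmod_triangle|]. right.
      rewrite Cmod_opp, !N, Cmod_mult, Cmod_pow by lra. reflexivity.
    - eapply Rle_trans; [apply Cmod_triangle|]. right.
      rewrite !N, Cmod_mult, !Cmod_pow by (apply Rmult_le_pos; lra).
      fold c m. unfold p. fold c. ring. }
  assert (Hm : (m <= q)%R).
  { pose proof (Cmod_ge_0 D). assert (m ^ 2 <= q ^ 2)%R by lra. simpl in *. nra. }
  assert (B1 : (3 / 2 * (c * Cmod D) <= 3 / 2 * c * (q ^ 2 - m ^ 2))%R).
  { rewrite <- Rmult_assoc. apply Rmult_le_compat_l; [lra|exact HD]. }
  (* The coefficient of [m^2] once [|D|] is replaced by [q^2 - m^2]. It equals
     [(1 - c) (2 - c) / 2], so the bound is largest at [m = q]. *)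
  assert (W : (0 <= 3 / 2 * p + q - 3 / 2 * c)%R).
  { unfold q. rewrite Hp. replace (_ - _)%R with ((1 - c) * (2 - c) / 2)%R by field. nra. }
  assert (M2 : (m ^ 2 <= q ^ 2)%R) by (apply pow_incr; lra).
  assert (Hp0 : (0 <= p)%R) by (unfold p; apply pow2_ge_0).
  assert (B2 : ((3 / 2 * p + q - 3 / 2 * c) * m ^ 2 <= (3 / 2 * p + q - 3 / 2 * c) * q ^ 2)%R) by (now apply Rmult_le_compat_l).
  assert (B3 : (q * (b / 4) * (p * m) <= q * (1 / 4) * (p * q))%R).
  { apply Rmult_le_compat; try (apply Rmult_le_pos; lra).
    - apply Rmult_le_compat_l; lra.
    - now apply Rmult_le_compat_l. }
  assert (B4 : (q * K * (p * p) <= q * (1 / 4) * (p * p))%R).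
  { apply Rmult_le_compat_r; [nra|]. apply Rmult_le_compat_l; lra. }
  apply (Rmult_le_reg_l q); [exact Hq|]. rewrite Rmult_1_r.
  assert (B5 : (q * Cmod E <= q * ((3 / 2 * p + q) * q + (1 / 4) * p * q + 1 / 4 * p * p))%R).
  { eapply Rle_trans; [exact B|]. simpl in *. lra. }
  eapply Rle_trans; [exact B5|].
  rewrite <- (Rmult_1_r q) at 5. apply Rmult_le_compat_l; [lra|].
  (* The remaining expression is [1 - p / 4 - p^2 / 2]. *)
  assert (Eq : (q = 1 - p)%R) by reflexivity. rewrite Eq. nra.
Qed.

(** * Functions whose logarithmic derivative is subordinate *)

Lemma cderiv_C_derive (f : C -> C) (z d : C) : cderiv f z d -> C_derive f z = d.
Proof. intros H. apply is_C_derive_unique. exact H. Qed.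

(** The supremum [m] of the initial segments on which [P] holds satisfies [P] by the closedness
    hypothesis, and equals 1 by the openness hypothesis. *)
Lemma interval_induction (P : R -> Prop) :
  P 0%R ->
  (forall t : R, 0 <= t < 1 -> P t -> exists d : R, 0 < d /\ forall s, t < s < t + d -> s <= 1 -> P s) ->
  (forall t : R, 0 < t <= 1 -> (forall s, 0 <= s < t -> P s) -> P t) ->
  forall t : R, 0 <= t <= 1 -> P t.
Proof.
intros H0 Hopen Hclosed.
set (A := fun t : R => (0 <= t <= 1)%R /\ forall s, (0 <= s <= t)%R -> P s).
assert (A0 : A 0%R).
{ split; [lra|]. intros s Hs. replace s with 0%R by lra. exact H0. }
destruct (completeness A) as [m [Hm1 Hm2]].
- exists 1%R. intros x [Hx _]. lra.
- now exists 0%R.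
- assert (Hm0 : (0 <= m)%R) by (now apply Hm1).
  assert (Hm1' : (m <= 1)%R) by (apply Hm2; intros x [Hx _]; lra).
  assert (Hlt : forall s, (0 <= s < m)%R -> P s).
  { intros s Hs. destruct (Classical_Prop.classic (P s)) as [|Hn]; [assumption|exfalso].
    assert (m <= s)%R; [|lra]. apply Hm2. intros x [Hx1 Hx2]. apply Rnot_lt_le. intros Hsx.
    apply Hn, Hx2. lra. }
  assert (Pm : P m).
  { destruct (Req_dec m 0) as [->|Hne]; [exact H0|]. apply Hclosed; [lra|exact Hlt]. }
  assert (Hm : m = 1%R).
  { destruct (Req_dec m 1) as [|Hne]; [assumption|exfalso].
    destruct (Hopen m ltac:(lra) Pm) as [d [Hd HP]].
    set (x := Rmin (m + d / 2) 1).
    assert (Hx1 : (x <= m + d / 2)%R) by apply Rmin_l. assert (Hx2 : (x <= 1)%R) by apply Rmin_r.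
    assert (Hx3 : (m < x)%R) by (apply Rmin_glb_lt; lra).
    assert (Ax : A x).
    { split; [lra|]. intros s Hs. destruct (Rlt_le_dec s m) as [|Hms]; [apply Hlt; lra|].
      destruct (Req_dec s m) as [->|]; [exact Pm|]. apply HP; lra. }
    apply Hm1 in Ax. lra. }
  intros t Ht. destruct (Req_dec t m) as [->|]; [exact Pm|]. apply Hlt. lra.
Qed.

(* Gronwall: [s^16 (X^2 + Y^2)] is nondecreasing on [t0/2, t0]. *)
Lemma norm_stays_positive (X Y X' Y' : R -> R) (t0 : R) : (0 < t0)%R ->
  (forall s, t0 / 2 <= s <= t0 -> is_derive X s (X' s) /\ is_derive Y s (Y' s)) ->
  (forall s, t0 / 2 <= s < t0 -> - (8 * (X s * X s + Y s * Y s)) <= s * (X s * X' s + Y s * Y' s))%R ->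
  (0 < X (t0 / 2)%R * X (t0 / 2)%R + Y (t0 / 2)%R * Y (t0 / 2)%R)%R ->
  ~ (X t0 = 0%R /\ Y t0 = 0%R).
Proof.
intros Ht HD HB Hpos [HX HY].
(* The exponent is twice the constant 8 of the inequality: the derivative becomes [2 s^15] times a
   nonnegative quantity. *)
set (psi := fun s : R => (s ^ 16 * (X s * X s + Y s * Y s))%R).
set (psi' := fun s : R => (2 * s ^ 15 * (8 * (X s * X s + Y s * Y s) + s * (X s * X' s + Y s * Y' s)))%R).
assert (HDpsi : forall s, (t0 / 2 <= s <= t0)%R -> is_derive psi s (psi' s)).
{ intros s Hs. destruct (HD s Hs) as [DX DY]. unfold psi, psi'. auto_derive.
  - repeat split; first [exact (ex_intro _ _ DX)|exact (ex_intro _ _ DY)].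
  - replace (Derive (fun x => X x) s) with (X' s) by (symmetry; now apply is_derive_unique).
    replace (Derive (fun x => Y x) s) with (Y' s) by (symmetry; now apply is_derive_unique).
    simpl. ring. }
destruct (MVT_gen psi (t0 / 2) t0 psi') as [c [Hc E]].
- intros s Hs. rewrite Rmin_left, Rmax_right in Hs by lra. apply HDpsi; lra.
- intros s Hs. rewrite Rmin_left, Rmax_right in Hs by lra.
  apply continuity_pt_filterlim. apply (ex_derive_continuous psi). exists (psi' s). apply HDpsi; lra.
- rewrite Rmin_left, Rmax_right in Hc by lra.
  assert (Hc0 : (0 <= psi' c)%R).
  { unfold psi'. apply Rmult_le_pos; [apply Rmult_le_pos; [lra|apply pow_le; lra]|].
    (* The inequality is assumed only before [t0]; at [t0] itself [psi'] vanishes together with [X]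
       and [Y]. *)
    destruct (Req_dec c t0) as [->|Hn].
    - rewrite HX, HY. lra.
    - specialize (HB c ltac:(lra)). lra. }
  assert (Hp1 : (0 < psi (t0 / 2))%R).
  { unfold psi. apply Rmult_lt_0_compat; [apply pow_lt; lra|exact Hpos]. }
  assert (Hp2 : psi t0 = 0%R) by (unfold psi; rewrite HX, HY; ring).
  assert (0 <= psi' c * (t0 - t0 / 2))%R by (apply Rmult_le_pos; lra). lra.
Qed.

Lemma Cmod_pos_components (z : C) : z <> 0 -> (0 < Re z * Re z + Im z * Im z)%R.
Proof. intros H. rewrite <- Cmod_sqr. apply Cmod_gt_0 in H. nra. Qed.

Lemma cderiv_Cexp_Ci (v : C) :
  cderiv (fun w => Cexp (Ci * w)) v (Ci * 1 * Cexp (Ci * v)) /\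
  cderiv (fun w => Cexp (- (Ci * w))) v (- (Ci * 1) * Cexp (- (Ci * v))).
Proof.
pose proof (cderiv_scal Ci (fun w => w) v 1 (cderiv_id v)) as H. split.
- exact (cderiv_comp Cexp (fun w => Ci * w) v _ _ (cderiv_Cexp _) H).
- exact (cderiv_comp Cexp (fun w => - (Ci * w)) v _ _ (cderiv_Cexp _) (cderiv_opp _ v _ H)).
Qed.

Lemma cderiv_Csin (v : C) : cderiv Csin v ((Cexp (Ci * v) + Cexp (- (Ci * v))) / 2).
Proof.
unfold Csin.
destruct (cderiv_Cexp_Ci v) as [H1 H2].
apply (cderiv_ext (fun w => / (2 * Ci) * (Cexp (Ci * w) - Cexp (- (Ci * w))))).
{ intros w. unfold Cdiv. ring. }
eapply cderiv_eq; [|exact (cderiv_scal (/ (2 * Ci)) _ v _ (cderiv_minus _ _ v _ _ H1 H2))].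
field. apply Ci_neq_0.
Qed.

Lemma cderiv_Ccos (v : C) : cderiv (fun w => (Cexp (Ci * w) + Cexp (- (Ci * w))) / 2) v (- Csin v).
Proof.
destruct (cderiv_Cexp_Ci v) as [H1 H2].
apply (cderiv_ext (fun w => / 2 * (Cexp (Ci * w) + Cexp (- (Ci * w))))).
{ intros w. unfold Cdiv. ring. }
eapply cderiv_eq; [|exact (cderiv_scal (/ 2) _ v _ (cderiv_plus _ _ v _ _ H1 H2))].
unfold Csin.
replace (- ((Cexp (Ci * v) - Cexp (- (Ci * v))) / (2 * Ci))) with
  ((Ci * Ci) * ((Cexp (Ci * v) - Cexp (- (Ci * v))) / (2 * Ci))) by (rewrite Ci_sqr; ring).
field. apply Ci_neq_0.
Qed.

Lemma smooth_on_Csin (D : C -> Prop) (g : C -> C) : smooth_on D g -> smooth_on D (fun z => Csin (g z)).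
Proof.
apply (smooth_on_comp D Csin (fun v => (Cexp (Ci * v) + Cexp (- (Ci * v))) / 2) (fun v => - Csin v)). intros z _.
split; [apply cderiv_Csin|apply cderiv_Ccos].
Qed.

Lemma smooth_on_psum (a : nat -> C) : CVdisk a -> smooth_on Omega (psum a).
Proof.
intros Ha. exists (psum (pderiv a)), (psum (pderiv (pderiv a))). intros z Hz.
split; apply cderiv_psum; try assumption. now apply CVdisk_deriv.
Qed.

Lemma taylor3_Cexp (v : C -> C) (v1 v2 v3 : C) :
  taylor3 v 0 v1 v2 v3 -> taylor3 (fun z => Cexp (v z)) 1 v1 (v2 + v1 ^ 2 / 2) (v3 + v1 * v2 + v1 ^ 3 / 6).
Proof.
intros Hv.
pose proof (taylor3_bigO_1 v v1 v2 v3 Hv) as Hv1.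
destruct Cexp_taylor as [K HK].
pose proof (bigO_taylor_comp Cexp (fun w => 1 + w + w ^ 2 / 2 + w ^ 3 / 6) K v HK Hv1) as HR. cbv beta in HR.
pose proof (taylor3_mult _ _ _ _ _ _ _ _ _ _ Hv Hv) as H2.
pose proof (taylor3_mult _ _ _ _ _ _ _ _ _ _ Hv H2) as H3.
pose proof (taylor3_plus _ _ _ _ _ _ _ _ _ _ (taylor3_plus _ _ _ _ _ _ _ _ _ _ (taylor3_plus _ _ _ _ _ _ _ _ _ _
  (taylor3_const 1) Hv) (taylor3_scal (/ 2) _ _ _ _ _ H2)) (taylor3_scal (/ 6) _ _ _ _ _ H3)) as HS. cbv beta in HS.
pose proof (bigO_plus _ _ _ HR HS) as H. eapply bigO_ext; [|exact H].
intros z. simpl. field.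
Qed.

Section Subordinate.

Variables (a : nat -> C) (w : C -> C).
Hypothesis Ha : CVdisk a.
Hypothesis Ha1 : a 1%nat = 1.
Hypothesis Hw : Defs.Schwarz w.

(** [p] is [f'], [p'] is [f''], and [V] is what the subordination prescribes for [arcsin (w z)]. *)
Let p := psum (pderiv a).
Let p' := psum (pderiv (pderiv a)).
Let V (z : C) := RtoC (PI / 2) * (z * p' z / p z).

Hypothesis Hsub : forall z, Omega z -> Carcsin (w z) = V z.

Let Hp : CVdisk (pderiv a) := CVdisk_deriv a Ha.
Let Hp' : CVdisk (pderiv (pderiv a)) := CVdisk_deriv _ Hp.

Let Dp (z : C) (Hz : Omega z) : cderiv p z (p' z) := cderiv_psum _ z Hp Hz.

Lemma subordinating_cderiv (z : C) : Omega z -> exists d, cderiv w z d.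
Proof. destruct Hw as [H _]. intros Hz. destruct (H z Hz) as [d Hd]. now exists d. Qed.

Lemma deriv_at_0 : p 0 = 1.
Proof.
unfold p. rewrite psum_0 by exact Hp. unfold pderiv. rewrite Ha1. simpl. ring.
Qed.

Lemma pulled_back_cderiv (z : C) : Omega z -> p z <> 0 -> exists d, cderiv V z d.
Proof.
intros Hz H0. eexists. unfold V, Cdiv.
apply cderiv_scal. apply cderiv_mult; [apply cderiv_mult; [apply cderiv_id|apply (cderiv_psum _ z Hp' Hz)]|].
exact (cderiv_inv p z _ (Dp z Hz) H0).
Qed.

Lemma neq_open (g : C -> C) (z c d : C) : cderiv g z d -> g z <> c ->
  exists delta : R, 0 < delta /\ forall y : C, Cmod (y - z) < delta -> g y <> c.
Proof.
intros Hd Hn.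
assert (Hm : (0 < Cmod (g z - c))%R).
{ apply Cmod_gt_0. intros E. apply Hn. replace (g z) with ((g z - c) + c) by ring. rewrite E. ring. }
destruct (cderiv_cont g z d Hd _ Hm) as [delta [Hdl H]]. exists delta. split; [exact Hdl|].
intros y Hy E. specialize (H y Hy). rewrite E in H.
replace (c - g z) with (- (g z - c)) in H by ring. rewrite Cmod_opp in H. lra.
Qed.

Lemma ray_dist (z : C) (s t : R) : Omega z -> (Cmod (s * z - t * z) <= Rabs (s - t))%R.
Proof.
intros Hz. replace (s * z - t * z) with (RtoC (s - t) * z) by (rewrite RtoC_minus; ring).
rewrite Cmod_mult, Cmod_R. unfold Omega in Hz. pose proof (Rabs_pos (s - t)). pose proof (Cmod_ge_0 z). nra.
Qed.

Lemma quotient_bound (z : C) : Omega z -> p z <> 0 -> w z ^ 2 <> 1 -> (Cmod (z * p' z) <= 8 * Cmod (p z))%R.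
Proof.
intros Hz H0 H1. pose proof (Carcsin_bounded (w z) (proj2 (proj2 Hw) z Hz) H1) as B.
rewrite (Hsub z Hz) in B. unfold V in B.
rewrite Cmod_mult, Cmod_R, Rabs_pos_eq, Cmod_div in B by (try exact H0; pose proof PI_RGT_0; lra).
pose proof PI2_1. assert (Hm : (0 < Cmod (p z))%R) by now apply Cmod_gt_0.
apply (Rle_div_l _ _ _ Hm).
assert (0 <= Cmod (z * p' z) / Cmod (p z))%R by (apply Rdiv_le_0_compat; [apply Cmod_ge_0|exact Hm]).
nra.
Qed.

(* Where [w^2 = 1], [Carcsin (w z)] is a junk value, and at a zero of [p] the
   quotient in [V] is one.  Along a ray from 0 the set where neither happens is
   open; it is closed because [|z p'| <= 8 |p|] on it keeps [p] away from 0, and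
   then [sin (V z) = w z] passes to the limit. *)
Lemma subordinate_regular (z : C) : Omega z -> p z <> 0 /\ w z ^ 2 <> 1.
Proof.
intros Hz.
pose proof (interval_induction (fun t => p (t * z) <> 0 /\ w (t * z) ^ 2 <> 1)) as I.
replace z with (1 * z) by ring. apply I; clear I; [| | |lra].
- replace (0 * z) with (RtoC 0) by ring. rewrite deriv_at_0. destruct Hw as (_ & W0 & _). rewrite W0.
  split; intros E; [|simpl in E; rewrite Cmult_0_l in E]; apply RtoC_inj in E; lra.
- intros t Ht [H0 H1].
  assert (Hzt : Omega (t * z)) by (apply Omega_ray; [lra|exact Hz]).
  destruct (subordinating_cderiv _ Hzt) as [dw Hdw].
  destruct (neq_open p _ 0 _ (Dp _ Hzt) H0) as [d1 [Hd1 N1]].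
  destruct (neq_open (fun y => w y * w y) (t * z) 1 _ (cderiv_mult _ _ _ _ _ Hdw Hdw)) as [d2 [Hd2 N2]].
  { intros E. apply H1. rewrite <- E. simpl. ring. }
  exists (Rmin d1 d2). split; [now apply Rmin_pos|]. intros s Hs Hs1.
  assert (Hdist : (Cmod (s * z - t * z) < Rmin d1 d2)%R).
  { eapply Rle_lt_trans; [apply ray_dist, Hz|]. rewrite Rabs_pos_eq; lra. }
  split.
  + apply N1. eapply Rlt_le_trans; [exact Hdist|apply Rmin_l].
  + intros E. apply (N2 (s * z)); [eapply Rlt_le_trans; [exact Hdist|apply Rmin_r]|]. rewrite <- E. simpl. ring.
- intros t Ht HP.
  assert (Hzs : forall s : R, (0 <= s <= t)%R -> Omega (s * z)) by (intros s Hs; apply Omega_ray; [lra|exact Hz]).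
  assert (Hzt : Omega (t * z)) by (apply Hzs; lra).
  assert (H0 : p (t * z) <> 0).
  { intros E.
    (* Before [t] the ray lies in the regular set, where [quotient_bound] holds; Cauchy-Schwarz
       turns it into the inequality for [|p|^2] along the ray. *)
    apply (norm_stays_positive (fun s => Re (p (0 + s * z))) (fun s => Im (p (0 + s * z)))
      (fun s => Re (p' (s * z) * z)) (fun s => Im (p' (s * z) * z)) t); [lra| | | |].
    - intros s Hs. apply cderiv_line. rewrite Cplus_0_l. apply Dp, Hzs. lra.
    - intros s Hs. rewrite Cplus_0_l. destruct (HP s ltac:(lra)) as [H0 H1].
      pose proof (quotient_bound (s * z) (Hzs s ltac:(lra)) H0 H1) as B.
      set (x := p (s * z)) in *. set (y := p' (s * z) * z) in *.
      replace (s * z * p' (s * z)) with (s * y) in B by (unfold y; ring).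
      rewrite Cmod_mult, Cmod_R, Rabs_pos_eq in B by lra.
      rewrite <- Cmod_sqr.
      assert (Q : (Rabs (Re (Cconj x * y)) <= Cmod x * Cmod y)%R).
      { rewrite <- (Cmod_conj x), <- Cmod_mult. apply re_le_Cmod. }
      assert (Q' : Re (Cconj x * y) = (Re x * Re y + Im x * Im y)%R) by (rewrite re_mult, re_conj, im_conj; ring).
      rewrite Q' in Q. apply Rabs_le_between in Q. pose proof (Cmod_ge_0 x). pose proof (Cmod_ge_0 y). nra.
    - rewrite Cplus_0_l. apply Cmod_pos_components. apply HP. lra.
    - rewrite Cplus_0_l, E. split; reflexivity. }
  split; [exact H0|].
  apply Csin_Carcsin. rewrite (Hsub _ Hzt).
  destruct (pulled_back_cderiv _ Hzt H0) as [dV HdV]. destruct (subordinating_cderiv _ Hzt) as [dw Hdw].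
  pose proof (cderiv_minus _ _ _ _ _ (cderiv_comp Csin V (t * z) _ _ (cderiv_Csin _) HdV) Hdw) as HdS.
  cbv beta in HdS.
  assert (Z : Csin (V (t * z)) - w (t * z) = 0).
  { destruct (Ceq_dec (Csin (V (t * z)) - w (t * z)) 0) as [|Hn]; [assumption|exfalso].
    destruct (neq_open (fun y => Csin (V y) - w y) _ 0 _ HdS Hn) as [d [Hd N]].
    (* A point of the ray just before [t], where [w^2 <> 1] and so
       [Csin (V (s * z)) = w (s * z)]. *)
    set (s := Rmax 0 (t - d / 2)).
    assert (Hs : (0 <= s < t)%R) by (unfold s; split; [apply Rmax_l|apply Rmax_lub_lt; lra]).
    assert (Hs2 : (t - d / 2 <= s)%R) by apply Rmax_r.
    apply (N (s * z)).
    - eapply Rle_lt_trans; [apply ray_dist, Hz|]. rewrite Rabs_left; lra.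
    - destruct (HP s Hs) as [_ H1]. rewrite <- (Hsub _ (Hzs s ltac:(lra))).
      rewrite (proj2 (Csin_Carcsin _) H1). ring. }
  replace (Csin (V (t * z))) with ((Csin (V (t * z)) - w (t * z)) + w (t * z)) by ring. rewrite Z. ring.
Qed.

(** [v1], [v2], [v3] are the coefficients of [z f'' / f'], from dividing
    [2 a2 z + 6 a3 z^2 + 12 a4 z^3] by [1 + 2 a2 z + 3 a3 z^2]; [c1], [c2], [c3] are those of
    [sin (PI/2 z f'' / f')], that is, of [w]. *)
Lemma subordinate_hankel_bound :
  let v1 := 2 * a 2%nat in
  let v2 := 6 * a 3%nat - v1 * v1 in
  let v3 := 12 * a 4%nat - v2 * v1 - v1 * (3 * a 3%nat) in
  let c1 := RtoC (PI / 2) * v1 in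
  let c2 := RtoC (PI / 2) * v2 in
  let c3 := RtoC (PI / 2) * v3 - c1 ^ 3 / 6 in
  Cmod (3 / 2 * c1 * c3 + RtoC (2 / PI) / 4 * (c1 ^ 2 * c2)
    + (1 / 4 - RtoC (2 / PI) ^ 2 / 16) * c1 ^ 4 - c2 ^ 2)%C <= 1.
Proof.
intros v1 v2 v3 c1 c2 c3.
apply (hankel_schwarz_bound (2 / PI) c1 c2 c3).
{ pose proof PI2_1. pose proof PI_RGT_0. split; [apply Rdiv_le_0_compat; lra|apply Rle_div_l; lra]. }
apply schwarz_coefficients. apply toeplitz_contraction. intros u0 u1 u2 y0 y1 y2.
apply (toeplitz_bilinear (fun z => Csin (V z))).
- apply smooth_on_Csin. unfold V.
  apply (smooth_on_mult Omega _ _ (smooth_on_const Omega (RtoC (PI / 2)))).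
  apply (smooth_on_mult Omega (fun z => z * p' z) (fun z => / p z)).
  + exact (smooth_on_mult Omega _ _ (smooth_on_id Omega) (smooth_on_psum _ Hp')).
  + apply smooth_on_inv; [intros z Hz; now apply subordinate_regular|]. exact (smooth_on_psum _ Hp).
- intros z Hz. rewrite <- (Hsub z Hz), (proj2 (Csin_Carcsin _) (proj2 (subordinate_regular z Hz))).
  now apply Hw.
- apply taylor3_Csin.
  pose proof (taylor3_mult _ _ _ _ _ _ _ _ _ _ taylor3_id (taylor3_psum _ Hp')) as Hn.
  pose proof (taylor3_psum _ Hp) as Hd.
  assert (Hq : taylor3 (fun z => z * p' z / p z) 0 v1 v2 v3).
  { apply (taylor3_quotient (fun z => z * p' z) p (2 * a 2%nat) (6 * a 3%nat) (12 * a 4%nat)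
      (2 * a 2%nat) (3 * a 3%nat) (4 * a 4%nat) v1 v2 v3 (p' 0)).
    - eapply taylor3_eq; [..|exact Hn]; unfold pderiv; rewrite !INR_IZR_INZ; simpl; ring.
    - eapply taylor3_eq; [..|exact Hd]; unfold pderiv; rewrite ?Ha1, !INR_IZR_INZ; simpl; ring.
    - exact (Dp 0 Omega_0).
    - reflexivity.
    - unfold v2, v1. ring.
    - unfold v3, v2, v1. ring.
    - exact deriv_at_0. }
  eapply taylor3_eq; [..|exact (taylor3_scal (RtoC (PI / 2)) _ _ _ _ _ Hq)]; [ring|reflexivity|reflexivity|].
  unfold c3. ring.
Qed.

End Subordinate.

Lemma Omega_near (z : C) : Omega z -> exists d : R, 0 < d /\ forall y : C, Cmod (y - z) < d -> Omega y.
Proof.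
unfold Omega. intros Hz. exists (1 - Cmod z)%R. split; [lra|]. intros y Hy.
pose proof (Cmod_triangle (y - z) z) as T. replace (y - z + z) with y in T by ring. lra.
Qed.

Lemma cderiv_of_psum (f : C -> C) (a : nat -> C) (z : C) :
  CVdisk a -> (forall y, Omega y -> f y = psum a y) -> Omega z -> cderiv f z (psum (pderiv a) z).
Proof.
intros Ha Hf Hz. destruct (Omega_near z Hz) as [d [Hd HO]].
apply (cderiv_ext_loc (psum a) f z _ d Hd); [intros y Hy; symmetry; now apply Hf, HO|].
now apply cderiv_psum.
Qed.

Lemma taylor3_of_psum (f : C -> C) (a : nat -> C) : CVdisk a -> (forall y, Omega y -> f y = psum a y) ->
  taylor3 f (a 0%nat) (a 1%nat) (a 2%nat) (a 3%nat).
Proof.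
intros Ha Hf. apply (taylor3_ext_loc (psum a) f _ _ _ _ 1 Rlt_0_1); [|now apply taylor3_psum].
intros z Hz. symmetry. now apply Hf.
Qed.

Lemma C_derive_psum (f : C -> C) (a : nat -> C) (z : C) :
  CVdisk a -> (forall y, Omega y -> f y = psum a y) -> Omega z ->
  C_derive f z = psum (pderiv a) z /\ C_derive (C_derive f) z = psum (pderiv (pderiv a)) z.
Proof.
intros Ha Hf Hz.
assert (H1 : forall y, Omega y -> C_derive f y = psum (pderiv a) y).
{ intros y Hy. now apply cderiv_C_derive, cderiv_of_psum. }
split; [now apply H1|]. apply cderiv_C_derive, cderiv_of_psum; [now apply CVdisk_deriv|exact H1|exact Hz].
Qed.

Lemma logarithmic_hankel_bound (f : C -> C) (gamma : nat -> C) :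
  class_C_arcsin f -> log_coefficients f gamma -> (Cmod (H21 gamma) <= 1 / (36 * PI ^ 2))%R.
Proof.
intros [[[_ (a & Ha0 & Ha1 & Hf)] _] (w & Hw & Hsub)] (F & (_ & HF0 & HFe) & HF).
assert (Ha : CVdisk a) by exact (CVdisk_of_power_series a f Hf).
assert (Hfa : forall z, Omega z -> f z = psum a z) by (intros z; now apply psum_of_power_series).
assert (HPC : RtoC PI <> 0) by (intros E; apply RtoC_inj in E; exact (PI_neq0 E)).
assert (H2C : RtoC 2 <> 0) by (intros E; apply RtoC_inj in E; lra).
assert (HV : forall z, Omega z -> Carcsin (w z) =
  RtoC (PI / 2) * (z * psum (pderiv (pderiv a)) z / psum (pderiv a) z)).
{ intros z Hz. specialize (Hsub z Hz). cbv beta in Hsub.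
  destruct (C_derive_psum f a z Ha Hfa Hz) as [E1 E2]. rewrite E1, E2 in Hsub.
  set (x := z * psum (pderiv (pderiv a)) z / psum (pderiv a) z) in *.
  assert (X : x = 2 / PI * Carcsin (w z)).
  { replace x with ((1 + x) - 1) by ring. rewrite Hsub. ring. }
  rewrite X, RtoC_div by lra. field. exact HPC. }
pose proof (subordinate_hankel_bound a w Ha Ha1 Hw HV) as B. cbv zeta in B.
set (gam := fun n : nat => match n with O => RtoC 0 | S _ => 2 * gamma n end).
assert (HG : CVdisk gam) by exact (CVdisk_of_power_series gam F HF).
pose proof (taylor3_of_psum F gam HG (fun z Hz => psum_of_power_series gam F z HF Hz)) as TF.
apply taylor3_Cexp in TF.
assert (Ht : CVdisk (fun n => a (S n))) by now apply CVdisk_tail.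
(* A second expansion of [exp (F z) = f z / z], from the shifted series of [f]; at 0 the value
   [Cexp 0 = a 1] fills the gap. Uniqueness of expansions then expresses [a2], [a3], [a4] through
   [gamma]. *)
assert (TE : taylor3 (fun z => Cexp (F z)) (a 1%nat) (a 2%nat) (a 3%nat) (a 4%nat)).
{ apply (taylor3_of_psum _ (fun n => a (S n)) Ht). intros z Hz.
  destruct (Ceq_dec z 0) as [->|Hz0].
  - rewrite HF0, Cexp_0, psum_0, Ha1 by exact Ht. reflexivity.
  - rewrite (HFe z Hz Hz0), (Hfa z Hz), (psum_tail a z Ha Hz), Ha0. field. exact Hz0. }
destruct (taylor3_unique _ _ _ _ _ _ _ _ _ TE TF) as (_ & E2 & E3 & E4).
simpl in E2, E3, E4. rewrite E2, E3, E4 in B.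
rewrite !RtoC_div in B by (try lra; exact PI_neq0).
match type of B with Cmod ?x <= 1 => set (X := x) in B end.
(* By now a polynomial identity in [gamma]. The factor comes from [c2 = 6 PI gamma_2 + ...], whose
   square enters [X] with sign minus. *)
assert (HH : H21 gamma = / (RtoC 36 * PI ^ 2) * X).
{ unfold H21, X. simpl. field. exact HPC. }
assert (EC : / (RtoC 36 * PI ^ 2) = RtoC (1 / (36 * PI ^ 2))).
{ pose proof PI_RGT_0. assert (36 * PI ^ 2 <> 0)%R by nra.
  rewrite RtoC_div, RtoC_mult, RtoC_pow by assumption. field. exact HPC. }
rewrite HH, EC, Cmod_mult, Cmod_R.
assert (0 < 1 / (36 * PI ^ 2))%R.
{ pose proof PI_RGT_0. apply Rdiv_lt_0_compat; nra. }
rewrite Rabs_pos_eq by lra. nra.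
Qed.

(** * The power series of arcsin (z^2) *)

(** [F u n] depends only on the entries of [u] below [n], so entry [k] of the iterates of [F] on the
    zero sequence is final after [k + 1] steps; the diagonal is a fixed point. *)
Lemma causal_recursion (F : (nat -> R) -> nat -> R) :
  (forall u v n, (forall k, (k < n)%nat -> u k = v k) -> F u n = F v n) ->
  exists p : nat -> R, forall n, p n = F p n.
Proof.
intros HF. set (it := fix it (m : nat) : nat -> R := match m with O => fun _ => 0%R | S k => F (it k) end).
assert (H1 : forall m k, (k < m)%nat -> it m k = it (S m) k).
{ induction m as [|m IH]; intros k Hk; [lia|]. change (F (it m) k = F (it (S m)) k).
  apply HF. intros j Hj. apply IH. lia. }
assert (H2 : forall m k, (k < m)%nat -> it m k = it (S k) k).
{ induction m as [|m IH]; intros k Hk; [lia|]. destruct (Nat.eq_dec k m) as [->|]; [reflexivity|].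
  rewrite <- H1 by lia. apply IH. lia. }
exists (fun n => it (S n) n). intros n. change (F (it n) n = F (fun n => it (S n) n) n).
apply HF. intros k Hk. now apply H2.
Qed.

Lemma sum_n_nonneg (a : nat -> R) (n : nat) : (forall k, (k <= n)%nat -> 0 <= a k) -> (0 <= sum_n a n)%R.
Proof.
induction n as [|n IH]; intros H.
- rewrite sum_O. now apply H.
- rewrite sum_Sn. apply Rplus_le_le_0_compat; [apply IH; intros k Hk; apply H; lia|now apply H].
Qed.

Lemma sum_n_le_sum_n (a b : nat -> R) (n : nat) : (forall k, (k <= n)%nat -> a k <= b k) -> (sum_n a n <= sum_n b n)%R.
Proof.
induction n as [|n IH]; intros H.
- rewrite !sum_O. now apply H.
- rewrite !sum_Sn. apply Rplus_le_compat; [apply IH; intros k Hk; apply H; lia|now apply H].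
Qed.

Lemma sum_n_mono (a : nat -> R) (n m : nat) : (forall k, 0 <= a k) -> (n <= m)%nat -> (sum_n a n <= sum_n a m)%R.
Proof.
intros Ha H. induction H as [|m H IH]; [lra|]. rewrite sum_Sn.
change (sum_n a n <= sum_n a m + a (S m))%R. specialize (Ha (S m)). lra.
Qed.

Lemma sum_n_scal_R (c : R) (a : nat -> R) (n : nat) : sum_n (fun k => (c * a k)%R) n = (c * sum_n a n)%R.
Proof. exact (sum_n_scal_l (K := R_Ring) (V := R_ModuleSpace) c a n). Qed.

Lemma sum_n_shift (a : nat -> R) (n : nat) : sum_n a (S n) = (a O + sum_n (fun k => a (S k)) n)%R.
Proof.
induction n as [|n IH].
- rewrite sum_Sn, !sum_O. reflexivity.
- rewrite sum_Sn, IH, sum_Sn. unfold plus; simpl. ring.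
Qed.

Lemma term_le_sum_n (a : nat -> R) (n : nat) : (forall k, 0 <= a k) -> (a n <= sum_n a n)%R.
Proof.
intros Ha. destruct n as [|n]; [rewrite sum_O; lra|]. rewrite sum_Sn.
change (a (S n) <= sum_n a n + a (S n))%R.
pose proof (sum_n_nonneg a n (fun k _ => Ha k)). lra.
Qed.

(** Regroups the triangle of index pairs with sum at most [n] by the index of [a]. *)
Lemma sum_n_conv (a b : nat -> R) (n : nat) :
  sum_n (fun m => sum_n (fun k => a k * b (m - k)%nat)%R m) n = sum_n (fun k => a k * sum_n b (n - k)%nat)%R n.
Proof.
induction n as [|n IH].
- rewrite !sum_O. change (0 - 0)%nat with 0%nat. now rewrite ?sum_O.
- rewrite sum_Sn, IH, sum_Sn, (sum_Sn _ n), Nat.sub_diag.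
  rewrite (sum_n_ext_loc (fun k => a k * sum_n b (S n - k)%nat)%R
    (fun k => plus (a k * sum_n b (n - k)%nat)%R (a k * b (S n - k)%nat)%R) n).
  2:{ intros k Hk. replace (S n - k)%nat with (S (n - k)) by lia. rewrite sum_Sn. unfold plus; simpl. ring. }
  rewrite sum_n_plus, sum_O. unfold plus; simpl. ring.
Qed.

Lemma sum_n_conv_le (a b : nat -> R) (n : nat) : (forall k, 0 <= a k) -> (forall k, 0 <= b k) ->
  (sum_n (fun m => sum_n (fun k => a k * b (m - k)%nat)%R m) n <= sum_n a n * sum_n b n)%R.
Proof.
intros Ha Hb. rewrite sum_n_conv, Rmult_comm, <- sum_n_scal_R.
apply sum_n_le_sum_n. intros k Hk. rewrite Rmult_comm. apply Rmult_le_compat_r; [apply Ha|].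
apply sum_n_mono; [exact Hb|lia].
Qed.

Lemma pconv_RtoC (a b : nat -> R) (n : nat) :
  pconv (fun k => RtoC (a k)) (fun k => RtoC (b k)) n = RtoC (sum_n (fun k => a k * b (n - k)%nat)%R n).
Proof.
unfold pconv. generalize n at 2 4. intros m. induction m as [|m IH].
- rewrite !sum_O. now rewrite RtoC_mult.
- rewrite !sum_Sn, IH, <- RtoC_mult. exact (eq_sym (RtoC_plus _ _)).
Qed.

Lemma CVdisk_RtoC (a : nat -> R) (M : R) : (forall n, Rabs (a n) <= M) -> CVdisk (fun n => RtoC (a n)).
Proof. intros H. apply (CVdisk_bounded _ M). intros n. rewrite Cmod_R. apply H. Qed.

(* Taylor coefficients of [(1 - z^4)^(-1/2)]; integrating
   [2 z (1 - z^4)^(-1/2)] gives those of [arcsin (z^2)]. *)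
Fixpoint rsqrt_coef (n : nat) : R :=
  match n with
  | O => 1
  | S (S (S (S m))) => (INR m + 2) / (INR m + 4) * rsqrt_coef m
  | _ => 0
  end%R.

Definition arcsin_sqr_coef (n : nat) : R :=
  match n with S (S m) => 2 * rsqrt_coef m / (INR m + 2) | _ => 0 end%R.

Lemma rsqrt_coef_bound (n : nat) : (0 <= rsqrt_coef n <= 1)%R.
Proof.
assert (H : forall n, (0 <= rsqrt_coef n <= 1)%R /\ (0 <= rsqrt_coef (S n) <= 1)%R /\ (0 <= rsqrt_coef (S (S n)) <= 1)%R /\ (0 <= rsqrt_coef (S (S (S n))) <= 1)%R).
{ clear n. induction n as [|n (H0 & H1 & H2 & H3)]; [simpl; lra|]. repeat split; try apply H1; try apply H2; try apply H3;
  change (rsqrt_coef (S (S (S (S n))))) with ((INR n + 2) / (INR n + 4) * rsqrt_coef n)%R; pose proof (pos_INR n);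
  assert (0 <= (INR n + 2) / (INR n + 4) <= 1)%R by (split; [apply Rdiv_le_0_compat; lra|apply Rle_div_l; lra]); nra. }
apply H.
Qed.

Lemma arcsin_sqr_coef_bound (n : nat) : (0 <= arcsin_sqr_coef n <= 1)%R.
Proof.
destruct n as [|[|m]]; simpl; try lra. pose proof (rsqrt_coef_bound m). pose proof (pos_INR m).
split; [apply Rdiv_le_0_compat; lra|apply Rle_div_l; lra].
Qed.

Definition rsqrt_fun : C -> C := psum (fun n => RtoC (rsqrt_coef n)).
Definition arcsin_sqr_fun : C -> C := psum (fun n => RtoC (arcsin_sqr_coef n)).
Definition sqrt_fun (z : C) : C := rsqrt_fun z * (1 - z ^ 4).

Lemma CVdisk_rsqrt : CVdisk (fun n => RtoC (rsqrt_coef n)).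
Proof. apply (CVdisk_RtoC _ 1). intros n. rewrite Rabs_pos_eq; apply rsqrt_coef_bound. Qed.

Lemma CVdisk_arcsin_sqr : CVdisk (fun n => RtoC (arcsin_sqr_coef n)).
Proof. apply (CVdisk_RtoC _ 1). intros n. rewrite Rabs_pos_eq; apply arcsin_sqr_coef_bound. Qed.

Lemma pshift_pderiv (a : nat -> C) (n : nat) : pshift (pderiv a) n = INR n * a n.
Proof. destruct n; [simpl; ring|reflexivity]. Qed.

(** The recursion [(m + 4) r_(m+4) = (m + 2) r_m] is the equation [(1 - z^4) y' = 2 z^3 y], kept
    here in the shape [y' = z^3 (z y' + 2 y)] in which the coefficients can be compared. *)
Lemma rsqrt_fun_ode (z : C) : Omega z -> exists D' : C, cderiv rsqrt_fun z D' /\ D' = z ^ 3 * (z * D' + 2 * rsqrt_fun z).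
Proof.
intros Hz. exists (psum (pderiv (fun n => RtoC (rsqrt_coef n))) z). split; [exact (cderiv_psum _ z CVdisk_rsqrt Hz)|].
set (d := fun n => RtoC (rsqrt_coef n)). pose proof CVdisk_rsqrt as Hd. fold d in Hd.
assert (Hd' : CVdisk (pshift (pderiv d))) by now apply CVdisk_shift, CVdisk_deriv.
set (s := fun n => pshift (pderiv d) n + 2 * d n).
assert (Hs : CVdisk s) by (apply CVdisk_plus; [exact Hd'|now apply CVdisk_scal]).
transitivity (psum (pshift (pshift (pshift s))) z).
- apply psum_ext. intros [|[|[|m]]]; unfold pderiv, d; try (simpl; ring).
  simpl pshift. unfold s. rewrite pshift_pderiv. unfold d.
  change (rsqrt_coef (S (S (S (S m))))) with ((INR m + 2) / (INR m + 4) * rsqrt_coef m)%R.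
  rewrite <- !RtoC_mult, <- RtoC_plus. f_equal. rewrite !S_INR. field. pose proof (pos_INR m). lra.
- rewrite !psum_shift by (repeat apply CVdisk_shift; assumption).
  unfold s. rewrite (psum_plus (pshift (pderiv d)) (fun n => 2 * d n) z Hd' (CVdisk_scal 2 d Hd) Hz), (psum_scal 2 d z Hd Hz), psum_shift by (try apply CVdisk_deriv; assumption).
  unfold rsqrt_fun. fold d. simpl. ring.
Qed.

Lemma cderiv_arcsin_sqr (z : C) : Omega z -> cderiv arcsin_sqr_fun z (2 * z * rsqrt_fun z).
Proof.
intros Hz. eapply cderiv_eq; [|exact (cderiv_psum _ z CVdisk_arcsin_sqr Hz)].
transitivity (psum (pshift (fun n => 2 * RtoC (rsqrt_coef n))) z).
- apply psum_ext. intros [|m]; unfold pderiv; [simpl; ring|]. simpl pshift.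
  change (arcsin_sqr_coef (S (S m))) with (2 * rsqrt_coef m / (INR m + 2))%R.
  rewrite <- !RtoC_mult. f_equal. rewrite !S_INR. field. pose proof (pos_INR m). lra.
- rewrite psum_shift, psum_scal by (try apply CVdisk_scal; try exact CVdisk_rsqrt; exact Hz). unfold rsqrt_fun. ring.
Qed.

Lemma arcsin_sqr_0 : arcsin_sqr_fun 0 = 0.
Proof. exact (psum_0 _ CVdisk_arcsin_sqr). Qed.

Lemma rsqrt_0 : rsqrt_fun 0 = 1.
Proof. exact (psum_0 _ CVdisk_rsqrt). Qed.

Lemma cderiv_pow4 (z : C) : cderiv (fun w => 1 - w ^ 4) z (- (4 * z ^ 3)).
Proof.
eapply cderiv_eq; [|exact (cderiv_minus _ _ z _ _ (cderiv_const 1 z) (cderiv_pow 3 z))].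
rewrite INR_IZR_INZ. simpl. ring.
Qed.

Lemma rsqrt_sqr (z : C) : Omega z -> rsqrt_fun z * rsqrt_fun z * (1 - z ^ 4) = 1.
Proof.
intros Hz.
rewrite (cderiv_zero_const (fun z => rsqrt_fun z * rsqrt_fun z * (1 - z ^ 4)) z); [rewrite rsqrt_0; ring| |exact Hz].
intros y Hy. destruct (rsqrt_fun_ode y Hy) as (D' & HD & E).
eapply cderiv_eq; [|exact (cderiv_mult _ _ y _ _ (cderiv_mult _ _ y _ _ HD HD) (cderiv_pow4 y))].
cbv beta.
transitivity (2 * rsqrt_fun y * (D' - y ^ 3 * (y * D' + 2 * rsqrt_fun y))); [simpl; ring|]. rewrite <- E. ring.
Qed.

(** The right side times [exp (- i arcsin (z^2))] has derivative 0, by the differential equation,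
    [rsqrt_sqr] and [i^2 = -1]. *)
Lemma Cexp_arcsin_sqr (z : C) : Omega z -> Cexp (Ci * arcsin_sqr_fun z) = sqrt_fun z + Ci * z ^ 2.
Proof.
intros Hz.
assert (H : (sqrt_fun z + Ci * z ^ 2) * Cexp (- (Ci * arcsin_sqr_fun z)) = 1).
{ rewrite (cderiv_zero_const (fun z => (sqrt_fun z + Ci * z ^ 2) * Cexp (- (Ci * arcsin_sqr_fun z))) z); [| |exact Hz].
  - rewrite arcsin_sqr_0. unfold sqrt_fun. rewrite rsqrt_0. replace (- (Ci * 0)) with (RtoC 0) by ring. rewrite Cexp_0. ring.
  - intros y Hy. destruct (rsqrt_fun_ode y Hy) as (D' & HD & E).
    pose proof (cderiv_mult _ _ y _ _ HD (cderiv_pow4 y)) as HR.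
    pose proof (cderiv_plus _ _ y _ _ HR (cderiv_scal Ci _ y _ (cderiv_pow 1 y))) as HL.
    pose proof (cderiv_comp Cexp (fun z => - (Ci * arcsin_sqr_fun z)) y _ _ (cderiv_Cexp _) (cderiv_opp _ y _ (cderiv_scal Ci _ y _ (cderiv_arcsin_sqr y Hy)))) as HE.
    eapply cderiv_eq; [|exact (cderiv_mult _ _ y _ _ HL HE)]. cbv beta.
    rewrite INR_IZR_INZ. simpl IZR.
    transitivity (Cexp (- (Ci * arcsin_sqr_fun y)) * ((D' - y ^ 3 * (y * D' + 2 * rsqrt_fun y))
      + 2 * Ci * y * (1 - rsqrt_fun y * rsqrt_fun y * (1 - y ^ 4)) - 2 * y ^ 3 * rsqrt_fun y * (1 + Ci * Ci))).
    + unfold sqrt_fun. simpl. ring.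
    + rewrite <- E, (rsqrt_sqr y Hy), Ci_sqr. ring. }
rewrite <- (Cmult_1_r (sqrt_fun z + Ci * z ^ 2)), <- (Cexp_opp (Ci * arcsin_sqr_fun z)).
transitivity (Cexp (Ci * arcsin_sqr_fun z) * ((sqrt_fun z + Ci * z ^ 2) * Cexp (- (Ci * arcsin_sqr_fun z)))); [rewrite H|]; ring.
Qed.

(** By the intermediate value theorem a continuous real function without zeros keeps its sign along
    the ray from 0. This selects the branches of the square root and of the arcsine. *)
Lemma positive_on_ray (h : C -> R) (z : C) :
  (forall y, Omega y -> exists g d, cderiv g y d /\ (forall x, h x = Re (g x))) ->
  (forall y, Omega y -> h y <> 0%R) -> (0 < h 0)%R -> Omega z -> (0 < h z)%R.
Proof.
intros Hd Hn H0 Hz. apply Rnot_le_lt. intros Hle.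
assert (Hlt : (h z < 0)%R) by (destruct Hle as [|E]; [assumption|now destruct (Hn z Hz)]).
destruct (Ranalysis5.IVT_interv (fun t => - h (0 + t * z)%C)%R 0 1) as [t [Ht E]].
- intros t Ht.
  destruct (Hd (0 + t * z)) as (g & d & Hg & Eg).
  { rewrite Cplus_0_l. now apply Omega_ray. }
  apply (continuity_pt_opp (fun t => h (0 + t * z)%C)).
  apply continuity_pt_filterlim. apply (continuous_ext (fun t : R => Re (g (0 + t * z)))); [intros s; now rewrite Eg|].
  apply (ex_derive_continuous (fun t : R => Re (g (0 + t * z)))).
  exact (ex_intro _ _ (proj1 (cderiv_line g 0 z d t Hg))).
- lra.
- replace (0 + 0 * z) with (RtoC 0) by ring. lra.
- replace (0 + 1 * z) with z by ring. lra.
- apply (Hn (0 + t * z)); [rewrite Cplus_0_l; now apply Omega_ray|lra].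
Qed.

Lemma sqrt_fun_sqr (z : C) : Omega z -> sqrt_fun z * sqrt_fun z = 1 - z ^ 4.
Proof.
intros Hz. unfold sqrt_fun.
transitivity ((rsqrt_fun z * rsqrt_fun z * (1 - z ^ 4)) * (1 - z ^ 4)); [ring|]. rewrite rsqrt_sqr by exact Hz. ring.
Qed.

Lemma Re_sqrt_fun (z : C) : Omega z -> (0 < Re (sqrt_fun z))%R.
Proof.
apply (positive_on_ray (fun z => Re (sqrt_fun z))).
- intros y Hy. destruct (rsqrt_fun_ode y Hy) as (D' & HD & _).
  eexists sqrt_fun, _. split; [exact (cderiv_mult _ _ y _ _ HD (cderiv_pow4 y))|reflexivity].
(* A number with real part 0 has a square with real part at most 0, whereas [Re (1 - y^4) > 0]. *)
- intros y Hy E. pose proof (sqrt_fun_sqr y Hy) as S. apply (f_equal Re) in S.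
  rewrite re_mult, E in S. unfold Cminus in S. rewrite re_plus, re_opp, re_RtoC in S.
  pose proof (re_le_Cmod (y ^ 4)) as B. rewrite Cmod_pow in B. apply Rabs_le_between in B.
  assert (Cmod y ^ 4 < 1)%R.
  { unfold Omega in Hy. pose proof (Cmod_ge_0 y). assert (Cmod y ^ 2 < 1)%R by (simpl; nra).
    replace (Cmod y ^ 4)%R with (Cmod y ^ 2 * Cmod y ^ 2)%R by ring. pose proof (pow2_ge_0 (Cmod y)). nra. }
  nra.
- unfold sqrt_fun. rewrite rsqrt_0. replace (1 * (1 - 0 ^ 4)) with (RtoC 1) by (simpl; ring). rewrite re_RtoC. lra.
Qed.

(** With [E = s + i z^2] and [s = sqrt_fun z], one has [1 / E = s - i z^2], so [E + 1 / E = 2 s]. As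
    [1 / E] is a positive multiple of [conj E], the real parts of [E] and [s] have the same sign. *)
Lemma Re_Cexp_arcsin_sqr (z : C) : Omega z -> (0 < Re (Cexp (Ci * arcsin_sqr_fun z)))%R.
Proof.
intros Hz. rewrite (Cexp_arcsin_sqr z Hz). pose proof (Re_sqrt_fun z Hz) as HR.
set (E := sqrt_fun z + Ci * z ^ 2).
assert (P : E * (sqrt_fun z - Ci * z ^ 2) = 1).
{ unfold E. transitivity (sqrt_fun z * sqrt_fun z - (Ci * Ci) * z ^ 4); [simpl; ring|]. rewrite (sqrt_fun_sqr z Hz), Ci_sqr. ring. }
assert (HE : E <> 0) by (intros H0; rewrite H0, Cmult_0_l in P; apply RtoC_inj in P; lra).
assert (Q : Cconj E = Cmod E ^ 2 * (2 * sqrt_fun z - E)).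
{ rewrite <- RtoC_pow, <- Cmult_conj_r. transitivity (Cconj E * (E * (sqrt_fun z - Ci * z ^ 2))); [rewrite P; ring|]. unfold E. ring. }
apply (f_equal Re) in Q. rewrite re_conj, <- RtoC_pow, re_scal_l in Q.
unfold Cminus in Q. rewrite re_plus, re_opp, re_scal_l in Q.
assert (Hm : (0 < Cmod E ^ 2)%R) by (apply pow_lt, Cmod_gt_0, HE). nra.
Qed.

(** For [A = arcsin_sqr_fun z], the real part of [exp (i A)] is [exp (- Im A) cos (Re A) > 0]. So
    [Re A], which is 0 at the origin, never reaches [PI / 2] or [- PI / 2]. *)
Lemma Re_arcsin_sqr (z : C) : Omega z -> (- (PI / 2) < Re (arcsin_sqr_fun z) < PI / 2)%R.
Proof.
assert (HC : forall y, Omega y -> (cos (Re (arcsin_sqr_fun y)) <> 0)%R).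
{ intros y Hy E. pose proof (Re_Cexp_arcsin_sqr y Hy) as H.
  change (0 < exp (Re (Ci * arcsin_sqr_fun y)) * cos (Im (Ci * arcsin_sqr_fun y)))%R in H.
  replace (Im (Ci * arcsin_sqr_fun y)) with (Re (arcsin_sqr_fun y)) in H by (rewrite im_mult; simpl; ring).
  rewrite E in H. lra. }
pose proof PI_RGT_0.
intros Hz. split.
- enough (0 < Re (PI / 2 + arcsin_sqr_fun z)%C)%R.
  { rewrite re_plus, <- RtoC_div, re_RtoC in H0 by lra. lra. }
  apply (positive_on_ray (fun z => Re (PI / 2 + arcsin_sqr_fun z))); [| | |exact Hz].
  + intros y Hy. eexists (fun z => PI / 2 + arcsin_sqr_fun z), _. split; [|reflexivity].
    exact (cderiv_plus _ _ y _ _ (cderiv_const (PI / 2) y) (cderiv_arcsin_sqr y Hy)).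
  + intros y Hy E. apply (HC y Hy). rewrite re_plus, <- RtoC_div, re_RtoC in E by lra.
    replace (Re (arcsin_sqr_fun y)) with (- (PI / 2))%R by lra. rewrite cos_neg. apply cos_PI2.
  + rewrite arcsin_sqr_0, re_plus, <- RtoC_div, !re_RtoC by lra. lra.
- enough (0 < Re (PI / 2 + (-1) * arcsin_sqr_fun z)%C)%R.
  { rewrite re_plus, <- RtoC_div, re_RtoC, re_scal_l in H0 by lra. lra. }
  apply (positive_on_ray (fun z => Re (PI / 2 + (-1) * arcsin_sqr_fun z))); [| | |exact Hz].
  + intros y Hy. eexists (fun z => PI / 2 + (-1) * arcsin_sqr_fun z), _. split; [|reflexivity].
    exact (cderiv_plus _ _ y _ _ (cderiv_const (PI / 2) y) (cderiv_scal (-1) _ y _ (cderiv_arcsin_sqr y Hy))).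
  + intros y Hy E. apply (HC y Hy). rewrite re_plus, <- RtoC_div, re_RtoC, re_scal_l in E by lra.
    replace (Re (arcsin_sqr_fun y)) with (PI / 2)%R by lra. apply cos_PI2.
  + rewrite arcsin_sqr_0, re_plus, <- RtoC_div, re_scal_l, !re_RtoC by lra. lra.
Qed.

Lemma Carcsin_sqr (z : C) : Omega z -> Carcsin (z ^ 2) = arcsin_sqr_fun z.
Proof.
intros Hz. apply Carcsin_unique with (sqrt_fun z).
- rewrite (sqrt_fun_sqr z Hz). simpl. ring.
- now apply Re_sqrt_fun.
- now apply Cexp_arcsin_sqr.
- pose proof (Re_arcsin_sqr z Hz). pose proof PI_RGT_0. lra.
Qed.

Lemma sum_n_le_series (a : nat -> R) (l : R) (n : nat) : (forall k, 0 <= a k) -> is_series a l -> (sum_n a n <= l)%R.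
Proof.
intros Ha H.
apply (is_lim_seq_incr_compare (sum_n a) l); [exact H|].
intros m. apply sum_n_mono; [exact Ha|lia].
Qed.

(** As the coefficients are nonnegative, [r^n] times the partial sum is at most the value of the
    series at [r], which is below [PI / 2]; let [r] tend to 1. *)
Lemma sum_arcsin_sqr_coef (n : nat) : (sum_n arcsin_sqr_coef n <= PI / 2)%R.
Proof.
pose proof PI_RGT_0.
apply (le_of_pow_scaled _ _ n); [lra|]. intros r Hr.
assert (Hz : Omega (RtoC r)) by (unfold Omega; rewrite Cmod_R, Rabs_pos_eq; lra).
pose proof (proj1 (psum_csum _ _ CVdisk_arcsin_sqr Hz)) as S.
apply Rle_trans with (sum_n (fun k => Re (RtoC (arcsin_sqr_coef k) * RtoC r ^ k)) n).
- rewrite Rmult_comm, <- sum_n_scal_R. apply sum_n_le_sum_n. intros k Hk.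
  rewrite <- RtoC_pow, <- RtoC_mult, re_RtoC, Rmult_comm. apply Rmult_le_compat_l; [apply arcsin_sqr_coef_bound|].
  replace n with (k + (n - k))%nat by lia. rewrite pow_add.
  rewrite <- (Rmult_1_r (r ^ k)) at 2. apply Rmult_le_compat_l; [apply pow_le; lra|].
  rewrite <- (pow1 (n - k)). apply pow_incr. lra.
- eapply Rle_trans; [apply (sum_n_le_series _ _ n) with (2 := S)|].
  + intros k. rewrite <- RtoC_pow, <- RtoC_mult, re_RtoC. apply Rmult_le_pos; [apply arcsin_sqr_coef_bound|apply pow_le; lra].
  + apply Rlt_le. apply (Re_arcsin_sqr _ Hz).
Qed.

(** * The extremal function *)

Lemma sum_n_congr (a b : nat -> R) (n : nat) : (forall k, (k <= n)%nat -> a k = b k) -> sum_n a n = sum_n b n.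
Proof. exact (sum_n_ext_loc a b n). Qed.

(* Coefficients [p] of the solution of [y' = e y], [y 0 = 1]. *)
Lemma linear_ode_coefficients (e : nat -> R) :
  exists p : nat -> R, p O = 1%R /\
    forall n, (INR (S n) * p (S n) = sum_n (fun k => e k * p (n - k)%nat) n)%R.
Proof.
destruct (causal_recursion (fun u n => match n with O => 1 | S m => / INR (S m) * sum_n (fun k => e k * u (m - k)%nat) m end)%R) as [p Hp].
- intros u v [|m] H; [reflexivity|]. f_equal. apply sum_n_congr. intros k Hk. now rewrite H by lia.
- exists p. split; [exact (Hp O)|]. intros n. rewrite (Hp (S n)), <- Rmult_assoc, Rinv_r, Rmult_1_l; [reflexivity|].
  apply not_0_INR. lia.
Qed.

(* Coefficients [t] of the quotient [c / g] when [g 0 = 1]. *)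
Lemma quotient_coefficients (g c : nat -> R) : g O = 1%R ->
  exists t : nat -> R, t O = c O /\
    (forall n, t (S n) = c (S n) - sum_n (fun k => g (S k) * t (n - k)%nat) n)%R /\
    (forall n, sum_n (fun k => g k * t (n - k)%nat)%R n = c n).
Proof.
intros Hg.
destruct (causal_recursion (fun u n => match n with O => c O | S m => c (S m) - sum_n (fun k => g (S k) * u (m - k)%nat) m end)%R) as [t Ht].
- intros u v [|m] H; [reflexivity|]. f_equal. apply sum_n_congr. intros k Hk. now rewrite H by lia.
- exists t. split; [exact (Ht O)|]. split; [intros n; exact (Ht (S n))|]. intros [|n].
  + rewrite sum_O, Hg, Nat.sub_diag, (Ht O). apply Rmult_1_l.
  + rewrite sum_n_shift, Hg, Nat.sub_0_r, (Ht (S n)).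
    change (fun k => g (S k) * t (S n - S k)%nat)%R with (fun k => g (S k) * t (n - k)%nat)%R.
    match goal with |- @eq _ ?x ?y => change (@eq R x y) end. ring.
Qed.

(* Coefficients of [2/PI * arcsin (z^2) / z]. *)
Definition drift_coef (n : nat) : R := (2 / PI * arcsin_sqr_coef (S n))%R.

Lemma drift_coef_nonneg (n : nat) : (0 <= drift_coef n)%R.
Proof.
pose proof PI_RGT_0. apply Rmult_le_pos; [apply Rdiv_le_0_compat; lra|apply arcsin_sqr_coef_bound].
Qed.

Lemma sum_drift_coef (n : nat) : (sum_n drift_coef n <= 1)%R.
Proof.
pose proof PI_RGT_0. unfold drift_coef. rewrite sum_n_scal_R.
pose proof (sum_arcsin_sqr_coef (S n)) as B. rewrite sum_n_shift in B. change (arcsin_sqr_coef 0) with 0%R in B.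
apply Rle_trans with (2 / PI * (PI / 2))%R; [|right; field; lra].
apply Rmult_le_compat_l; [apply Rdiv_le_0_compat; lra|lra].
Qed.

Lemma psum_drift_coef (z : C) : Omega z -> z * psum (fun n => RtoC (drift_coef n)) z = RtoC (2 / PI) * arcsin_sqr_fun z.
Proof.
intros Hz. unfold arcsin_sqr_fun. rewrite (psum_tail _ z CVdisk_arcsin_sqr Hz).
pose proof (CVdisk_tail _ CVdisk_arcsin_sqr) as Ht. change (RtoC (arcsin_sqr_coef 0)) with (RtoC 0).
replace (psum (fun n => RtoC (drift_coef n)) z) with (RtoC (2 / PI) * psum (fun n => RtoC (arcsin_sqr_coef (S n))) z); [ring|].
rewrite <- (psum_scal _ _ z Ht Hz). apply psum_ext. intros n. unfold drift_coef. now rewrite RtoC_mult.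
Qed.

Section Extremal.

Variable p : nat -> R.
Hypothesis Hp0 : p O = 1%R.
Hypothesis Hp : forall n, (INR (S n) * p (S n) = sum_n (fun k => drift_coef k * p (n - k)%nat) n)%R.

Lemma p_nonneg (n : nat) : (0 <= p n)%R.
Proof.
induction n as [[|n] IH] using lt_wf_ind; [rewrite Hp0; lra|].
apply (Rmult_le_reg_l (INR (S n))); [apply lt_0_INR; lia|]. rewrite Rmult_0_r, Hp.
apply sum_n_nonneg. intros k Hk. apply Rmult_le_pos; [apply drift_coef_nonneg|apply IH; lia].
Qed.

(** [arcsin (z^2) / z] has no constant term. This is what gives [2 p_n <= n p_n] for all
    [n >= 1]. *)
Lemma p_1 : p 1%nat = 0%R.
Proof.
pose proof (Hp 0) as H. rewrite sum_O in H. unfold drift_coef in H. simpl in H. lra.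
Qed.

Lemma p_2 : p 2%nat = (1 / PI)%R.
Proof.
pose proof (Hp 1) as H. rewrite sum_Sn, sum_O in H. unfold drift_coef, plus in H. simpl in H.
rewrite Hp0, p_1 in H.
replace (1 / PI)%R with ((2 / PI * (2 * 1 / (0 + 2))) / 2)%R by (field; exact PI_neq0). lra.
Qed.

(* As [p 1 = 0], one has [2 p n <= n p n] for [n >= 1]; sum the recursion. *)
Lemma sum_p_tail (n : nat) : (sum_n (fun k => p (S k)) n <= 1)%R.
Proof.
assert (H : (2 * sum_n (fun k => p (S k)) n <= sum_n p n)%R).
{ rewrite <- sum_n_scal_R.
  apply Rle_trans with (sum_n (fun m => sum_n (fun k => drift_coef k * p (m - k)%nat) m) n)%R.
  - apply sum_n_le_sum_n. intros k Hk. rewrite <- Hp. destruct k as [|k]; [rewrite p_1; lra|].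
    apply Rmult_le_compat_r; [apply p_nonneg|]. rewrite !S_INR. pose proof (pos_INR k). lra.
  - eapply Rle_trans; [apply sum_n_conv_le; [apply drift_coef_nonneg|apply p_nonneg]|].
    rewrite <- (Rmult_1_l (sum_n p n)) at 2. apply Rmult_le_compat_r; [apply sum_n_nonneg; intros; apply p_nonneg|apply sum_drift_coef]. }
assert (H2 : (sum_n p n <= 1 + sum_n (fun k => p (S k)) n)%R).
{ rewrite <- Hp0, <- sum_n_shift. apply sum_n_mono; [apply p_nonneg|lia]. }
lra.
Qed.

Lemma p_bound (n : nat) : (0 <= p n <= 1)%R.
Proof.
split; [apply p_nonneg|]. destruct n as [|n]; [rewrite Hp0; lra|].
eapply Rle_trans; [apply (term_le_sum_n (fun k => p (S k)) n); intros; apply p_nonneg|apply sum_p_tail].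
Qed.

Let P : C -> C := psum (fun n => RtoC (p n)).

Lemma CV_p : CVdisk (fun n => RtoC (p n)).
Proof. apply (CVdisk_RtoC _ 1). intros n. rewrite Rabs_pos_eq; apply p_bound. Qed.

Lemma P_ode (z : C) : Omega z -> psum (pderiv (fun n => RtoC (p n))) z = psum (fun n => RtoC (drift_coef n)) z * P z.
Proof.
intros Hz.
assert (He : CVdisk (fun n => RtoC (drift_coef n))).
{ apply (CVdisk_RtoC _ 1). intros n. rewrite Rabs_pos_eq by apply drift_coef_nonneg.
  eapply Rle_trans; [apply (term_le_sum_n drift_coef n drift_coef_nonneg)|apply sum_drift_coef]. }
assert (E : forall n, pderiv (fun n => RtoC (p n)) n = pconv (fun n => RtoC (drift_coef n)) (fun n => RtoC (p n)) n).
{ intros n. rewrite pconv_RtoC, <- Hp, RtoC_mult. reflexivity. }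
rewrite (psum_ext _ _ z E). apply psum_conv; [exact He|exact CV_p| |exact Hz].
apply (CVdisk_ext _ _ E), CVdisk_deriv, CV_p.
Qed.

(** [P z = 1 + z y] with [|y| <= p_1 + p_2 + ... <= 1], hence [|z y| < 1]. *)
Lemma Re_P (z : C) : Omega z -> (0 < Re (P z))%R.
Proof.
intros Hz. unfold P. rewrite (psum_tail _ z CV_p Hz), Hp0.
set (y := psum _ z).
assert (Hy : (Cmod y <= 1)%R).
{ assert (Hs : ex_series (fun n => p (S n))).
  { destruct (ex_finite_lim_seq_incr (sum_n (fun n => p (S n))) 1) as [l Hl].
    - intros n. apply sum_n_mono; [intros; apply p_nonneg|lia].
    - exact sum_p_tail.
    - now exists l. }
  destruct Hs as [l Hl].
  assert (Hl1 : (l <= 1)%R).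
  { apply (is_lim_seq_le (sum_n (fun n => p (S n))) (fun _ => 1%R) l 1%R); [exact sum_p_tail|exact Hl|apply is_lim_seq_const]. }
  apply Rle_trans with l; [|exact Hl1].
  eapply Cmod_csum_le; [exact (psum_csum _ z (CVdisk_tail _ CV_p) Hz)|exact Hl|].
  intros n. cbv beta. rewrite Cmod_mult, Cmod_pow, Cmod_R, Rabs_pos_eq by apply p_nonneg.
  rewrite <- (Rmult_1_r (p (S n))) at 2. apply Rmult_le_compat_l; [apply p_nonneg|].
  rewrite <- (pow1 n). apply pow_incr. split; [apply Cmod_ge_0|]. unfold Omega in Hz. lra. }
rewrite re_plus, re_RtoC.
pose proof (re_le_Cmod (z * y)) as B. rewrite Cmod_mult in B. apply Rabs_le_between in B.
unfold Omega in Hz. pose proof (Cmod_ge_0 z). pose proof (Cmod_ge_0 y).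
assert (Cmod z * Cmod y <= Cmod z * 1)%R by (apply Rmult_le_compat_l; lra). lra.
Qed.

(* Coefficients of [f z / z]. *)
Definition gcoef (n : nat) : R := (p n / INR (S n))%R.

Lemma gcoef_bound (n : nat) : (0 <= gcoef n <= p n)%R.
Proof.
unfold gcoef. assert (H : (1 <= INR (S n))%R) by (rewrite S_INR; pose proof (pos_INR n); lra).
pose proof (p_nonneg n). split; [apply Rdiv_le_0_compat; lra|]. apply Rle_div_l; nra.
Qed.

Lemma CV_g : CVdisk (fun n => RtoC (gcoef n)).
Proof.
apply (CVdisk_RtoC _ 1). intros n. pose proof (gcoef_bound n). pose proof (p_bound n). rewrite Rabs_pos_eq; lra.
Qed.

Definition acoef : nat -> C := pshift (fun n => RtoC (gcoef n)).
Definition extremal : C -> C := psum acoef.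

Lemma CV_a : CVdisk acoef.
Proof. apply CVdisk_shift, CV_g. Qed.

Lemma pderiv_acoef (n : nat) : pderiv acoef n = RtoC (p n).
Proof.
unfold pderiv, acoef, gcoef. change (RtoC (INR (S n)) * RtoC (p n / INR (S n)) = RtoC (p n)).
rewrite <- RtoC_mult. apply (f_equal RtoC). field. apply not_0_INR. lia.
Qed.

Lemma cderiv_extremal (z : C) : Omega z -> cderiv extremal z (P z).
Proof.
intros Hz. eapply cderiv_eq; [|exact (cderiv_psum acoef z CV_a Hz)].
apply psum_ext, pderiv_acoef.
Qed.

(* Noshiro-Warschawski: the real part of the derivative is positive. *)
Lemma extremal_univalent : univalent extremal.
Proof.
intros z w Hz Hw E. destruct (Ceq_dec (z - w) 0) as [H|H].
{ replace z with ((z - w) + w) by ring. rewrite H. ring. }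
exfalso. set (d := z - w) in *.
assert (Hseg : forall t : R, (0 <= t <= 1)%R -> Omega (w + t * d)).
{ intros t Ht. unfold Omega in *. replace (w + t * d) with (RtoC (1 - t) * w + t * z) by (unfold d; rewrite RtoC_minus; ring).
  eapply Rle_lt_trans; [apply Cmod_triangle|]. rewrite !Cmod_mult, !Cmod_R, (Rabs_pos_eq (1 - t)), (Rabs_pos_eq t) by lra.
  apply Rle_lt_trans with (Rmax (Cmod w) (Cmod z)); [|now apply Rmax_lub_lt].
  pose proof (Rmax_l (Cmod w) (Cmod z)). pose proof (Rmax_r (Cmod w) (Cmod z)). nra. }
(* Along the segment this function has derivative [|d|^2 Re P > 0], although its end values
   agree. *)
destruct (MVT_unit (fun s => Re (Cconj d * extremal (w + s * d))) (fun t => Re (Cconj d * P (w + t * d) * d))) as [c [Hc Ec]].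
{ intros t Ht. apply (cderiv_line (fun y => Cconj d * extremal y) w d _ t).
  apply cderiv_scal, cderiv_extremal. now apply Hseg. }
replace (w + 1 * d) with z in Ec by (unfold d; ring). replace (w + 0 * d) with w in Ec by ring.
rewrite E in Ec.
replace (Cconj d * P (w + c * d) * d) with (RtoC (Cmod d ^ 2) * P (w + c * d)) in Ec by (rewrite <- Cmult_conj_r; ring).
rewrite re_scal_l in Ec.
assert (0 < Cmod d ^ 2 * Re (P (w + c * d)))%R.
{ apply Rmult_lt_0_compat; [apply pow_lt, Cmod_gt_0, H|apply Re_P, Hseg, Hc]. }
lra.
Qed.

Lemma extremal_class : class_C_arcsin extremal.
Proof.
repeat split.
- intros z Hz. exists (P z). exact (cderiv_extremal z Hz).
- exists acoef. split; [reflexivity|]. split.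
  + apply (f_equal RtoC). unfold gcoef. simpl. rewrite Hp0. field.
  + intros z Hz. apply psum_power_series; [exact CV_a|exact Hz].
- exact extremal_univalent.
- exists (fun z => z ^ 2). split.
  + split; [|split].
    * intros z Hz. eexists. exact (cderiv_pow 1 z).
    * simpl. ring.
    * intros z Hz. rewrite Cmod_pow. unfold Omega in Hz. pose proof (Cmod_ge_0 z). simpl. nra.
  + intros z Hz. destruct (C_derive_psum extremal acoef z CV_a (fun _ _ => eq_refl) Hz) as [E1 E2].
    rewrite E1, E2, (Carcsin_sqr z Hz).
    rewrite (psum_ext _ _ z pderiv_acoef). fold P.
    assert (E3 : psum (pderiv (pderiv acoef)) z = psum (fun n => RtoC (drift_coef n)) z * P z).
    { rewrite <- (P_ode z Hz). apply psum_ext. intros n. unfold pderiv at 1 3. now rewrite pderiv_acoef. }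
    rewrite E3.
    (* Positivity of [Re P] makes the division by [f'] genuine; the quotient [z P' / P] then reduces
       to [z] times the drift series. *)
    assert (HP : P z <> 0) by (intros H; pose proof (Re_P z Hz) as B; rewrite H, re_RtoC in B; lra).
    rewrite <- RtoC_div by exact PI_neq0. rewrite <- (psum_drift_coef z Hz). field. exact HP.
Qed.

Lemma gcoef_0 : gcoef 0 = 1%R.
Proof. unfold gcoef. simpl. rewrite Hp0. field. Qed.

(** The logarithm [F] of [G = f z / z] is built from its derivative: [t] holds the coefficients of
    [G' / G], obtained by division, [phi] those of the primitive, and [exp F = G] because
    [G exp (- F)] has derivative 0. *)
Lemma extremal_log_coefficients : exists gamma : nat -> C,
  log_coefficients extremal gamma /\ gamma 1%nat = 0 /\ gamma 2%nat = RtoC (/ (6 * PI)).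
Proof.
set (c := fun n => (INR (S n) * gcoef (S n))%R).
destruct (quotient_coefficients gcoef c gcoef_0) as (t & Ht0 & HtS & Hconv).
assert (Hc : forall n, (0 <= c n <= 1)%R).
{ intros n. unfold c, gcoef. pose proof (p_bound (S n)). pose proof (pos_INR (S n)) as Hn.
  replace (INR (S n) * (p (S n) / INR (S (S n))))%R with (p (S n) * (INR (S n) / INR (S (S n))))%R
    by (field; apply not_0_INR; lia).
  assert (0 <= INR (S n) / INR (S (S n)) <= 1)%R.
  { rewrite (S_INR (S n)). split; [apply Rdiv_le_0_compat; lra|apply Rle_div_l; lra]. }
  nra. }
(* Each [gcoef (S k)] divides [p (S k)] by [k + 2 >= 2], and the [p (S k)] sum to at most 1. *)
assert (Hg : forall n, (sum_n (fun k => gcoef (S k)) n <= 1 / 2)%R).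
{ intros n. apply Rle_trans with (1 / 2 * sum_n (fun k => p (S k)) n)%R.
  - rewrite <- sum_n_scal_R. apply sum_n_le_sum_n. intros k _. unfold gcoef, Rdiv.
    rewrite Rmult_comm. apply Rmult_le_compat_r; [apply p_nonneg|]. rewrite Rmult_1_l.
    apply Rinv_le_contravar; [lra|]. rewrite !S_INR. pose proof (pos_INR k). lra.
  - pose proof (sum_p_tail n). lra. }
(* In the division recursion [|t_(n+1)|] is at most [1 + 2 / 2]: the coefficient of [G'] is at most
   1, and the convolution is at most twice the tail sum of [gcoef]. *)
assert (Ht : forall n, (Rabs (t n) <= 2)%R).
{ intros n. induction n as [[|n] IH] using lt_wf_ind.
  - rewrite Ht0. pose proof (Hc 0%nat). rewrite Rabs_pos_eq; lra.
  - rewrite HtS. pose proof (Hc (S n)) as H1.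
    assert (H2 : (Rabs (sum_n (fun k => gcoef (S k) * t (n - k)%nat) n) <= 1)%R).
    { apply Rle_trans with (sum_n (fun k => 2 * gcoef (S k)) n)%R.
      - eapply Rle_trans; [apply (norm_sum_n_m (fun k => gcoef (S k) * t (n - k)%nat)%R 0 n)|].
        apply sum_n_le_sum_n. intros k Hk.
        change (Rabs (gcoef (S k) * t (n - k)%nat) <= 2 * gcoef (S k))%R.
        pose proof (gcoef_bound (S k)) as G. rewrite Rabs_mult, (Rabs_pos_eq (gcoef (S k))), Rmult_comm by apply G.
        apply Rmult_le_compat_r; [apply G|apply IH; lia].
      - rewrite sum_n_scal_R. specialize (Hg n). lra. }
    apply Rabs_le_between in H2. apply Rabs_le. lra. }
set (phi := fun n => match n with O => 0 | S m => t m / INR (S m) end%R).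
assert (CVt : CVdisk (fun n => RtoC (t n))) by exact (CVdisk_RtoC t 2 Ht).
assert (CVphi : CVdisk (fun n => RtoC (phi n))).
{ apply (CVdisk_RtoC _ 2). intros [|m]; unfold phi; [rewrite Rabs_R0; lra|].
  assert (H : (1 <= INR (S m))%R) by (rewrite S_INR; pose proof (pos_INR m); lra).
  rewrite Rabs_div, (Rabs_pos_eq (INR (S m))) by lra. apply Rle_div_l; [lra|]. specialize (Ht m). nra. }
assert (Ephi : forall n, pderiv (fun n => RtoC (phi n)) n = RtoC (t n)).
{ intros n. unfold pderiv, phi. rewrite <- RtoC_mult. apply (f_equal RtoC). field. apply not_0_INR. lia. }
set (F := psum (fun n => RtoC (phi n))). set (G := psum (fun n => RtoC (gcoef n))).
assert (DF : forall z, Omega z -> cderiv F z (psum (fun n => RtoC (t n)) z)).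
{ intros z Hz. eapply cderiv_eq; [|exact (cderiv_psum _ z CVphi Hz)]. now apply psum_ext. }
assert (DG : forall z, Omega z -> cderiv G z (G z * psum (fun n => RtoC (t n)) z)).
{ intros z Hz. eapply cderiv_eq; [|exact (cderiv_psum _ z CV_g Hz)].
  assert (E : forall n, pconv (fun n => RtoC (gcoef n)) (fun n => RtoC (t n)) n = pderiv (fun n => RtoC (gcoef n)) n).
  { intros n. rewrite pconv_RtoC, Hconv. unfold c. now rewrite RtoC_mult. }
  rewrite <- (psum_ext _ _ z E). apply psum_conv; [exact CV_g|exact CVt| |exact Hz].
  eapply CVdisk_ext; [intros n; symmetry; apply E|]. apply CVdisk_deriv, CV_g. }
assert (F0 : F 0 = 0) by exact (psum_0 _ CVphi).
assert (G0 : G 0 = 1) by (unfold G; rewrite (psum_0 _ CV_g), gcoef_0; reflexivity).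
assert (EFG : forall z, Omega z -> Cexp (F z) = G z).
{ intros z Hz.
  assert (H : G z * Cexp (- F z) = 1).
  { rewrite (cderiv_zero_const (fun z => G z * Cexp (- F z)) z); [| |exact Hz].
    - rewrite F0, G0. replace (- 0) with (RtoC 0) by ring. rewrite Cexp_0. ring.
    - intros y Hy.
      pose proof (cderiv_comp Cexp (fun z => - F z) y _ _ (cderiv_Cexp _) (cderiv_opp _ y _ (DF y Hy))) as HE.
      eapply cderiv_eq; [|exact (cderiv_mult _ _ y _ _ (DG y Hy) HE)]. cbv beta. ring. }
  transitivity (Cexp (F z) * (G z * Cexp (- F z))); [rewrite H; ring|].
  transitivity (G z * (Cexp (F z) * Cexp (- F z))); [ring|]. rewrite Cexp_opp. ring. }
exists (fun n => RtoC (phi n / 2)). split; [|split].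
- exists F. split; [split; [|split]|].
  + intros z Hz. eexists. exact (DF z Hz).
  + exact F0.
  + intros z Hz Hz0. rewrite (EFG z Hz). unfold extremal, acoef. rewrite (psum_shift _ z CV_g Hz).
    fold G. field. exact Hz0.
  + intros z Hz.
    assert (E : forall n, RtoC (phi n) = match n with O => 0 | S _ => 2 * RtoC (phi n / 2) end).
    { intros [|n]; [reflexivity|]. rewrite <- RtoC_mult. apply (f_equal RtoC). field. }
    pose proof (psum_power_series _ z CVphi Hz) as H. apply power_series_iff in H. apply power_series_iff.
    eapply csum_ext; [|exact H]. intros n. cbv beta. now rewrite E at 1.
- change (RtoC (t 0%nat / INR 1 / 2) = RtoC 0). rewrite Ht0. unfold c, gcoef. rewrite p_1. apply (f_equal RtoC). simpl. field.
(* Since [p_1 = 0], only [t_1 = 2 p_2 / 3 = 2 / (3 PI)] is left; integration and the convention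
   [F = 2 (gamma_1 z + ...)] each halve it. *)
- change (RtoC (t 1%nat / INR 2 / 2) = RtoC (/ (6 * PI))). rewrite HtS, sum_O. change (0 - 0)%nat with 0%nat. rewrite Ht0. unfold c, gcoef. rewrite p_1, p_2. apply (f_equal RtoC). simpl. field. exact PI_neq0.
Qed.

End Extremal.

Theorem theorem3p7 :
  (forall (f : C -> C) (gamma : nat -> C),
      class_C_arcsin f -> log_coefficients f gamma ->
      (Cmod (H21 gamma) <= 1 / (36 * PI ^ 2))%R) /\
  (exists (f : C -> C) (gamma : nat -> C),
      class_C_arcsin f /\ log_coefficients f gamma /\
      Cmod (H21 gamma) = (1 / (36 * PI ^ 2))%R).
Proof.
split; [exact logarithmic_hankel_bound|].
destruct (linear_ode_coefficients drift_coef) as (p & Hp0 & Hp).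
destruct (extremal_log_coefficients p Hp0 Hp) as (gamma & Hg & G1 & G2).
exists (extremal p), gamma. split; [now apply extremal_class|]. split; [exact Hg|].
unfold H21. rewrite G1, G2.
(* As [gamma_1 = 0], the determinant reduces to [- gamma_2^2]. *)
replace (0 * gamma 3%nat - RtoC (/ (6 * PI)) ^ 2) with (- RtoC (/ (6 * PI)) ^ 2) by ring.
rewrite Cmod_opp, Cmod_pow, Cmod_R. pose proof PI_RGT_0.
rewrite Rabs_pos_eq by (apply Rlt_le, Rinv_0_lt_compat; lra). field. lra.
Qed.
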